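(* Let $n\ge2$. For a kernel $K:\mathbb{B}^n\times\mathbb{B}^n\to\mathbb{R}$ the following are equivalent. 1) $K$ is continuous and invariant under the left action of $O(n)$. 2) There exist continuous radial kernels $c_l:[0,1]\times[0,1]\to\mathbb{R}$, $l=0,1,2,\dots$, with $c_l(0,0)=0$ for $l\ge1$ and $\max_{r\in[0,1]}\sum_{l=0}^\infty c_l(r,r)<\infty$, such that $K=\sum_{l=0}^\infty c_l\otimes C_l^{n/2-1}$, i.e. for any $r_1,r_2\in[0,1]$ and $\theta_1,\theta_2\in\mathbb{S}^{n-1}$, $$K(r_1\theta_1,r_2\theta_2)=\sum_{l=0}^\infty c_l(r_1,r_2)\,C_l^{n/2-1}(\theta_1^\top\theta_2),$$ where the sum converges absolutely and uniformly. Also, the $l$-th radial kernel $c_l$ is given by $$c_l(r_1,r_2)=\frac{1}{p_l^{n/2-1}|\mathbb{S}^{n-2}|}\int_{\mathbb{S}^{n-1}}K(r_1\theta_1,r_2\theta_2)\,C_l^{n/2-1}(\theta_1^\top\theta_2)\,d\theta_2,$$ independent of the choice of $\theta_1\in\mathbb{S}^{n-1}$.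
   Context: $\mathbb{B}^n$ is the closed unit ball and $\mathbb{S}^{n-1}$ the unit sphere of $\mathbb{R}^n$; $|\mathbb{S}^{m}|$ is the surface measure of $\mathbb{S}^m$ ($|\mathbb{S}^0|=2$), and $d\theta$ is (unnormalized) surface measure. A kernel on a set $E$ is a real symmetric positive semidefinite function on $E\times E$. $K$ is invariant under the left action of $O(n)$ if $K(\mathbf{z}_1,\mathbf{z}_2)=K(R^\top\mathbf{z}_1,R^\top\mathbf{z}_2)$ for all $R\in O(n)$, $\mathbf{z}_1,\mathbf{z}_2\in\mathbb{B}^n$. A radial kernel is a kernel on $[0,1]$. For $\lambda>-1/2$, $C_l^\lambda$ denotes the Gegenbauer polynomial of degree $l$: the orthogonal polynomials on $[-1,1]$ with respect to the weight $(1-s^2)^{\lambda-1/2}$, normalized by $C_l^\lambda(1)=1$ (so $C_l^0$ are the Chebyshev polynomials of the first kind). $p_l^\lambda:=\int_{-1}^1(1-s^2)^{\lambda-1/2}C_l^\lambda(s)^2\,ds>0$. *)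

(* Defs.v *)
From HB Require Import structures.
From mathcomp Require Import all_boot all_order all_algebra.
From mathcomp Require Import all_classical all_reals all_analysis.
From mathcomp Require Import measurable_realfun.
Import Order.TTheory GRing.Theory Num.Theory.
Import numFieldNormedType.Exports.

Set Implicit Arguments.
Unset Strict Implicit.
Unset Printing Implicit Defensive.

Local Open Scope classical_set_scope.
Local Open Scope ring_scope.

(** Points of R^n are column vectors.  The norm that the library puts on
    matrices is the sup norm, so the Euclidean norm is introduced separately;
    the library topology on ['cV[R]_n] is the usual one. *)

Definition dotv (R : realType) (n : nat) (x y : 'cV[R]_n) : R :=
  (x^T *m y) 0 0.

Definition enorm (R : realType) (n : nat) (x : 'cV[R]_n) : R :=
  Num.sqrt (dotv x x).

Definition unit_ball (R : realType) (n : nat) : set 'cV[R]_n :=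
  [set x | enorm x <= 1].

Definition unit_sphere (R : realType) (n : nat) : set 'cV[R]_n :=
  [set x | enorm x = 1].

Definition unit_interval (R : realType) : set R := `[0, 1]%classic.

Arguments unit_ball : clear implicits.
Arguments unit_sphere : clear implicits.
Arguments unit_interval : clear implicits.

(** ** Borel sigma-algebra and Lebesgue measure on R^n *)

Definition measure_cV_display : measure_display -> measure_display.
Proof. exact. Qed.

Section measurable_cV.
Context {d} {T : sigmaRingType d}.
Variable n : nat.

Let coors : 'I_n -> 'cV[T]_n -> T := fun i x => x i 0.

Let cV_set0 : g_sigma_preimage coors set0.
Proof. exact: sigma_algebra0. Qed.

Let cV_setC A : g_sigma_preimage coors A -> g_sigma_preimage coors (~` A).
Proof. exact: sigma_algebraC. Qed.

Let cV_bigcup (F : _^nat) : (forall i, g_sigma_preimage coors (F i)) ->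
  g_sigma_preimage coors (\bigcup_i (F i)).
Proof. exact: sigma_algebra_bigcup. Qed.

HB.instance Definition _ := @isMeasurable.Build (measure_cV_display d)
  'cV[T]_n (g_sigma_preimage coors) cV_set0 cV_setC cV_bigcup.

End measurable_cV.

Section measurable_coord.
Context d (T : measurableType d) (n : nat).

Lemma measurable_coord (i : 'I_n) :
  measurable_fun [set: 'cV[T]_n] (fun x : 'cV[T]_n => x i 0).
Proof.
move=> _ Y mY; rewrite setTI; apply: sub_sigma_algebra => /=.
rewrite -bigcup_seq/=; exists i => /=; first by rewrite mem_index_enum.
by exists Y => //; rewrite setTI.
Qed.

Lemma measurable_fun_coordP d1 (T1 : measurableType d1) (f : T1 -> 'cV[T]_n) :
  (forall i, measurable_fun [set: T1] (fun x => f x i 0)) ->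
  measurable_fun [set: T1] f.
Proof.
move=> mf.
have h : g_sigma_preimage (fun i (x : T1) => f x i 0) `<=` measurable.
  apply: smallest_sub; first exact: sigma_algebra_measurable.
  by rewrite -bigcup_seq => A [i _] [B mB <-]; exact: mf.
move=> _ A mA; apply: h.
rewrite (g_sigma_preimage_comp (fun i (x : 'cV[T]_n) => x i 0) f).
by exists A.
Qed.

End measurable_coord.

(** In the library the canonical sigma-finite structure of [m1 \x m2] is only
    found for sub-probabilities, hence this explicit lemma. *)
Lemma product_sigma_finite d1 d2 (T1 : measurableType d1)
    (T2 : measurableType d2) (R : realType)
    (m1 : {sigma_finite_measure set T1 -> \bar R})
    (m2 : {sigma_finite_measure set T2 -> \bar R}) :
  sigma_finite setT (m1 \x m2)%E.
Proof.
have /sigma_finiteP[F [TF ndF Foo]] := sigma_finiteT m1.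
have /sigma_finiteP[G [TG ndG Goo]] := sigma_finiteT m2.
exists (fun n => F n `*` G n).
  rewrite -setXTT TF TG predeqE => -[x y]; split.
    move=> [/= [n _ Fnx] [k _ Gky]]; exists (maxn n k) => //; split.
    - by move: x Fnx; exact/subsetPset/ndF/leq_maxl.
    - by move: y Gky; exact/subsetPset/ndG/leq_maxr.
  by move=> [n _ []/= ? ?]; split; exists n.
move=> k; have [? ?] := Foo k; have [? ?] := Goo k.
split; first exact: measurableX.
by rewrite product_measure1E// lte_mul_pinfty// ge0_fin_numE.
Qed.

Section lebesgue_cV.
Context (R : realType).

Definition cons_cV (n : nat) (p : R * 'cV[R]_n) : 'cV[R]_n.+1 :=
  col_mx (const_mx p.1 : 'cV[R]_1) p.2.

Let uncons_cV (n : nat) (x : 'cV[R]_n.+1) : R * 'cV[R]_n :=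
  (x ord0 0, \col_(i < n) x (lift ord0 i) 0).

Let cons_cV0 n (p : R * 'cV[R]_n) : cons_cV p ord0 0 = p.1.
Proof.
have -> : ord0 = lshift n 0 :> 'I_(1 + n) by exact: val_inj.
by apply: etrans (col_mxEu (const_mx p.1) p.2 0 0) _; rewrite mxE.
Qed.

Let cons_cVS n (p : R * 'cV[R]_n) i : cons_cV p (lift ord0 i) 0 = p.2 i 0.
Proof.
have -> : lift ord0 i = rshift 1 i :> 'I_(1 + n) by exact: val_inj.
exact: (col_mxEd (const_mx p.1 : 'cV_1)).
Qed.

Lemma measurable_cons_cV n :
  measurable_fun [set: R * 'cV[R]_n] (@cons_cV n).
Proof.
apply: measurable_fun_coordP => i.
have [->|[j ->]] : i = ord0 \/ exists j, i = lift ord0 j.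
  by case: (unliftP ord0 i) => [j ->|->]; [right; exists j|left].
- by under eq_fun do rewrite cons_cV0; exact: measurable_fst.
- under eq_fun do rewrite cons_cVS.
  by apply: (measurableT_comp (measurable_coord j)); exact: measurable_snd.
Qed.

Let cons_cVK n : cancel (@cons_cV n) (@uncons_cV n).
Proof.
move=> p; rewrite /uncons_cV cons_cV0 [RHS]surjective_pairing; congr pair.
by apply/colP => i; rewrite mxE cons_cVS.
Qed.

Let uncons_cVK n : cancel (@uncons_cV n) (@cons_cV n).
Proof.
move=> x; apply/colP => i.
by case: (unliftP ord0 i) => [j ->|->]; rewrite (cons_cVS, cons_cV0)//= mxE.
Qed.

Let measurable_uncons_cV n :
  measurable_fun [set: 'cV[R]_n.+1] (@uncons_cV n).
Proof.
apply: measurable_fun_pair; first exact: measurable_coord.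
apply: measurable_fun_coordP => i; under eq_fun do rewrite mxE.
exact: measurable_coord.
Qed.



Section step.
Variables (n : nat) (mu : {sigma_finite_measure set 'cV[R]_n -> \bar R}).

Definition lebesgue_cons : set 'cV[R]_n.+1 -> \bar R :=
  pushforward (@lebesgue_measure R \x mu)%E (@cons_cV n).

Let mcons := @measurable_cons_cV n.

Let lebesgue_cons0 : lebesgue_cons set0 = 0%E.
Proof. exact: measure0. Qed.

Let lebesgue_cons_ge0 A : (0 <= lebesgue_cons A)%E.
Proof. exact: measure_ge0. Qed.

Let lebesgue_cons_sigma_additive : semi_sigma_additive lebesgue_cons.
Proof. exact: measure_semi_sigma_additive. Qed.

HB.instance Definition _ := isMeasure.Build _ _ _ lebesgue_cons
  lebesgue_cons0 lebesgue_cons_ge0 lebesgue_cons_sigma_additive.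

Let lebesgue_cons_sigma_finite : sigma_finite setT lebesgue_cons.
Proof.
have [F FT Foo] := product_sigma_finite (@lebesgue_measure R) mu.
exists (fun k => @uncons_cV n @^-1` F k).
  by rewrite -preimage_bigcup -FT preimage_setT.
move=> k; have [mF Fk] := Foo k; split.
  by rewrite -[X in measurable X]setTI; exact: measurable_uncons_cV.
rewrite /lebesgue_cons /pushforward -comp_preimage.
by rewrite (_ : _ \o _ = id)//; apply/funext => p; exact: cons_cVK.
Qed.

HB.instance Definition _ := Measure_isSigmaFinite.Build _ _ _ lebesgue_cons
  lebesgue_cons_sigma_finite.

End step.

Fixpoint lebesgue_cV (n : nat) : {sigma_finite_measure set 'cV[R]_n -> \bar R} :=
  if n is m.+1 then lebesgue_cons (lebesgue_cV m) else \d_(0 : 'cV[R]_0).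

End lebesgue_cV.

(** ** Surface measure on the unit sphere

    The surface measure of a set [A] of unit vectors is [n] times the volume
    of the part of the unit ball that lies on the rays through [A].  For
    [n = 1] this is the counting measure on [{-1, 1}]. *)

Section surface_measure.
Context (R : realType) (n : nat).

Definition normalize (x : 'cV[R]_n) : 'cV[R]_n := (enorm x)^-1 *: x.

Definition cone (A : set 'cV[R]_n) : set 'cV[R]_n :=
  normalize @^-1` A `&` [set x | 0 < enorm x <= 1].

Definition surface_measure (A : set 'cV[R]_n) : \bar R :=
  (n%:R%:E * lebesgue_cV R n (cone A))%E.

Let dotvE (x y : 'cV[R]_n) : dotv x y = \sum_(i < n) x i 0 * y i 0.
Proof. by rewrite /dotv mxE; apply: eq_bigr => i _; rewrite mxE. Qed.

Lemma measurable_enorm : measurable_fun [set: 'cV[R]_n] (@enorm R n).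
Proof.
apply: measurableT_comp.
  by apply: continuous_measurable_fun; exact: sqrt_continuous.
under eq_fun do rewrite dotvE.
by apply: measurable_sum => i; apply: measurable_funM; exact: measurable_coord.
Qed.

Lemma measurable_normalize : measurable_fun [set: 'cV[R]_n] normalize.
Proof.
apply: measurable_fun_coordP => i; under eq_fun do rewrite mxE.
apply: measurable_funM; last exact: measurable_coord.
under eq_fun do rewrite -powR_inv1 ?sqrtr_ge0//.
by apply: (measurableT_comp (measurable_powR _)); exact: measurable_enorm.
Qed.

Let measurable_punctured_ball :
  measurable [set x : 'cV[R]_n | 0 < enorm x <= 1].
Proof.
rewrite (_ : [set x | _] = setT `&` @enorm R n @^-1` `]0, 1]%classic).
  by apply: measurable_enorm => //; exact: measurable_itv.
by rewrite setTI; apply/seteqP; split=> x; rewrite /= in_itv.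
Qed.

Let mu : {measure set 'cV[R]_n -> \bar R} :=
  mscale (n%:R)%:nng (mrestr (lebesgue_cV R n) measurable_punctured_ball).

Let surface_measureE : surface_measure = pushforward mu normalize.
Proof. by []. Qed.

Let mnormalize := measurable_normalize.

Let surface_measure0 : surface_measure set0 = 0%E.
Proof. by rewrite surface_measureE; exact: measure0. Qed.

Let surface_measure_ge0 A : (0 <= surface_measure A)%E.
Proof. by rewrite surface_measureE; exact: measure_ge0. Qed.

Let surface_measure_sigma_additive : semi_sigma_additive surface_measure.
Proof. by rewrite surface_measureE; exact: measure_semi_sigma_additive. Qed.

HB.instance Definition _ := isMeasure.Build _ _ _ surface_measure
  surface_measure0 surface_measure_ge0 surface_measure_sigma_additive.

End surface_measure.
Arguments surface_measure : clear implicits.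

(** [sphere_area R n] is the area of the unit sphere of R^n, that is
    |S^(n-1)| (and not |S^n|). *)
Definition sphere_area (R : realType) (n : nat) : R :=
  fine (surface_measure R n (unit_sphere R n)).

(** ** Kernels

    A function on [E * E] is represented by a total function on [T * T] of
    which only the values on [E * E] are constrained. *)

Definition is_kernel (R : realType) (T : Type) (E : set T) (K : T -> T -> R) :
    Prop :=
  (forall x y, E x -> E y -> K x y = K y x) /\
  (forall (m : nat) (x : 'I_m -> T) (a : 'I_m -> R), (forall i, E (x i)) ->
     0 <= \sum_(i < m) \sum_(j < m) a i * a j * K (x i) (x j)).

Definition kernel_continuous (R : realType) (T : topologicalType) (E : set T)
    (K : T -> T -> R) : Prop :=
  {within E `*` E, continuous (fun p : T * T => K p.1 p.2)}.

Definition orthogonal_mx (R : realType) (n : nat) (Q : 'M[R]_n) : Prop :=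
  Q^T *m Q = 1%:M.

Definition O_invariant (R : realType) (n : nat)
    (K : 'cV[R]_n -> 'cV[R]_n -> R) : Prop :=
  forall (Q : 'M[R]_n) (z1 z2 : 'cV[R]_n), orthogonal_mx Q ->
    unit_ball R n z1 -> unit_ball R n z2 ->
    K z1 z2 = K (Q^T *m z1) (Q^T *m z2).

(** ** Gegenbauer polynomials *)

Definition gegenbauer_weight (R : realType) (lam s : R) : R :=
  (1 - s ^+ 2) `^ (lam - 2^-1).

Definition is_gegenbauer (R : realType) (lam : R) (C : nat -> {poly R}) :
    Prop :=
  [/\ forall l, size (C l) = l.+1,
      forall l m, l != m ->
        \int[@lebesgue_measure R]_(s in `[(- 1), 1])
          (gegenbauer_weight lam s * (C l).[s] * (C m).[s]) = 0
    & forall l, (C l).[1] = 1].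

(** For [lam > -1/2] there is exactly one family satisfying
    [is_gegenbauer lam]; [gegenbauer lam] is that family. *)
Definition gegenbauer (R : realType) (lam : R) : nat -> {poly R} :=
  xget (fun=> 0) [set C | is_gegenbauer lam C].

Definition gegenbauer_sqnorm (R : realType) (lam : R) (l : nat) : R :=
  \int[@lebesgue_measure R]_(s in `[(- 1), 1])
    (gegenbauer_weight lam s * (gegenbauer lam l).[s] ^+ 2).

(** ** Radial expansions *)

(** The Gegenbauer index n/2 - 1 attached to R^n. *)
Definition geg_index (R : realType) (n : nat) : R := n%:R / 2 - 1.

(** Pairs (radius, direction). *)
Definition polar (R : realType) (n : nat) : set (R * 'cV[R]_n) :=
  unit_interval R `*` unit_sphere R n.
Arguments polar : clear implicits.

Definition expansion_term (R : realType) (n : nat) (c : nat -> R -> R -> R)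
    (x : (R * 'cV[R]_n) * (R * 'cV[R]_n)) (l : nat) : R :=
  c l x.1.1 x.2.1 * (gegenbauer (geg_index R n) l).[dotv x.1.2 x.2.2].

Definition radial_expansion (R : realType) (n : nat)
    (K : 'cV[R]_n -> 'cV[R]_n -> R) (c : nat -> R -> R -> R) : Prop :=
  [/\ forall l, is_kernel (unit_interval R) (c l) /\
                kernel_continuous (unit_interval R) (c l),
      forall l, (0 < l)%N -> c l 0 0 = 0,
      exists2 r0 : R, unit_interval R r0 &
        (\sum_(0 <= l <oo) (c l r0 r0)%:E < +oo)%E /\
        forall r : R, unit_interval R r ->
          (\sum_(0 <= l <oo) (c l r r)%:E <=
           \sum_(0 <= l <oo) (c l r0 r0)%:E)%E,
      (forall x, (polar R n `*` polar R n) x ->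
         cvgn [normed series (expansion_term c x)])
    & {uniform polar R n `*` polar R n,
        (fun (N : nat) x => series (expansion_term c x) N) @ \oo -->
        (fun x => K (x.1.1 *: x.1.2) (x.2.1 *: x.2.2))}].

(* Main.v *)
(** By two-point transitivity of the orthogonal group, an invariant [K] satisfies
    [K (r1 x) (r2 y) = kappa r1 r2 (x . y)] for unit vectors [x], [y], and [c_l r1 r2]
    is the [l]-th Gegenbauer coefficient of [kappa r1 r2].  Testing the positivity of
    [K] on combinations of a Dirac mass at a pole and of zonal densities, placed on
    spheres of various radii (the densities being approximated by finite samples),
    shows with the Funk-Hecke formula that [c_l] is positive semidefinite and that
    the sum of the [c_l r r] is at most [kappa r r 1].  Since Gegenbauer polynomials
    are bounded by 1 on [[-1, 1]], the expansion converges absolutely; it has the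
    same coefficients as the continuous function [kappa r1 r2], hence equals it by
    Weierstrass approximation.  At [r1 = r2] and [x = y] this is a series of
    nonnegative continuous functions with a continuous sum, so Dini's theorem makes
    the convergence uniform in the radius, and Cauchy-Schwarz for the [c_l]
    transfers it to all pairs.

    The Funk-Hecke formula and the bound by 1 come from zonal convolution on the
    sphere: it depends only on the Gram matrix of its two poles, because surface
    measure is rotation invariant.

    Conversely, [c_l 0 r = 0] for [l > 0] by positivity, so each term of an expansion
    is continuous on the ball, including at the origin, and so is the uniform limit.
    Integrating the uniformly convergent series against one Gegenbauer polynomial
    gives the coefficient formula. *)
Require Import Defs.
From HB Require Import structures.
From mathcomp Require Import all_boot all_order all_algebra.
From mathcomp Require Import all_classical all_reals all_analysis.
From mathcomp Require Import measurable_realfun.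
From mathcomp Require Import ring lra zify.
Import Order.TTheory GRing.Theory Num.Theory.
Import numFieldNormedType.Exports.
Local Open Scope classical_set_scope.
Local Open Scope ring_scope.

Set Implicit Arguments.
Unset Strict Implicit.
Unset Printing Implicit Defensive.

(** * Euclidean space and orthogonal maps *)

(** Lebesgue measure is an iterated product and surface measure is the volume of cones, so rotation
    invariance has to be earned: orthogonal maps are built from shears and reflections. Polar
    coordinates are avoided; zonal integrals agree with weighted integrals on [-1, 1] because both
    moment sequences satisfy (k + 1) m_k = (k + n) m_{k+2}. Double integrals over the sphere are
    never formed. Profiles are replaced by polynomials in the inner product, whose powers split into
    finitely many products of monomials; what remains is a finite quadratic form in monomial
    moments, and these are what finite samples approximate. The price is an error eps times the
    squared total variation of the test measures, which is fixed before eps tends to 0.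
    Normalization at 1 presupposes that orthogonal polynomials do not vanish there. This follows
    from Funk-Hecke, which is therefore proved before any normalization. For n = 2 the weight is
    unbounded at both endpoints, so the fundamental theorem of calculus is needed for integrands
    continuous only inside. For Bessel's inequality the test measure is a Dirac mass minus the
    truncated zonal reproducing kernel. *)

Section Euclid.
Variables (R : realType) (n : nat).
Implicit Types (x y z v : 'cV[R]_n) (Q : 'M[R]_n).

Lemma dotvE x y : dotv x y = \sum_(i < n) x i 0 * y i 0.
Proof. by rewrite /dotv mxE; apply: eq_bigr => i _; rewrite mxE. Qed.

Lemma dotvC x y : dotv x y = dotv y x.
Proof. by rewrite !dotvE; apply: eq_bigr => i _; rewrite mulrC. Qed.

Lemma dotvDl x y z : dotv (x + y) z = dotv x z + dotv y z.
Proof. by rewrite /dotv linearD /= mulmxDl mxE. Qed.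

Lemma dotvZl a x z : dotv (a *: x) z = a * dotv x z.
Proof. by rewrite /dotv linearZ /= -scalemxAl mxE. Qed.

Lemma dotvNl x z : dotv (- x) z = - dotv x z.
Proof. by rewrite -scaleN1r dotvZl mulN1r. Qed.

Lemma dotvDr x y z : dotv z (x + y) = dotv z x + dotv z y.
Proof. by rewrite dotvC dotvDl !(dotvC z). Qed.

Lemma dotvZr a x z : dotv z (a *: x) = a * dotv z x.
Proof. by rewrite dotvC dotvZl (dotvC z). Qed.

Lemma dotvNr x z : dotv z (- x) = - dotv z x.
Proof. by rewrite dotvC dotvNl (dotvC z). Qed.

Lemma dot0v z : dotv 0 z = 0.
Proof. by rewrite -(scale0r 0) dotvZl mul0r. Qed.

Lemma dotv0 z : dotv z 0 = 0.
Proof. by rewrite dotvC dot0v. Qed.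

Definition dotv_lin := (dotvDl, dotvDr, dotvZl, dotvZr, dotvNl, dotvNr).

Lemma dotvv_ge0 x : 0 <= dotv x x.
Proof. by rewrite dotvE sumr_ge0// => i _; rewrite -expr2 sqr_ge0. Qed.

Lemma dotvv_eq0 x : (dotv x x == 0) = (x == 0).
Proof.
apply/eqP/eqP => [|->]; last exact: dotv0.
move/eqP; rewrite dotvE psumr_eq0 => [/allP h|i _]; last by rewrite -expr2 sqr_ge0.
apply/colP => i; rewrite mxE; apply/eqP.
by have := h i (mem_index_enum i); rewrite /= mulf_eq0 orbb.
Qed.

Lemma dotv_sqr_le x y : dotv x y ^+ 2 <= dotv x x * dotv y y.
Proof.
have [->|x0] := eqVneq x 0; first by rewrite !dot0v expr0n mul0r.
have p : 0 < dotv x x by rewrite lt_def dotvv_eq0 x0 dotvv_ge0.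
have := dotvv_ge0 (dotv x x *: y - dotv x y *: x).
rewrite !dotv_lin (dotvC y x) => h.
rewrite -subr_ge0 -(pmulr_rge0 _ p); apply: le_trans h _.
by rewrite le_eqVlt; apply/orP; left; apply/eqP; ring.
Qed.

Lemma sqr_enorm x : enorm x ^+ 2 = dotv x x.
Proof. by rewrite /enorm sqr_sqrtr// dotvv_ge0. Qed.

Lemma enorm_ge0 x : 0 <= enorm x.
Proof. exact: sqrtr_ge0. Qed.

Lemma enorm0 : enorm (0 : 'cV[R]_n) = 0.
Proof. by rewrite /enorm dotv0 sqrtr0. Qed.

Lemma enorm_eq0 x : (enorm x == 0) = (x == 0).
Proof. by rewrite -dotvv_eq0 -sqr_enorm sqrf_eq0. Qed.

Lemma enormZ a x : enorm (a *: x) = `|a| * enorm x.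
Proof.
by rewrite /enorm dotvZl dotvZr mulrA -expr2 sqrtrM ?sqr_ge0// sqrtr_sqr.
Qed.

Lemma dotv_le x y : `|dotv x y| <= enorm x * enorm y.
Proof.
rewrite -(@ler_pXn2r _ 2)// ?nnegrE ?normr_ge0 ?mulr_ge0 ?enorm_ge0//.
by rewrite exprMn !sqr_enorm -normrX ger0_norm ?sqr_ge0// dotv_sqr_le.
Qed.

Lemma sphere_dotv x : unit_sphere R n x <-> dotv x x = 1.
Proof.
split => [/= h|h]; first by rewrite -sqr_enorm h expr1n.
by rewrite /unit_sphere /= /enorm h sqrtr1.
Qed.

Lemma sphere_dotv_itv x y : unit_sphere R n x -> unit_sphere R n y ->
  dotv x y \in `[-1, 1].
Proof. by move=> hx hy; rewrite in_itv/= -ler_norml (le_trans (dotv_le _ _))// hx hy mulr1. Qed.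

Lemma sphere_normalize x : x != 0 -> unit_sphere R n (normalize x).
Proof.
move=> x0; rewrite /unit_sphere /= /normalize enormZ ger0_norm ?invr_ge0 ?enorm_ge0//.
by rewrite mulVf// enorm_eq0.
Qed.

Lemma polar_ball (r : R) x : unit_interval R r -> unit_sphere R n x ->
  unit_ball R n (r *: x).
Proof.
rewrite /unit_interval /unit_ball /= in_itv /= => /andP[r0 r1] hx.
by rewrite enormZ hx mulr1 ger0_norm.
Qed.

Lemma polar_decomposition x : enorm x *: normalize x = x.
Proof.
have [->|x0] := eqVneq x 0; first by rewrite enorm0 scale0r.
by rewrite /normalize scalerA divff ?scale1r// enorm_eq0.
Qed.

Lemma orthogonal_tr Q : orthogonal_mx Q -> orthogonal_mx Q^T.
Proof. by rewrite /orthogonal_mx trmxK => /mulmx1C. Qed.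

Lemma orthogonalM Q1 Q2 : orthogonal_mx Q1 -> orthogonal_mx Q2 ->
  orthogonal_mx (Q1 *m Q2).
Proof.
rewrite /orthogonal_mx trmx_mul => h1 h2.
by rewrite mulmxA -(mulmxA Q2^T) h1 mulmx1.
Qed.

Lemma dotv_orthogonal Q x y : orthogonal_mx Q -> dotv (Q *m x) (Q *m y) = dotv x y.
Proof.
by move=> h; rewrite /dotv trmx_mul mulmxA -(mulmxA x^T) h mulmx1.
Qed.

Lemma enorm_orthogonal Q x : orthogonal_mx Q -> enorm (Q *m x) = enorm x.
Proof. by move=> h; rewrite /enorm dotv_orthogonal. Qed.

(** Reflection in the hyperplane orthogonal to [v]. For [v = 0] the inverse of 0 is 0 and this is
    the identity, so [householder (x - y)] maps [x] to [y] even when they coincide. *)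
Definition householder v : 'M[R]_n := 1%:M - (2 / dotv v v) *: (v *m v^T).

Lemma householderE v x :
  householder v *m x = x - (2 * dotv v x / dotv v v) *: v.
Proof.
rewrite /householder mulmxBl mul1mx -scalemxAl -mulmxA; congr (_ - _).
have -> : v^T *m x = (dotv v x)%:M by apply/matrixP => i j; rewrite !ord1 !mxE /= mulr1n /dotv mxE.
by rewrite mul_mx_scalar scalerA; congr (_ *: _); rewrite mulrAC.
Qed.

Lemma householder_orthogonal v : orthogonal_mx (householder v).
Proof.
rewrite /orthogonal_mx; have -> : (householder v)^T = householder v.
  by rewrite /householder linearB/= linearZ/= trmx1 trmx_mul trmxK.
rewrite {2}/householder mulmxBr mulmx1 -scalemxAr mulmxA householderE.
rewrite {1}/householder; have [->|v0] := eqVneq (dotv v v) 0.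
  by rewrite invr0 !mulr0 !scale0r !subr0.
set A := v *m v^T; rewrite mulmxBl -scalemxAl -/A.
set c := 2 / _; have -> : 2 * dotv v v / dotv v v = 2 by rewrite mulfK.
rewrite scaler_nat mulr2n -/A.
by rewrite opprD addrA subrr add0r scalerN opprK subrK.
Qed.

Lemma householder_swap x y : dotv x x = dotv y y -> householder (x - y) *m x = y.
Proof.
move=> h; rewrite householderE; have [xy|xy] := eqVneq x y.
  by rewrite xy subrr scaler0 subr0.
have d0 : dotv (x - y) (x - y) != 0 by rewrite dotvv_eq0 subr_eq0.
rewrite (_ : 2 * _ = dotv (x - y) (x - y)).
  by rewrite divff// scale1r opprB addrC subrK.
by rewrite !dotv_lin (dotvC y x) -h; ring.
Qed.

Lemma householder_fix v z : dotv v z = 0 -> householder v *m z = z.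
Proof. by move=> h; rewrite householderE h mulr0 mul0r scale0r subr0. Qed.

(** Two reflections suffice. The first takes [x1] to [y1]; the second takes the image of [x2] to
    [y2] and fixes [y1], because that image and [y2] have equal inner products with [y1]. *)
Lemma orthogonal_2transitive x1 x2 y1 y2 :
  dotv x1 x1 = dotv y1 y1 -> dotv x2 x2 = dotv y2 y2 -> dotv x1 x2 = dotv y1 y2 ->
  exists2 Q : 'M[R]_n, orthogonal_mx Q & Q *m x1 = y1 /\ Q *m x2 = y2.
Proof.
move=> h1 h2 h12; set H := householder (x1 - y1).
have oH : orthogonal_mx H by exact: householder_orthogonal.
set G := householder (H *m x2 - y2).
exists (G *m H); first by apply: orthogonalM => //; exact: householder_orthogonal.
have Hx1 : H *m x1 = y1 by exact: householder_swap.
rewrite -!mulmxA Hx1; split.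
  apply: householder_fix; rewrite dotvDl dotvNl -[in LHS]Hx1 dotv_orthogonal// dotvC h12.
  by rewrite Hx1 dotvC subrr.
by rewrite householder_swap// dotv_orthogonal.
Qed.

End Euclid.

(** * Rotation invariance of Lebesgue and surface measure *)

Section pullback_scaling.
Context (R : realType).

(** Preimages keep this closed under composition without inverses; the constant is then the
    reciprocal of the volume factor, such as [a ^- n] for dilation by [a]. *)
Definition scales d (T : measurableType d) (mu : set T -> \bar R) (c : R)
    (f : T -> T) : Prop :=
  measurable_fun [set: T] f /\
  forall A, measurable A -> mu (f @^-1` A) = (c%:E * mu A)%E.

Lemma scales_comp d (T : measurableType d) (mu : {measure set T -> \bar R}) c c'
    (f g : T -> T) : scales mu c f -> scales mu c' g ->
  scales mu (c * c') (f \o g).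
Proof.
move=> [mf cf] [mg cg]; split; first exact: measurableT_comp.
move=> A mA; have mfA : measurable (f @^-1` A) by rewrite -[X in measurable X]setTI; exact: mf.
by rewrite comp_preimage cg// cf// muleA -EFinM [c' * c]mulrC.
Qed.

Lemma scales_comp1 d (T : measurableType d) (mu : {measure set T -> \bar R})
    (f g : T -> T) : scales mu 1 f -> scales mu 1 g -> scales mu 1 (f \o g).
Proof. by move=> ? ?; rewrite -(mulr1 1); exact: scales_comp. Qed.

Lemma measurable_addr (a : R) : measurable_fun [set: R] (fun x => x + a).
Proof. by apply: measurable_funD => //. Qed.

Lemma scales_addr (a : R) : scales (@lebesgue_measure R) 1 (fun x => x + a).
Proof.
split; first exact: measurable_addr.
move=> A mA; rewrite mul1e.
have mf : measurable_fun [set: measurableTypeR R] (fun x : measurableTypeR R => (x + a : measurableTypeR R)).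
  exact: measurable_addr.
pose mu := pushforward (@lebesgue_measure R) (fun x : measurableTypeR R => x + a : measurableTypeR R).
suff -> : lebesgue_measure A = mu A by [].
apply: (lebesgue_measure_unique (mu := mu)) => // _ [[b c]] _ <-.
have E : (fun x : R => x + a) @^-1` `]b, c] = `](b - a), (c - a)]%classic.
  by apply/seteqP; split=> x /=; rewrite !in_itv/= ltrBlDr lerBrDr.
change (lebesgue_measure `]b, c] = lebesgue_measure ((fun x : R => x + a) @^-1` `]b, c])).
by rewrite E !lebesgue_measure_itv/= !lte_fin ltrD2r -!EFinB opprB addrA subrK.
Qed.

Lemma scales_opp : scales (@lebesgue_measure R) 1 -%R.
Proof.
split; first exact: oppr_measurable.
by move=> A mA; rewrite mul1e; exact: lebesgue_measureN.
Qed.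

Lemma scales_mulr (a : R) : 0 < a -> scales (@lebesgue_measure R) a^-1 (fun x => a * x).
Proof.
move=> a0; split; first by apply: measurable_funM => //.
move=> A mA.
have mf : measurable_fun [set: measurableTypeR R] (fun x : measurableTypeR R => (a * x : measurableTypeR R)).
  by apply: (@measurable_funM _ _ R) => //.
pose mu := mscale (NngNum (ltW a0)) (pushforward (@lebesgue_measure R) (fun x : measurableTypeR R => a * x : measurableTypeR R)).
have -> : lebesgue_measure A = mu mf A.
  apply: (lebesgue_measure_unique (mu := mu mf)) => // _ [[b c]] _ <-.
  have E : (fun x : R => a * x) @^-1` `]b, c] = `](b / a), (c / a)]%classic.
    apply/seteqP; split=> x /=; rewrite !in_itv/=;
    by rewrite ltr_pdivrMr// ler_pdivlMr// !(mulrC x).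
  change (lebesgue_measure `]b, c] = (a%:E * lebesgue_measure ((fun x : R => a * x)%R @^-1` `]b, c]))%E).
  rewrite E !lebesgue_measure_itv/= !lte_fin ltr_pM2r ?invr_gt0//.
  case: ifPn => _; last by rewrite mule0.
  by rewrite -!EFinB -EFinM -mulrBl mulrC divfK// gt_eqF.
by rewrite /mu /mscale/= muleA -EFinM mulVf ?mul1e// gt_eqF.
Qed.

End pullback_scaling.

Section product_fibres.
Context (R : realType) d1 d2 (T1 : measurableType d1) (T2 : measurableType d2).
Variables (m1 : {sigma_finite_measure set T1 -> \bar R})
          (m2 : {sigma_finite_measure set T2 -> \bar R}).

Lemma scales_fibre_snd c (t : T1 -> T2 -> T2) : 0 <= c ->
  measurable_fun [set: T1 * T2] (fun p => t p.1 p.2) ->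
  (forall x, scales m2 c (t x)) ->
  scales (m1 \x m2)%E c (fun p => (p.1, t p.1 p.2)).
Proof.
move=> c0 mt ht; have mT : measurable_fun [set: T1 * T2] (fun p => (p.1, t p.1 p.2)).
  by apply: measurable_fun_pair.
split=> // B mB; rewrite /product_measure1.
rewrite -ge0_integralZl//; last exact: measurable_fun_xsection.
apply: eq_integral => x _ /=; rewrite -(ht x).2; last exact: measurable_xsection.
by congr (m2 _); apply/seteqP; split=> y; rewrite /xsection /= !inE.
Qed.

(** Tonelli: the product measure integrates sections over the first factor, and maps acting on the
    first factor call for the other order. *)
Lemma product_measure12 B : measurable B -> (m1 \x m2)%E B = (m1 \x^ m2)%E B.
Proof.
move=> mB; apply: product_measure_unique => // A1 A2 mA1 mA2.
exact: product_measure2E.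
Qed.

Lemma scales_fibre_fst c (t : T2 -> T1 -> T1) : 0 <= c ->
  measurable_fun [set: T1 * T2] (fun p => t p.2 p.1) ->
  (forall y, scales m1 c (t y)) ->
  scales (m1 \x m2)%E c (fun p => (t p.2 p.1, p.2)).
Proof.
move=> c0 mt ht; have mT : measurable_fun [set: T1 * T2] (fun p => (t p.2 p.1, p.2)).
  by apply: measurable_fun_pair.
split=> // B mB; rewrite !product_measure12//; last first.
  by rewrite -[X in measurable X]setTI; exact: mT.
rewrite /product_measure2 -ge0_integralZl//; last exact: measurable_fun_ysection.
apply: eq_integral => x _ /=; rewrite -(ht x).2; last exact: measurable_ysection.
by congr (m1 _); apply/seteqP; split=> y; rewrite /ysection /= !inE.
Qed.

End product_fibres.

Arguments scales_fibre_fst {R d1 d2 T1 T2} m1 m2 {c} t.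
Arguments scales_fibre_snd {R d1 d2 T1 T2} m1 m2 {c} t.

(** * Lebesgue measure under translations, dilations and orthogonal maps *)

Section lebesgue_linear.
Context (R : realType).
Notation leb := (lebesgue_cV R).

Lemma scales_cons n c (f : 'cV[R]_n.+1 -> 'cV[R]_n.+1)
    (t : R * 'cV[R]_n -> R * 'cV[R]_n) :
  (forall p, f (cons_cV p) = cons_cV (t p)) ->
  measurable_fun [set: 'cV[R]_n.+1] f ->
  scales (@lebesgue_measure R \x leb n)%E c t -> scales (leb n.+1) c f.
Proof.
move=> ft mf [mt ht]; split=> // A mA.
rewrite /= /lebesgue_cons /pushforward -ht//; last first.
  by rewrite -[X in measurable X]setTI; exact: measurable_cons_cV.
by congr (product_measure1 _ _ _); apply/seteqP; split=> p /=; rewrite ft.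
Qed.

Lemma measurable_addcV n (b : 'cV[R]_n) : measurable_fun [set: 'cV[R]_n] (fun x => x + b).
Proof.
apply: measurable_fun_coordP => i; under eq_fun do rewrite mxE.
by apply: measurable_funD => //; exact: measurable_coord.
Qed.

Lemma measurable_mulmx n m (Q : 'M[R]_(m, n)) : measurable_fun [set: 'cV[R]_n] (mulmx Q).
Proof.
apply: measurable_fun_coordP => i; under eq_fun do rewrite mxE.
apply: measurable_sum => j; apply: measurable_funM => //; exact: measurable_coord.
Qed.

Lemma measurable_dotv n (v : 'cV[R]_n) : measurable_fun [set: 'cV[R]_n] (dotv v).
Proof.
rewrite (_ : dotv v = fun x => \sum_j v j 0 * x j 0).
  by apply: measurable_sum => j; apply: measurable_funM => //; exact: measurable_coord.
by apply/funext => x; rewrite dotvE.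
Qed.

Lemma scales_addcV n (b : 'cV[R]_n) : scales (leb n) 1 (fun x => x + b).
Proof.
elim: n b => [|n IH] b.
  split; first exact: measurable_addcV.
  move=> A _; rewrite mul1e; congr (_ _); apply/seteqP.
  by split=> x /=; rewrite [x + b]flatmx0 [x]flatmx0.
rewrite -[b](@vsubmxK _ 1 n) [usubmx _]mx11_scalar.
set b0 := _ 0 0; set b' := dsubmx _.
apply: (@scales_cons n 1 _ ((fun p => (p.1 + b0, p.2)) \o (fun p => (p.1, p.2 + b')))).
- move=> [x y]; rewrite /cons_cV/= [LHS](add_col_mx (const_mx x : 'cV_1) y).
  have -> : const_mx x + b0%:M = const_mx (x + b0) :> 'cV_1 by apply/colP => i; rewrite !ord1 !mxE.
  by [].
- exact: measurable_addcV.
- apply: scales_comp1.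
    apply: (scales_fibre_fst (@lebesgue_measure R) (leb n) (fun _ x => x + b0)) => //.
      by apply: measurableT_comp (measurable_addr _) _ => //.
    by move=> _; exact: scales_addr.
  apply: (scales_fibre_snd (@lebesgue_measure R) (leb n) (fun _ x => x + b')) => //.
  by apply: measurableT_comp (measurable_addcV _) _ => //.
Qed.

Lemma scales_scale n (a : R) : 0 < a -> scales (leb n) (a ^- n) (fun x => a *: x).
Proof.
move=> a0.
have ms k : measurable_fun [set: 'cV[R]_k] (fun x => a *: x).
  by under eq_fun do rewrite -mul_scalar_mx; exact: measurable_mulmx.
elim: n => [|n IH].
  split; [exact: ms|move=> A _]; rewrite expr0 invr1 mul1e; congr (_ _); apply/seteqP.
  by split=> x /=; rewrite [a *: x]flatmx0 [x]flatmx0.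
apply: (@scales_cons n _ _ ((fun p => (a * p.1, p.2)) \o (fun p => (p.1, a *: p.2)))).
- move=> [x y]; rewrite /cons_cV/= [LHS](scale_col_mx a (const_mx x : 'cV_1) y).
  have -> : a *: const_mx x = const_mx (a * x) :> 'cV_1 by apply/colP => i; rewrite !mxE.
  by [].
- exact: ms.
- rewrite exprS invfM; apply: scales_comp.
    apply: (scales_fibre_fst (@lebesgue_measure R) (leb n) (fun _ x => a * x)) => //; first by rewrite invr_ge0 ltW.
      by apply: measurable_funM => //.
    by move=> _; exact: scales_mulr.
  apply: (scales_fibre_snd (@lebesgue_measure R) (leb n) (fun _ x => a *: x)) => //; first by rewrite invr_ge0 exprn_ge0// ltW.
  by apply: (measurableT_comp (ms n)).
Qed.

Definition preserved n (Q : 'M[R]_n) := scales (leb n) 1 (mulmx Q).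

Lemma preservedM n (P Q : 'M[R]_n) : preserved P -> preserved Q -> preserved (P *m Q).
Proof.
move=> hP hQ; rewrite /preserved (_ : mulmx _ = mulmx P \o mulmx Q).
  exact: scales_comp1.
by apply/funext => x /=; rewrite mulmxA.
Qed.

Lemma mulmx_cons n (a : R) (u : 'rV[R]_n) (v : 'cV[R]_n) (Q : 'M[R]_n) p :
  (block_mx a%:M u v Q : 'M[R]_(1 + n)) *m (cons_cV p : 'cV[R]_(1 + n)) =
  cons_cV (a * p.1 + dotv u^T p.2, p.1 *: v + Q *m p.2).
Proof.
rewrite /cons_cV mul_block_col mul_scalar_mx; congr (col_mx _ _) => /=.
  by apply/colP => i; rewrite !ord1 !mxE; congr (_ + _); rewrite dotvE; apply: eq_bigr => j _; rewrite mxE.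
by congr (_ + _); apply/colP => i; rewrite !mxE big_ord1 mxE mulrC.
Qed.

(** A shear translates each line parallel to the first axis by an amount constant on that line, so
    translation invariance on fibres is enough. *)
Lemma preserved_shear_fst n (u : 'rV[R]_n) :
  preserved (block_mx 1%:M u 0 1%:M : 'M[R]_(1 + n)).
Proof.
apply: (@scales_cons n 1 _ (fun p => (p.1 + dotv u^T p.2, p.2))).
- by move=> p; rewrite mulmx_cons mul1r scaler0 add0r mul1mx.
- exact: measurable_mulmx.
- apply: (scales_fibre_fst (@lebesgue_measure R) (leb n) (fun y x => x + dotv u^T y)) => //.
    by apply: measurable_funD => //; apply: measurableT_comp (measurable_dotv _) _.
  by move=> y; exact: scales_addr.
Qed.

Lemma preserved_shear_snd n (v : 'cV[R]_n) :
  preserved (block_mx 1%:M 0 v 1%:M : 'M[R]_(1 + n)).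
Proof.
apply: (@scales_cons n 1 _ (fun p => (p.1, p.2 + p.1 *: v))).
- by move=> p; rewrite mulmx_cons trmx0 dot0v addr0 mul1r mul1mx addrC.
- exact: measurable_mulmx.
- apply: (scales_fibre_snd (@lebesgue_measure R) (leb n) (fun x y => y + x *: v)) => //.
    apply: measurable_fun_coordP => i; under eq_fun do rewrite !mxE.
    apply: measurable_funD; last by apply: measurable_funM => //.
    by apply: (measurableT_comp (measurable_coord i)) => //.
  by move=> x; exact: scales_addcV.
Qed.

Lemma preserved_reflection n : preserved (block_mx (-1)%:M 0 0 1%:M : 'M[R]_(1 + n)).
Proof.
apply: (@scales_cons n 1 _ (fun p => (- p.1, p.2))).
- by move=> p; rewrite mulmx_cons trmx0 dot0v addr0 mulN1r mul1mx scaler0 add0r.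
- exact: measurable_mulmx.
- apply: (scales_fibre_fst (@lebesgue_measure R) (leb n) (fun _ x => - x)) => //.
    by apply: measurableT_comp.
  by move=> _; exact: scales_opp.
Qed.

Lemma preserved_block n (Q : 'M[R]_n) : preserved Q ->
  preserved (block_mx 1%:M 0 0 Q : 'M[R]_(1 + n)).
Proof.
move=> hQ; apply: (@scales_cons n 1 _ (fun p => (p.1, Q *m p.2))).
- by move=> p; rewrite mulmx_cons trmx0 dot0v addr0 mul1r scaler0 add0r.
- exact: measurable_mulmx.
- apply: (scales_fibre_snd (@lebesgue_measure R) (leb n) (fun _ y => Q *m y)) => //.
  by apply: measurableT_comp (measurable_mulmx _) _.
Qed.

(* A rotation in the plane of [e_0] and [theta] is a product of three shears. *)
Lemma preserved_transitive n (a : R) (v : 'cV[R]_n) : a ^+ 2 + dotv v v = 1 ->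
  exists2 Q : 'M[R]_n, orthogonal_mx (block_mx a%:M (- v^T) v Q : 'M[R]_(1 + n)) &
    preserved (block_mx a%:M (- v^T) v Q : 'M[R]_(1 + n)).
Proof.
move=> h; have vv : v^T *m v = (1 - a ^+ 2)%:M.
  rewrite [LHS]mx11_scalar -/(dotv v v); congr _%:M; by rewrite -h addrAC subrr add0r.
(* The constant [1 / (1 + a)] breaks down exactly here; then [v = 0] and a reflection takes over. *)
have [a1|a1] := eqVneq a (-1).
  have v0 : v = 0.
    by apply/eqP; rewrite -dotvv_eq0; apply/eqP; move: h; rewrite a1; lra.
  exists 1%:M; rewrite v0 trmx0 oppr0 a1; last exact: preserved_reflection.
  rewrite /orthogonal_mx tr_block_mx !trmx0 mulmx_block !mulmx0 !mul0mx !trmx1 !mulmx1 !addr0 add0r.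
  by rewrite tr_scalar_mx -scalar_mxM mulrNN mulr1 -scalar_mx_block.
have a1' : 1 + a != 0 by rewrite addrC -(opprK 1) subr_eq0.
(* With [a = cos t] and [|v| = sin t], [d * |v|] is [tan (t / 2)], up to sign the slope of the outer
   shears. [P] multiplies [v] by [a] and fixes its orthogonal complement. *)
set d := (1 + a)^-1; pose P := 1%:M - d *: (v *m v^T).
have tP : P^T = P.
  by rewrite /P [LHS]linearB/= [in LHS]linearZ/= trmx1 trmx_mul trmxK.
have vP : v^T *m P = a *: v^T.
  rewrite /P mulmxBr mulmx1 -scalemxAr mulmxA vv mul_scalar_mx scalerA -[X in X - _]scale1r -scalerBl.
  by congr (_ *: _); rewrite /d; field.
have Pv : P *m v = a *: v.
  by apply: trmx_inj; rewrite trmx_mul tP vP linearZ.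
have PP : v *m v^T + P *m P = 1%:M.
  rewrite {1}/P mulmxBl mul1mx -scalemxAl -mulmxA vP -scalemxAr scalerA {1}/P.
  rewrite -addrA -opprD -scalerDl addrCA -[X in X - _]scale1r -scalerBl.
  by rewrite (_ : _ - _ = 0) ?scale0r ?addr0//; rewrite /d; field.
exists P.
  rewrite /orthogonal_mx tr_block_mx mulmx_block [(- v^T)^T]linearN/= trmxK tr_scalar_mx tP scalar_mx_block.
  rewrite !mulNmx !mulmxN opprK vP PP.
  rewrite [a%:M *m v^T]mul_scalar_mx [X in block_mx _ X]addNr [v *m a%:M]mul_mx_scalar Pv [X in block_mx _ _ X]addNr vv -scalar_mxM.
  rewrite (_ : _ + _ = 1%:M)//.
  by rewrite -[LHS](raddfD (@scalar_mx R 1))/=; congr _%:M; ring.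
set U := block_mx 1%:M (- d *: v^T) 0 1%:M : 'M[R]_(1 + n).
set L := block_mx 1%:M 0 v 1%:M : 'M[R]_(1 + n).
rewrite (_ : block_mx _ _ _ _ = U *m L *m U).
  apply: preservedM; last exact: preserved_shear_fst.
  by apply: preservedM; [exact: preserved_shear_fst|exact: preserved_shear_snd].
rewrite /U /L !mulmx_block !mulmx0 !mul0mx !mulmx1 !mul1mx !addr0 !add0r.
rewrite -!scalemxAl -!scalemxAr vv.
have e : (1%:M + - d *: (1 - a ^+ 2)%:M : 'M[R]_1) = a%:M.
  by rewrite scale_scalar_mx -[LHS](raddfD (@scalar_mx R 1))/=; congr _%:M; rewrite /d; field.
rewrite e mul_scalar_mx; congr block_mx.
  by rewrite scalerA -scalerDl -scaleN1r; congr (_ *: _); rewrite /d; field.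
by rewrite addrC scaleNr.
Qed.

(** Induction on the dimension: [S] has the same first column as [Q], so [S^T *m Q] fixes the first
    basis vector and, being orthogonal, splits into 1 and an orthogonal matrix of lower size. *)
Theorem orthogonal_preserved n (Q : 'M[R]_n) : orthogonal_mx Q -> preserved Q.
Proof.
elim: n Q => [|n IH] Q oQ.
  split; first exact: measurable_mulmx.
  move=> A _; rewrite mul1e; congr (_ _); apply/seteqP.
  by split=> x /=; rewrite [_ *m x]flatmx0 [x]flatmx0.
have /= Qb := @submxK _ 1 n 1 n Q.
set a := (ulsubmx (Q : 'M[R]_(1 + n, 1 + n))) 0 0.
set v := dlsubmx (Q : 'M[R]_(1 + n, 1 + n)).
have av : a ^+ 2 + dotv v v = 1.
  have := oQ; rewrite /orthogonal_mx -Qb (@tr_block_mx _ 1 n 1 n) (@mulmx_block _ 1 n 1 n 1 n) (@scalar_mx_block _ 1 n).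
  case/(@eq_block_mx _ 1 n 1 n) => /matrixP/(_ 0 0) + _ _ _.
  rewrite [X in X = _ -> _]mxE [X in X + _ = _ -> _]mxE big_ord1 [_^T 0 0]mxE -expr2.
  by rewrite [X in _ = X -> _]mxE eqxx.
have [Q' oS pS] := preserved_transitive av.
pose S : 'M[R]_(1 + n) := block_mx a%:M (- v^T) v Q'.
have {}oS : @orthogonal_mx R n.+1 S by exact: oS.
have {}pS : @preserved n.+1 S by exact: pS.
pose P : 'M[R]_n.+1 := S^T *m Q.
have oP : orthogonal_mx P by apply: orthogonalM => //; exact: orthogonal_tr.
have QE : Q = S *m P by rewrite /P mulmxA (mulmx1C oS) mul1mx.
pose e0 : 'cV[R]_n.+1 := col_mx (1%:M : 'M[R]_1) (0 : 'cV[R]_n).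
have Se0 : S *m e0 = Q *m e0.
  rewrite -[in RHS]Qb /S /e0 !(@mul_block_col _ 1 n 1 n) !mulmx1 !mulmx0 !addr0; congr (col_mx _ _).
  by rewrite [RHS]mx11_scalar.
have Pe0 : P *m e0 = e0 by rewrite /P -mulmxA -Se0 mulmxA oS mul1mx.
have /= Pb := @submxK _ 1 n 1 n P.
move: Pe0; rewrite -Pb /e0 (@mul_block_col _ 1 n 1 n) !mulmx1 !mulmx0 !addr0.
case/(@eq_col_mx _ 1 n 1) => P1 P0.
have := oP; rewrite /orthogonal_mx -Pb P1 P0 (@tr_block_mx _ 1 n 1 n) (@mulmx_block _ 1 n 1 n 1 n) (@scalar_mx_block _ 1 n).
rewrite !trmx0 !trmx1 !mul1mx !mul0mx !addr0 !mulmx1.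
case/(@eq_block_mx _ 1 n 1 n) => _ P01 _; rewrite P01 mulmx0 add0r => oP'.
rewrite QE -Pb P1 P0 P01; apply: preservedM => //.
by apply: preserved_block; exact: IH.
Qed.

End lebesgue_linear.

(** * Surface measure as cone volume, and volumes of balls *)

Section surface.
Context (R : realType).
Notation leb := (lebesgue_cV R).
Notation sigma := (surface_measure R).

Definition punctured_unit_ball n : set 'cV[R]_n := [set x | 0 < enorm x <= 1].

Arguments punctured_unit_ball : clear implicits.

Lemma measurable_punctured_unit_ball n : measurable (punctured_unit_ball n).
Proof.
rewrite (_ : punctured_unit_ball n = setT `&` @enorm R n @^-1` `]0, 1]%classic).
  by apply: measurable_enorm => //; exact: measurable_itv.
by rewrite setTI; apply/seteqP; split=> x; rewrite /= in_itv.
Qed.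

Lemma measurable_enorm_le n (r : R) : measurable [set x : 'cV[R]_n | enorm x <= r].
Proof.
rewrite (_ : [set x | _] = setT `&` @enorm R n @^-1` `]-oo, r]%classic).
  by apply: measurable_enorm => //; exact: measurable_itv.
by rewrite setTI; apply/seteqP; split=> x; rewrite /= in_itv.
Qed.

Lemma measurable_unit_sphere n : measurable (unit_sphere R n).
Proof.
rewrite (_ : unit_sphere R n = setT `&` @enorm R n @^-1` [set 1]).
  by apply: measurable_enorm.
by rewrite setTI.
Qed.

Lemma measurable_cone n (A : set 'cV[R]_n) : measurable A -> measurable (cone A).
Proof.
move=> mA; apply: measurableI; last exact: measurable_punctured_unit_ball.
by rewrite -[X in measurable X]setTI; exact: measurable_normalize.
Qed.

Lemma surface_orthogonal n (Q : 'M[R]_n) : orthogonal_mx Q ->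
  scales (sigma n) 1 (mulmx Q).
Proof.
move=> oQ; split; first exact: measurable_mulmx.
move=> A mA; rewrite mul1e /surface_measure; congr (_ * _)%E.
have [_] := orthogonal_preserved oQ => /(_ _ (measurable_cone mA)); rewrite mul1e => <-.
congr (leb n _); apply/seteqP.
by split=> x /=; rewrite /cone/= enorm_orthogonal// /normalize /= enorm_orthogonal// scalemxAr.
Qed.

Lemma surface_sphere n : sigma n (unit_sphere R n) = (n%:R%:E * leb n (punctured_unit_ball n))%E.
Proof.
rewrite /surface_measure; congr (_ * leb n _)%E; apply/seteqP; split=> [x []//|x /= h].
split=> //; apply: sphere_normalize; rewrite -enorm_eq0 gt_eqF//.
by case/andP: h.
Qed.

Lemma measurable_set1cV0 n : measurable [set (0 : 'cV[R]_n)].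
Proof.
rewrite (_ : [set 0] = [set x : 'cV[R]_n | enorm x <= 0]); first exact: measurable_enorm_le.
apply/seteqP; split=> x /=; first by move->; rewrite enorm0.
by move=> h; apply/eqP; rewrite -enorm_eq0 eq_le h enorm_ge0.
Qed.

Lemma leb_set1cV0 n : leb n.+1 [set 0] = 0%E.
Proof.
rewrite /= /lebesgue_cons /pushforward (_ : _ @^-1` _ = [set 0] `*` [set 0]).
  rewrite product_measure1E//=.
    by rewrite lebesgue_measure_set1 mul0e.
  exact: measurable_set1cV0.
apply/seteqP; split=> [[x y]|[x y]]/=; rewrite /cons_cV /=.
  rewrite -(@col_mx0 _ 1 n 1) => /(@eq_col_mx _ 1 n 1)[/matrixP/(_ 0 0) + ->].
  by rewrite !mxE => ->.
move=> [-> ->]; have -> : const_mx 0 = 0 :> 'cV[R]_1 by apply/matrixP => i j; rewrite !mxE.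
by rewrite col_mx0.
Qed.

Lemma leb_ball_scale n (r : R) : 0 < r ->
  leb n [set x | (enorm x <= r)%R] = ((r ^+ n)%:E * leb n (unit_ball R n))%E.
Proof.
move=> r0; have r0' : 0 < r^-1 by rewrite invr_gt0.
have [_] := scales_scale n r0' => /(_ _ (@measurable_enorm_le n 1)).
rewrite exprVn invrK /unit_ball => <-; congr (leb n _); apply/seteqP.
by split=> x /=; rewrite enormZ gtr0_norm// ler_pdivrMl// mulr1.
Qed.

Lemma sqr_enorm_cons n (p : R * 'cV[R]_n) :
  enorm (cons_cV p) ^+ 2 = p.1 ^+ 2 + enorm p.2 ^+ 2.
Proof.
rewrite !sqr_enorm /dotv /cons_cV (@tr_col_mx _ 1 n 1) (@mul_row_col _ 1 1 n 1) mxE; congr (_ + _).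
by rewrite mxE big_ord1 !mxE expr2.
Qed.

Definition vol n : R := fine (leb n (unit_ball R n)).

Definition halfcircle (s : R) : R := Num.sqrt (1 - s ^+ 2).

Lemma continuous_halfcircle : continuous halfcircle.
Proof.
move=> s; apply: continuous_comp; last exact: sqrt_continuous.
by apply: cvgB; [exact: cvg_cst|exact: exprn_continuous].
Qed.

Lemma continuous_moment k m : continuous (fun s : R => s ^+ k * halfcircle s ^+ m).
Proof.
move=> s; apply: cvgM; first exact: exprn_continuous.
apply: (@continuous_comp _ _ _ halfcircle (fun x => x ^+ m)).
  exact: continuous_halfcircle.
exact: exprn_continuous.
Qed.

(** The slice at first coordinate [s] is a ball of radius [halfcircle s]. The endpoints are left out
    because the scaling law asks for a positive radius. *)
Lemma leb_ballS n : leb n.+1 (unit_ball R n.+1) =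
  (\int[@lebesgue_measure R]_(s in `](-1)%R, 1%R[) (leb n (unit_ball R n) * (halfcircle s ^+ n)%:E))%E.
Proof.
rewrite /= /lebesgue_cons /pushforward /product_measure1.
set B := _ @^-1` _.
have xB s y : B (s, y) <-> s ^+ 2 + enorm y ^+ 2 <= 1.
  by rewrite /B /unit_ball/= -[s ^+ 2 + _](sqr_enorm_cons (s, y)) expr_le1// enorm_ge0.
have mB : measurable B.
  by rewrite /B -[X in measurable X]setTI; apply: measurable_cons_cV => //; exact: measurable_enorm_le.
have -> : (\int[lebesgue_measure]_x ((leb n \o xsection B) x) =
   \int[lebesgue_measure]_(x in `[(-1)%R, 1%R]) ((leb n \o xsection B) x))%E.
  rewrite [RHS]integral_mkcond; apply: eq_integral => s _; rewrite patchE.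
  case: ifPn => //; rewrite notin_setE/= in_itv/= => /negP; rewrite -ler_norml -ltNge => s1.
  rewrite (_ : xsection B s = set0) ?measure0// -subset0 => y.
  rewrite /xsection/= inE xB => h.
  have : 1 < s ^+ 2 by rewrite -real_normK ?num_real// exprn_egt1.
  by have := sqr_ge0 (enorm y); lra.
rewrite -integral_itv_obnd_cbnd; last first.
  by apply: measurable_funTS; exact: measurable_fun_xsection.
rewrite -integral_itv_bndo_bndc; last first.
  by apply: measurable_funTS; exact: measurable_fun_xsection.
apply: eq_integral => s; rewrite inE/= in_itv/= -ltr_norml => s1.
have s2 : s ^+ 2 < 1 by rewrite -real_normK ?num_real// expr_lt1.
rewrite muleC -leb_ball_scale; last by rewrite /halfcircle sqrtr_gt0; lra.
congr (leb n _); apply/seteqP; split=> y; rewrite /xsection/= inE xB.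
  move=> h; rewrite -(@ler_pXn2r _ 2)// ?nnegrE ?enorm_ge0 ?sqrtr_ge0//.
  by rewrite [halfcircle s ^+ 2]sqr_sqrtr; lra.
rewrite -(@ler_pXn2r _ 2)// ?nnegrE ?enorm_ge0 ?sqrtr_ge0//.
by rewrite [halfcircle s ^+ 2]sqr_sqrtr; lra.
Qed.

End surface.
Arguments punctured_unit_ball : clear implicits.

(** * Integration against the Gegenbauer weight *)

Section one_dim_integration.
Context (R : realType).
Notation mu := (@lebesgue_measure R).

Lemma Rintegral_gt0 d (T : measurableType d) (m : {measure set T -> \bar R})
    (D : set T) (E : set T) (f : T -> R) (c : R) :
  measurable D -> measurable E -> E `<=` D -> (0 < m E)%E -> 0 < c ->
  m.-integrable D (EFin \o f) -> (forall x, D x -> 0 <= f x) ->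
  (forall x, E x -> c <= f x) -> 0 < \int[m]_(x in D) f x.
Proof.
move=> mD mE ED mE0 c0 intf f0 fc.
have mf : measurable_fun D (EFin \o f) by case/integrableP : intf.
rewrite /Rintegral fine_gt0//; apply/andP; split; last first.
  by have := integrable_fin_num mD intf; rewrite fin_numElt => /andP[].
apply: (@lt_le_trans _ _ (c%:E * m E)%E); first by rewrite mule_gt0.
apply: (@le_trans _ _ (\int[m]_(x in E) (f x)%:E)%E).
  rewrite -integral_cst//; apply: ge0_le_integral => //.
  - by move=> x _; rewrite lee_fin ltW.
  - exact: measurable_funS mf.
by apply: ge0_subset_integral => // x Dx; rewrite lee_fin f0.
Qed.

Lemma continuous_integrable (f : R -> R) a b :
  {within `[a, b], continuous f} -> mu.-integrable `[a, b] (EFin \o f).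
Proof. by move=> cf; apply: continuous_compact_integrable => //; exact: segment_compact. Qed.

(** The integrand may blow up at the endpoints. The indefinite integral minus [F] is continuous up
    to the endpoints and has zero derivative inside, so the mean value theorem makes its end values
    equal. *)
Lemma FTC_integrable (f F : R -> R) a b : a < b ->
  mu.-integrable `[a, b] (EFin \o f) ->
  (forall x : R, x \in `]a, b[ -> {for x, continuous f}) ->
  (forall x : R, x \in `]a, b[ -> is_derive x 1 F (f x)) ->
  {within `[a, b], continuous F} ->
  \int[mu]_(x in `[a, b]) f x = F b - F a.
Proof.
move=> ab intf cf dF cF.
pose G := parameterized_integral mu a ^~ f.
have cG : {within `[a, b], continuous G}.
  by apply: parameterized_integral_continuous => //; exact: ltW.
have dG x : x \in `]a, b[ -> is_derive x 1 G (f x).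
  move=> xab; move: (xab); rewrite in_itv/= => /andP[ax xb].
  have [dG <-] := continuous_FTC1_closed xb intf ax (cf x xab).
  by rewrite derive1E; exact: derivableP.
have [c cab] : exists2 c, c \in `]a, b[ & (G - F) b - (G - F) a = 0 * (b - a).
  apply: (@MVT R (G - F) (fun=> 0)) => //.
    by move=> x xab; rewrite -(subrr (f x)); apply: is_deriveB; [exact: dG|exact: dF].
  by move=> x; apply: cvgB; [exact: cG|exact: cF].
rewrite mul0r; change ((G b - F b) - (G a - F a) = 0 -> G b = F b - F a).
rewrite [G a](_ : _ = 0); last by rewrite /G /parameterized_integral set_itv1 Rintegral_set1.
lra.
Qed.

(** Finiteness, positivity and the recursion come together: [vol] passes through [fine], so it
    represents the volume only once finiteness is known. *)
Lemma volP n : lebesgue_cV R n (unit_ball R n) = (vol R n)%:E /\ 0 < vol R n /\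
  vol R n.+1 = vol R n * \int[mu]_(s in `[-1, 1]) (halfcircle s ^+ n).
Proof.
have ch k : continuous (fun s : R => halfcircle s ^+ k).
  rewrite (_ : (fun s => _) = fun s => s ^+ 0 * halfcircle s ^+ k); first exact: continuous_moment.
  by apply/funext => s; rewrite expr0 mul1r.
have mT k : measurable_fun [set: R] (fun s : R => (halfcircle s ^+ k)%:E).
  by apply/measurable_EFinP; apply: continuous_measurable_fun.
have intg k : mu.-integrable `[-1, 1] (EFin \o (fun s => halfcircle s ^+ k)).
  apply: continuous_integrable; exact: continuous_subspaceT.
have S k : lebesgue_cV R k (unit_ball R k) = (vol R k)%:E -> 0 < vol R k ->
    lebesgue_cV R k.+1 (unit_ball R k.+1) = (vol R k * \int[mu]_(s in `[-1, 1]) (halfcircle s ^+ k))%:E.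
  move=> h1 h2; rewrite leb_ballS h1 integralZl//; last first.
    apply: integrableS (intg k) => //; exact: subset_itv_oo_cc.
  rewrite EFinM; congr (_ * _)%E; rewrite /Rintegral fineK; last by apply: integrable_fin_num => //; exact: intg.
  rewrite -integral_itv_obnd_cbnd; last exact: measurable_funTS.
  by rewrite -integral_itv_bndo_bndc//; exact: measurable_funTS.
have m0 : (0 < mu `[0%R, 2^-1%R]%classic)%E.
  by rewrite lebesgue_measure_itv/= lte_fin invr_gt0 ltr0n/= sube0 lte_fin invr_gt0.
have pos k : 0 < \int[mu]_(s in `[-1, 1]) (halfcircle s ^+ k).
  apply: (@Rintegral_gt0 _ _ mu _ `[0, 2^-1]%classic _ (2^-1 ^+ k)) => //.
  - by apply: subset_itv; rewrite bnd_simp; lra.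
  - by move=> s _; rewrite exprn_ge0// sqrtr_ge0.
  - move=> s /=; rewrite in_itv/= => /andP[s0 s1].
    apply: lerXn2r; rewrite ?nnegrE ?sqrtr_ge0// /halfcircle.
    rewrite -[leLHS]ger0_norm// -sqrtr_sqr ler_sqrt; nra.
suff [h1 h2] : lebesgue_cV R n (unit_ball R n) = (vol R n)%:E /\ 0 < vol R n.
  by split=> //; split=> //; rewrite [LHS]/vol S.
elim: n => [|n [h1 h2]].
  rewrite /vol (_ : lebesgue_cV R 0 (unit_ball R 0) = 1%E)//.
  by rewrite /= diracE mem_set// /unit_ball/= enorm0.
by rewrite /vol S//=; split=> //; exact: mulr_gt0.
Qed.

Lemma surface_total n : (0 < n)%N ->
  surface_measure R n (unit_sphere R n) = (n%:R * vol R n)%:E.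
Proof.
case: n => // n _; rewrite surface_sphere EFinM; congr (_ * _)%E.
have [<- _] := volP n.+1.
have -> : unit_ball R n.+1 = [set 0] `|` punctured_unit_ball R n.+1.
  apply/seteqP; split=> x; rewrite /unit_ball /punctured_unit_ball /=.
    have [->|x0] := eqVneq x 0; first by left.
    by move=> ->; right; rewrite lt_def enorm_ge0 enorm_eq0 x0.
  by case=> [->|/andP[]//]; rewrite enorm0.
rewrite measureU//; last 2 first.
- exact: measurable_punctured_unit_ball.
- by apply/seteqP; split=> // x [/= ->]; rewrite /punctured_unit_ball/= enorm0 ltxx.
- by rewrite [X in (X + _)%E]leb_set1cV0 add0e.
- exact: measurable_set1cV0.
Qed.

Lemma sphere_areaE n : (0 < n)%N -> sphere_area R n = n%:R * vol R n.
Proof. by move=> n0; rewrite /sphere_area surface_total. Qed.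

Lemma sphere_area_gt0 n : (0 < n)%N -> 0 < sphere_area R n.
Proof. by move=> n0; rewrite sphere_areaE// mulr_gt0 ?ltr0n//; have [_ []] := volP n. Qed.

End one_dim_integration.

(** * Integrability of the Gegenbauer weight *)

Section weight.
Context (R : realType) (N : nat).
Hypothesis hN : (2 <= N)%N.
Notation mu := (@lebesgue_measure R).
Notation w := (gegenbauer_weight (geg_index R N)).
Implicit Types (g : R -> R) (s : R).

Lemma halfcircle_gt0 s : s \in `]-1, 1[ -> 0 < halfcircle s.
Proof. by rewrite in_itv/= => /andP[? ?]; rewrite /halfcircle sqrtr_gt0; nra. Qed.

Lemma sqr_halfcircle s : s \in `[-1, 1] -> halfcircle s ^+ 2 = 1 - s ^+ 2.
Proof. by rewrite in_itv/= => /andP[? ?]; rewrite sqr_sqrtr//; nra. Qed.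

Lemma itv_ooW s : s \in `]-1, 1[ -> s \in `[-1, 1].
Proof. by apply: subset_itv_oo_cc. Qed.

Lemma halfcircle_le1 s : halfcircle s <= 1.
Proof.
rewrite -[leRHS]sqrtr1 /halfcircle; have [h|h] := leP 0 (1 - s ^+ 2).
  by rewrite ler_sqrt//; have := sqr_ge0 s; lra.
by rewrite ler0_sqrtr// ltW.
Qed.

(** The exponent (N - 3) / 2 on [1 - s ^+ 2] is N - 3 on [halfcircle s]; the quotient keeps
    exponents natural when N = 2. *)
Lemma weightE s : s \in `]-1, 1[ -> w s = halfcircle s ^+ N.-2 / halfcircle s.
Proof.
move=> sI; have h0 := halfcircle_gt0 sI; have u0 : 0 < 1 - s ^+ 2.
  by rewrite -sqr_halfcircle ?itv_ooW// exprn_gt0.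
rewrite /gegenbauer_weight /geg_index.
have hE : halfcircle s = (1 - s ^+ 2) `^ 2^-1 by rewrite powR12_sqrt// ltW.
have -> : halfcircle s ^+ N.-2 / halfcircle s = halfcircle s `^ (N.-2%:R - 1).
  by rewrite powRD ?(gt_eqF h0) ?implybT// powR_mulrn ?powR_inv1// ltW.
rewrite hE -powRrM; congr (_ `^ _).
have [M ->] : exists M, N = M.+2 by exists N.-2; rewrite -[LHS](subnKC hN) addnC addn2 subn2.
by rewrite /= -addn2 natrD; field.
Qed.

Lemma weight_ge0 s : 0 <= w s.
Proof. exact: powR_ge0. Qed.

Lemma measurable_halfcircle : measurable_fun [set: R] (@halfcircle R).
Proof. by apply: continuous_measurable_fun; exact: continuous_halfcircle. Qed.

Lemma measurable_weight : measurable_fun [set: R] w.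
Proof.
apply: (measurableT_comp (measurable_powR _)).
by apply: measurable_funB => //; apply: measurable_funX.
Qed.

Lemma continuous_weight s : s \in `]-1, 1[ -> {for s, continuous w}.
Proof.
move=> sI; have h0 := halfcircle_gt0 sI.
have : (halfcircle x ^+ N.-2 / halfcircle x) @[x --> s] --> halfcircle s ^+ N.-2 / halfcircle s.
  apply: cvgM.
    apply: (@continuous_comp _ _ _ (@halfcircle R) (fun x => x ^+ N.-2)).
      exact: continuous_halfcircle.
    exact: exprn_continuous.
  by apply: cvgV; [rewrite gt_eqF|exact: continuous_halfcircle].
rewrite /prop_for /continuous_at weightE//; apply: cvg_trans.
apply: near_eq_cvg; near=> x; rewrite weightE//.
near: x; exact: near_in_itvoo.
Unshelve. all: by end_near. Qed.

(** The arcsine is an antiderivative, so [pi] bounds the integral uniformly in [d]; monotone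
    convergence passes this bound to the open interval. *)
Lemma integral_inv_halfcircle (d : R) : 0 < d -> d < 1 ->
  mu.-integrable `[- d, d] (EFin \o (fun s => (halfcircle s)^-1)) /\
  \int[mu]_(s in `[- d, d]) (halfcircle s)^-1 <= pi.
Proof.
move=> d0 d1.
have dd : - d < d by rewrite (lt_trans _ d0)// oppr_lt0.
have ci s : s \in `]-1, 1[ -> {for s, continuous (fun s => (halfcircle s)^-1)}.
  by move=> sI; apply: cvgV; [rewrite gt_eqF// halfcircle_gt0|exact: continuous_halfcircle].
have sb (x : R) : x \in `[- d, d] -> x \in `]-1, 1[.
  by rewrite !in_itv/= => /andP[x0 x1]; rewrite (lt_le_trans _ x0) ?(le_lt_trans x1)// ltrN2.
have oc (x : R) : x \in `]- d, d[ -> x \in `[- d, d].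
  by rewrite !in_itv/= => /andP[x0 x1]; rewrite !ltW.
have ii : mu.-integrable `[- d, d] (EFin \o (fun s => (halfcircle s)^-1)).
  apply: continuous_integrable; apply: continuous_in_subspaceT => x xF.
  by apply: ci; apply: sb; move: xF; rewrite inE.
split=> //.
have ai (x : R) : x \in `]-1, 1[ -> is_derive x 1 (@asin R) (halfcircle x)^-1.
  by rewrite in_itv/= => ?; exact: is_derive1_asin.
have cas : {within `[- d, d], continuous (@asin R)}.
  apply: continuous_in_subspaceT => x; rewrite inE => /sb.
  by rewrite in_itv/= => h; exact: continuous_asin.
rewrite (@FTC_integrable R (fun s => (halfcircle s)^-1) (@asin R) _ _ dd ii
  (fun x h => ci x (sb x (oc x h))) (fun x h => ai x (sb x (oc x h))) cas).
have d1' : -1 <= d <= 1 by rewrite (ltW d1) (le_trans _ (ltW d0))// lerN10.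
have d2' : -1 <= - d <= 1 by rewrite lerN2 (ltW d1) lerNl (le_trans _ (ltW d0))// lerN10.
by have := asin_lepi2 d1'; have := asin_geNpi2 d2'; move: (asin _) (asin _) pi => a b p *; lra.
Qed.

Let dil (i : nat) : R := 1 - i.+2%:R^-1.

Let dil_itv i : 0 < dil i < 1.
Proof.
rewrite /dil; apply/andP; split; last by rewrite ltrBlDr ltrDl invr_gt0 ltr0n.
by rewrite subr_gt0 invf_lt1 ?ltr0n// ltr1n.
Qed.

Lemma integrable_inv_halfcircle :
  mu.-integrable `](-1), 1[ (EFin \o (fun s => (halfcircle s)^-1)).
Proof.
have mi : measurable_fun [set: R] (fun s => (halfcircle s)^-1).
  under eq_fun do rewrite -powR_inv1 ?sqrtr_ge0//.
  by apply: (measurableT_comp (measurable_powR _)); exact: measurable_halfcircle.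
have i0 s : 0 <= (halfcircle s)^-1 by rewrite invr_ge0 sqrtr_ge0.
apply/integrableP; split; first by apply/measurable_EFinP; exact: measurable_funTS.
under eq_integral do rewrite /= ger0_norm//.
pose F i : set (measurableTypeR R) := `[- dil i, dil i]%classic.
have sub i : F i `<=` `](-1), 1[%classic.
  by apply: subset_itv; rewrite bnd_simp; have /andP[] := dil_itv i; lra.
have -> : `](-1), 1[%classic = \bigcup_i F i.
  apply/seteqP; split => [s|s [i _]]; last exact: sub.
  rewrite /= in_itv/= -ltr_norml => s1.
  exists (Num.truncn ((1 - `|s|)^-1)) => //.
  rewrite /F/= in_itv/= -ler_norml /dil lerBrDr -lerBrDl.
  have p : 0 < 1 - `|s| by rewrite subr_gt0.
  rewrite -[leRHS]invrK lef_pV2 ?posrE ?invr_gt0 ?ltr0n//.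
  apply: (le_trans (ltW (truncnS_gt _))); by rewrite ler_nat.
have ndF : nondecreasing_seq F.
  move=> i j ij; rewrite subsetEset; apply: subset_itv; rewrite bnd_simp /dil.
    by rewrite lerN2 lerB// lef_pV2 ?posrE ?ltr0n// ler_nat !ltnS.
  by rewrite lerB// lef_pV2 ?posrE ?ltr0n// ler_nat !ltnS.
have cv := @ge0_nondecreasing_set_cvg_integral _ _ _ F (fun s => ((halfcircle s)^-1)%:E) mu ndF.
apply: (@le_lt_trans _ _ pi%:E); last exact: ltry.
have {}cv : (\int[mu]_(x in F i) (halfcircle x)^-1%:E @[i --> \oo] -->
    \int[mu]_(x in \bigcup_i F i) (halfcircle x)^-1%:E)%E.
  apply: cv => [i|i|i s _].
  - exact: measurable_itv.
  - by apply/measurable_EFinP; exact: measurable_funTS.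
  - by rewrite lee_fin.
apply: (cvge_le _ cv).
apply: nearW => i; have /andP[d0 d1] := dil_itv i.
by have [ii] := integral_inv_halfcircle d0 d1; rewrite -lee_fin /Rintegral fineK//; exact: (integrable_fin_num _ ii).
Qed.

End weight.

(** * The weighted integral and its moment recursion *)

Section weighted_integral.
Context (R : realType) (N : nat).
Hypothesis hN : (2 <= N)%N.
Notation mu := (@lebesgue_measure R).
Notation w := (gegenbauer_weight (geg_index R N)).
Notation cI := (fun g : R -> R => {within `[-1, 1], continuous g}).
Implicit Types (g f : R -> R) (s : R).

(** Since [halfcircle] is at most 1, the weight for every N is dominated by the one for N = 2. *)
Lemma integrable_weight : mu.-integrable `[-1, 1] (EFin \o w).
Proof.
apply/integrableP; split; first by apply/measurable_EFinP; apply: measurable_funTS; exact: measurable_weight.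
have mw : measurable_fun [set: R] (fun s => `|(w s)%:E|%E).
  by apply: measurableT_comp => //; apply/measurable_EFinP; exact: measurable_weight.
rewrite -integral_itv_obnd_cbnd; last exact: measurable_funTS.
rewrite -integral_itv_bndo_bndc; last exact: measurable_funTS.
have /integrableP[mh] := integrable_inv_halfcircle R; apply: le_lt_trans.
apply: ge0_le_integral => //.
- exact: measurable_funTS.
- by apply: measurableT_comp mh.
- move=> s sI; have h0 := halfcircle_gt0 sI.
  rewrite /= lee_fin !ger0_norm ?weight_ge0 ?invr_ge0 ?(ltW h0)//.
  by rewrite weightE// ler_piMl ?invr_ge0 ?(ltW h0)// exprn_ile1 ?(ltW h0)// halfcircle_le1.
Qed.

Lemma cI_bounded g : cI g -> exists2 M : R, 0 <= M & forall s, s \in `[-1, 1] -> `|g s| <= M.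
Proof.
move=> cg; have cn : {within `[-1, 1], continuous (fun s => `|g s|)}.
  by apply: (@within_continuous_comp _ _ _ _ g (fun x : R => `|x|)) => // x _; exact: norm_continuous.
have [|c _ hc] := @EVT_max R (fun s => `|g s|) (-1) 1 _ cn; first lra.
by exists `|g c|.
Qed.

Lemma integrable_weightM g : cI g -> mu.-integrable `[-1, 1] (EFin \o (fun s => w s * g s)).
Proof.
move=> cg; have [M M0 hM] := cI_bounded cg.
have mg : measurable_fun (`[-1, 1]%classic : set R) g.
  by apply/measurable_EFinP; exact: measurable_int (continuous_integrable cg).
have iw : mu.-integrable `[-1, 1] (EFin \o (fun s => M * w s)).
  under [X in integrable _ _ X]eq_fun do rewrite /= EFinM.
  by apply: integrableZl => //; exact: integrable_weight.
apply: le_integrable iw => //.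
  apply/measurable_EFinP; apply: measurable_funM => //.
  by apply: measurable_funTS; exact: measurable_weight.
move=> s sI; rewrite /= lee_fin !normrM mulrC ler_wpM2r//.
by rewrite [leRHS]ger0_norm// hM.
Qed.

Definition wint g : R := \int[mu]_(s in `[-1, 1]) (w s * g s).

Lemma eq_wint f g : (forall s, s \in `[-1, 1] -> f s = g s) -> wint f = wint g.
Proof. by move=> h; apply: eq_Rintegral => s; rewrite inE => /h ->. Qed.

Lemma wintD f g : cI f -> cI g -> wint (fun s => f s + g s) = wint f + wint g.
Proof.
move=> cf cg; rewrite /wint -RintegralD//; [|exact: integrable_weightM|exact: integrable_weightM].
by apply: eq_Rintegral => s _; rewrite mulrDr.
Qed.

Lemma wintZ a f : cI f -> wint (fun s => a * f s) = a * wint f.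
Proof.
move=> cf; rewrite /wint -RintegralZl//; last exact: integrable_weightM.
by apply: eq_Rintegral => s _; rewrite mulrCA.
Qed.

Lemma wint_le f g : cI f -> cI g -> (forall s, s \in `[-1, 1] -> f s <= g s) ->
  wint f <= wint g.
Proof.
move=> cf cg fg; apply: le_Rintegral => //; [exact: integrable_weightM|exact: integrable_weightM|].
by move=> s sI; rewrite ler_wpM2l ?weight_ge0 ?fg.
Qed.

Lemma wint1_gt0 : 0 < wint (fun=> 1).
Proof.
have m0 : (0 < mu `[(- 2^-1)%R, 2^-1%R]%classic)%E.
  rewrite lebesgue_measure_itv/= lte_fin (_ : (- 2^-1 < 2^-1 :> R) = true); last by lra.
  by rewrite -EFinD lte_fin; lra.
apply: (@Rintegral_gt0 _ _ _ mu _ `[- 2^-1, 2^-1]%classic _ ((3 / 4) ^+ N.-2)) => //.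
- by apply: subset_itv; rewrite bnd_simp; lra.
- by apply: integrable_weightM; apply: continuous_subspaceT => x; exact: cvg_cst.
- by move=> s _; rewrite mulr1 weight_ge0.
move=> s /=; rewrite in_itv/= => /andP[s0 s1].
have sI : s \in `]-1, 1[ by rewrite in_itv/=; apply/andP; split; lra.
have h0 := halfcircle_gt0 sI; have h1 := halfcircle_le1 s.
have h2 := sqr_halfcircle (itv_ooW sI).
rewrite mulr1 weightE// -[leLHS]mulr1; apply: ler_pM.
- by rewrite exprn_ge0//; lra.
- by [].
- by apply: lerXn2r; rewrite ?nnegrE; nra.
- by rewrite invf_ge1//.
Qed.

(** [halfcircle s] is at least its square 1 - s^2, which is at least 2 eta - eta^2 and hence at
    least eta. *)
Lemma weight_ge (eta s : R) : 0 < eta -> `|s| <= 1 - eta -> eta ^+ N.-2 <= w s.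
Proof.
move=> e0 se; have sI : s \in `]-1, 1[ by rewrite in_itv/= -ltr_norml; lra.
have h0 := halfcircle_gt0 sI; have h1 := halfcircle_le1 s.
have h2 := sqr_halfcircle (itv_ooW sI).
have s2 : s ^+ 2 <= (1 - eta) ^+ 2.
  by rewrite -real_normK ?num_real//; apply: lerXn2r; rewrite ?nnegrE; have := normr_ge0 s; lra.
have s3 := normr_ge0 s.
have eh : eta <= halfcircle s.
  have : halfcircle s ^+ 2 <= halfcircle s by rewrite expr2 ler_piMr// ltW.
  have : eta ^+ 2 <= eta by rewrite expr2 ler_piMr ?(ltW e0)//; lra.
  by rewrite h2; move: s2; rewrite sqrrB expr1n mul1r; lra.
rewrite weightE// -[leLHS]mulr1; apply: ler_pM => //.
- by rewrite exprn_ge0// ltW.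
- by apply: lerXn2r => //; rewrite ?nnegrE ltW.
- by rewrite invf_ge1.
Qed.

Lemma wint_sqr_eq0 g : cI g -> wint (fun s => g s ^+ 2) = 0 ->
  forall s, s \in `[-1, 1] -> g s = 0.
Proof.
move=> cg g0 s0 s0I; apply/eqP; apply: contraT => gs0.
have d0 : 0 < `|g s0| / 2 by rewrite divr_gt0 ?normr_gt0.
have /subspace_continuousP/(_ _ s0I)/cvgrPdist_lt/(_ _ d0) := cg.
rewrite near_withinE => /nbhs_normP[e /= e0 he].
have cg2 : cI (fun s => g s ^+ 2).
  by apply: (@within_continuous_comp _ _ _ _ g (fun x : R => x ^+ 2)) => // x _; exact: exprn_continuous.
have [eta [et0 et1 et2]] : exists eta : R, [/\ 0 < eta, eta <= 2^-1 & 3 / 2 * eta < e].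
  exists (Num.min (e / 2) 2^-1); rewrite lt_min ge_min lexx orbT; split=> //.
    by apply/andP; split; lra.
  by have : Num.min (e / 2) 2^-1 <= e / 2 :> R; [rewrite ge_min lexx|lra].
(* The centre is moved from [s0] towards 0, since [s0] may be an endpoint, where the weight can
   vanish; [3 / 2 * eta < e] keeps the interval within distance [e] of [s0]. *)
pose c := s0 * (1 - eta).
have s0n : `|s0| <= 1 by move: s0I; rewrite in_itv/= -ler_norml.
have cE (s : R) : s \in `[c - eta / 2, c + eta / 2] -> `|s| <= 1 - eta / 2 /\ `|s0 - s| < e.
  rewrite in_itv/= => /andP[h1 h2]; move: s0n; rewrite !ler_norml ltr_norml => /andP[h3 h4].
  by rewrite /c in h1 h2; split; apply/andP; split; nra.
have m0 : (0 < mu `[(c - eta / 2)%R, (c + eta / 2)%R]%classic)%E.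
  rewrite lebesgue_measure_itv/= lte_fin (_ : (c - eta / 2 < c + eta / 2) = true); last by lra.
  by rewrite -EFinD lte_fin; lra.
suff : 0 < wint (fun s => g s ^+ 2) by rewrite g0 ltxx.
apply: (@Rintegral_gt0 _ _ _ mu _ `[c - eta / 2, c + eta / 2]%classic _
  ((eta / 2) ^+ N.-2 * (`|g s0| / 2) ^+ 2)) => //.
- move=> s /cE[h _]; rewrite /= in_itv/= -ler_norml; lra.
- by rewrite mulr_gt0// exprn_gt0// divr_gt0.
- exact: integrable_weightM.
- by move=> s _; rewrite mulr_ge0 ?weight_ge0 ?sqr_ge0.
move=> s /cE[h1 h2]; apply: ler_pM.
- by rewrite exprn_ge0// divr_ge0 ?ltW.
- exact: sqr_ge0.
- by apply: weight_ge => //; rewrite divr_gt0.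
have := he s h2; rewrite /= in_itv/= -ler_norml => /(_ _) h3.
have {}h3 : `|g s0 - g s| < `|g s0| / 2 by apply: h3; lra.
rewrite -[leRHS]real_normK ?num_real//; apply: lerXn2r; rewrite ?nnegrE ?(ltW d0)//.
by have := ler_normD (g s0 - g s) (g s); rewrite subrK; lra.
Qed.

Lemma continuous_cI g : continuous g -> cI g.
Proof. exact: continuous_subspaceT. Qed.

Lemma is_derive_halfcircle s : s \in `]-1, 1[ ->
  is_derive s 1 (@halfcircle R) (- s / halfcircle s).
Proof.
move=> sI; have h0 := halfcircle_gt0 sI.
have u0 : 0 < 1 - s ^+ 2 by rewrite -sqr_halfcircle ?itv_ooW// exprn_gt0.
have d1 := is_derive1_sqrt u0.
have d2 : is_derive s 1 (fun x : R => 1 - x ^+ 2) (- (2 * s)).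
  by apply: is_derive_eq; rewrite /GRing.scale/=; ring.
have := @is_derive1_comp R Num.sqrt (fun x => 1 - x ^+ 2) s _ _ d1 d2.
move=> h; apply: (is_derive_eq h).
rewrite -/(halfcircle s); field.
by rewrite gt_eqF.
Qed.

Lemma is_derive_moment k s : s \in `]-1, 1[ ->
  is_derive s 1 (fun x => x ^+ k * halfcircle x ^+ N.-1)
    (k%:R * (s ^+ k.-1 * halfcircle s ^+ N.-1) - (N.-1)%:R * (w s * s ^+ k.+1)).
Proof.
move=> sI; have dh := is_derive_halfcircle sI; have h0 := halfcircle_gt0 sI.
have d1 : is_derive s 1 (fun x => halfcircle x ^+ N.-1) ((N.-1)%:R * halfcircle s ^+ N.-2 * (- s / halfcircle s)).
  by have := is_deriveX N.-1 dh; rewrite exprfctE.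
have d2 : is_derive s 1 (fun x : R => x ^+ k) (k%:R * s ^+ k.-1).
  by have := is_deriveX k (is_derive_id s 1); rewrite exprfctE /GRing.scale/= mulr1.
have := is_deriveM d2 d1.
move=> h; apply: (is_derive_eq h).
rewrite /GRing.scale/= weightE// exprS; field.
by rewrite gt_eqF.
Qed.

(* Integration by parts: the antiderivative vanishes at both ends. *)
Lemma integration_by_parts_moment k :
  k%:R * \int[mu]_(s in `[-1, 1]) (s ^+ k.-1 * halfcircle s ^+ N.-1) =
  (N.-1)%:R * wint (fun s => s ^+ k.+1).
Proof.
have cX j : cI (fun s => s ^+ j) by apply: continuous_cI => x; exact: exprn_continuous.
have i1 : mu.-integrable `[-1, 1] (EFin \o (fun s => k%:R * (s ^+ k.-1 * halfcircle s ^+ N.-1))).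
  apply: continuous_integrable; apply: continuous_cI => x.
  by apply: cvgM; [exact: cvg_cst|exact: continuous_moment].
have i2 : mu.-integrable `[-1, 1] (EFin \o (fun s => (N.-1)%:R * (w s * s ^+ k.+1))).
  under [X in integrable _ _ X]eq_fun do rewrite /= EFinM.
  by apply: integrableZl => //; exact: integrable_weightM.
pose f s := k%:R * (s ^+ k.-1 * halfcircle s ^+ N.-1) - (N.-1)%:R * (w s * s ^+ k.+1).
have i3 : mu.-integrable `[-1, 1] (EFin \o f).
  under [X in integrable _ _ X]eq_fun do rewrite /= EFinB.
  exact: integrableB.
have ab : -1 < 1 :> R by lra.
have cf (s : R) : s \in `]-1, 1[ -> {for s, continuous f}.
  move=> sI; apply: cvgB; apply: cvgM; [exact: cvg_cst|exact: continuous_moment|exact: cvg_cst|].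
  by apply: cvgM; [exact: continuous_weight|exact: exprn_continuous].
have cF : cI (fun x => x ^+ k * halfcircle x ^+ N.-1).
  by apply: continuous_cI; exact: continuous_moment.
have := @FTC_integrable R f (fun x => x ^+ k * halfcircle x ^+ N.-1) _ _ ab i3 cf (is_derive_moment k) cF.
have h0 (x : R) : x ^+ 2 = 1 -> halfcircle x ^+ N.-1 = 0.
  move=> x2; rewrite /halfcircle x2 subrr sqrtr0 expr0n.
  by case: (N) hN => [|[]].
rewrite !h0 ?sqrrN ?expr1n// !mulr0 subrr /f RintegralB// => /subr0_eq.
rewrite RintegralZl//; last first.
  by apply: continuous_integrable; apply: continuous_cI; exact: continuous_moment.
by rewrite RintegralZl//; exact: integrable_weightM.
Qed.

Lemma wint_sub_moment k :
  \int[mu]_(s in `[-1, 1]) (s ^+ k * halfcircle s ^+ N.-1) =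
  wint (fun s => s ^+ k) - wint (fun s => s ^+ k.+2).
Proof.
have cX j : cI (fun s => s ^+ j) by apply: continuous_cI => x; exact: exprn_continuous.
rewrite /wint -RintegralB//; [|exact: integrable_weightM|exact: integrable_weightM].
apply: eq_Rintegral => s; rewrite inE/= => sI.
have -> : w s * s ^+ k - w s * s ^+ k.+2 = s ^+ k * (w s * (1 - s ^+ 2)).
  by rewrite !exprS; ring.
congr (_ * _); have [sI'|] := boolP (s \in `]-1, 1[).
  have h0 := halfcircle_gt0 sI'.
  rewrite weightE// -sqr_halfcircle//.
  have [M ->] : exists M, N = M.+2 by exists N.-2; rewrite -[LHS](subnKC hN) addnC addn2 subn2.
  by rewrite /= exprS; field; rewrite gt_eqF.
move=> sI'; have s1 : s ^+ 2 = 1.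
  move: sI sI'; rewrite !in_itv/= => /andP[a b]; rewrite negb_and -!leNgt => /orP[c|c].
    have -> : s = -1 by lra.
    by rewrite sqrrN expr1n.
  have -> : s = 1 by lra.
  by rewrite expr1n.
rewrite s1 subrr mulr0 /halfcircle s1 subrr sqrtr0 expr0n.
by case: (N) hN => [|[]].
Qed.

(** Integration by parts together with [wint_sub_moment]. The powers of a coordinate on the sphere
    obey the same recursion in [moment_step]. *)
Lemma wint_moment_step k :
  (k.+1%:R) * wint (fun s => s ^+ k) = (k + N)%:R * wint (fun s => s ^+ k.+2).
Proof.
have := integration_by_parts_moment k.+1; rewrite /= wint_sub_moment.
have -> : (k + N)%:R = k.+1%:R + (N.-1)%:R :> R.
  by rewrite -natrD addSn -addnS prednK// (leq_trans _ hN).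
by rewrite mulrBr mulrDl => /eqP; rewrite subr_eq addrC => /eqP.
Qed.

Lemma wint_moment1 : wint id = 0.
Proof.
have := integration_by_parts_moment 0; rewrite mul0r => /esym/eqP.
rewrite mulf_eq0 pnatr_eq0; have -> : (N.-1 == 0)%N = false by case: (N) hN => [|[]].
by move=> /= /eqP.
Qed.

(** Supplies the initial value for comparing moments: by [volP] the left side times [vol R N.-1] is
    the area of the sphere in dimension N. *)
Lemma wint_halfcircle : N%:R * \int[mu]_(s in `[-1, 1]) halfcircle s ^+ N.-1 =
  (N.-1)%:R * wint (fun=> 1).
Proof.
have -> : \int[mu]_(s in `[-1, 1]) halfcircle s ^+ N.-1 = \int[mu]_(s in `[-1, 1]) (s ^+ 0 * halfcircle s ^+ N.-1).
  by apply: eq_Rintegral => s _; rewrite mul1r.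
have := wint_moment_step 0; rewrite add0n mul1r wint_sub_moment => h.
have -> : wint (fun=> 1) = wint (fun s => s ^+ 0) by apply: eq_wint.
rewrite mulrBr -h -[X in _ - X]mul1r -mulrBl; congr (_ * _).
by rewrite -subn1 natrB// (leq_trans _ hN).
Qed.

End weighted_integral.

Section polynomial_facts.
Context (R : realType).

Lemma poly_eq_itv (p q : {poly R}) :
  (forall s, s \in `[-1, 1] -> p.[s] = q.[s]) -> p = q.
Proof.
move=> h; apply/eqP; rewrite -subr_eq0; apply: contraT => pq0.
pose rs : seq R := [seq i.+1%:R^-1 | i <- iota 0 (size (p - q))].
have := max_poly_roots pq0 (rs := rs); rewrite size_map size_iota ltnn => -> //.
  apply/allP => _ /mapP[i _ ->]; rewrite /root !hornerE h ?subrr// in_itv/=.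
  have : 0 < i.+1%:R^-1 :> R by rewrite invr_gt0.
  have : i.+1%:R^-1 <= 1 :> R by rewrite invf_le1 ?ler1n.
  by move: (_^-1) => u *; lra.
rewrite map_inj_uniq ?iota_uniq// => i j /invr_inj/eqP.
by rewrite eqr_nat => /eqP[].
Qed.

End polynomial_facts.

(** * Integrals over the sphere and their zonal reduction *)

Section sphere_integral.
Context (R : realType) (n : nat).
Hypothesis hn : (2 <= n)%N.
Notation S := (unit_sphere R n).
Notation sigma := (surface_measure R n).
Implicit Types (f g : 'cV[R]_n -> R) (x y : 'cV[R]_n).

Let n0 : (0 < n)%N. Proof. exact: leq_trans hn. Qed.

(** A class of integrands closed under sums, products and polynomials, all integrable because the
    sphere has finite measure. *)
Definition adm f := measurable_fun [set: 'cV[R]_n] f /\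
  exists M, forall x, S x -> `|f x| <= M.

Definition sint f : R := \int[sigma]_(x in S) f x.

Lemma surface_lty : (sigma S < +oo)%E.
Proof. by rewrite surface_total// ltry. Qed.

Lemma adm_integrable f : adm f -> sigma.-integrable S (EFin \o f).
Proof.
move=> [mf [M hM]]; apply: measurable_bounded_integrable => //.
- exact: measurable_unit_sphere.
- exact: surface_lty.
- exact: measurable_funTS.
- by exists M; split; [exact: num_real|move=> r Mr x Sx; apply: (le_trans (hM x Sx)); exact: ltW].
Qed.

Lemma adm_cst c : adm (fun=> c).
Proof. by split=> //; exists `|c|. Qed.

Lemma adm_dotv x : adm (dotv x).
Proof.
split; first exact: measurable_dotv.
by exists (enorm x) => y Sy; rewrite (le_trans (dotv_le _ _))// Sy mulr1.
Qed.

Lemma admD f g : adm f -> adm g -> adm (fun x => f x + g x).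
Proof.
move=> [mf [M hM]] [mg [L hL]]; split; first exact: measurable_funD.
by exists (M + L) => x Sx; rewrite (le_trans (ler_normD _ _))// lerD ?hM ?hL.
Qed.

Lemma admM f g : adm f -> adm g -> adm (fun x => f x * g x).
Proof.
move=> [mf [M hM]] [mg [L hL]]; split; first exact: measurable_funM.
by exists (M * L) => x Sx; rewrite normrM ler_pM ?hM ?hL.
Qed.

Lemma admZ c f : adm f -> adm (fun x => c * f x).
Proof. by move=> af; apply: admM => //; exact: adm_cst. Qed.

Lemma admB f g : adm f -> adm g -> adm (fun x => f x - g x).
Proof.
move=> af ag; under eq_fun do rewrite -mulN1r.
by apply: admD => //; exact: admZ.
Qed.

Lemma admX f k : adm f -> adm (fun x => f x ^+ k).
Proof.
move=> af; elim: k => [|k IH]; first by under eq_fun do rewrite expr0; exact: adm_cst.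
by under eq_fun do rewrite exprS; exact: admM.
Qed.

Lemma adm_sum (I : Type) (r : seq I) (P : pred I) (F : I -> 'cV[R]_n -> R) :
  (forall i, P i -> adm (F i)) -> adm (fun x => \sum_(i <- r | P i) F i x).
Proof.
move=> aF; elim: r => [|i r IH].
  rewrite (_ : (fun x => \sum_(j <- [::] | P j) F j x) = fun=> 0); first exact: adm_cst.
  by apply: funext => x; exact: big_nil.
rewrite (_ : (fun x => \sum_(j <- i :: r | P j) F j x) = fun x => if P i then F i x + \sum_(j <- r | P j) F j x else \sum_(j <- r | P j) F j x).
  by case: (boolP (P i)) => [Pi|_] //; apply: admD => //; exact: aF.
by apply: funext => x; exact: big_cons.
Qed.

Lemma adm_prod (I : Type) (r : seq I) (P : pred I) (F : I -> 'cV[R]_n -> R) :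
  (forall i, P i -> adm (F i)) -> adm (fun x => \prod_(i <- r | P i) F i x).
Proof.
move=> aF; elim: r => [|i r IH].
  rewrite (_ : (fun x => \prod_(j <- [::] | P j) F j x) = fun=> 1); first exact: adm_cst.
  by apply: funext => x; exact: big_nil.
rewrite (_ : (fun x => \prod_(j <- i :: r | P j) F j x) = fun x => if P i then F i x * \prod_(j <- r | P j) F j x else \prod_(j <- r | P j) F j x).
  by case: (boolP (P i)) => [Pi|_] //; apply: admM => //; exact: aF.
by apply: funext => x; exact: big_cons.
Qed.

Lemma adm_horner (p : {poly R}) f : adm f -> adm (fun x => p.[f x]).
Proof.
move=> af; under eq_fun do rewrite horner_coef.
by apply: adm_sum => i _; apply: admZ; exact: admX.
Qed.

Lemma adm_coord i : adm (fun x => x i 0).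
Proof.
split; first exact: measurable_coord.
exists 1 => x /sphere_dotv; rewrite dotvE (bigD1 i)//= -expr2 => h.
rewrite -(@ler_pXn2r _ 2)// ?nnegrE// real_normK ?num_real// expr1n -h lerDl.
by apply: sumr_ge0 => j _; rewrite -expr2 sqr_ge0.
Qed.

Lemma eq_sint f g : (forall x, S x -> f x = g x) -> sint f = sint g.
Proof. by move=> h; apply: eq_Rintegral => x; rewrite inE => /h. Qed.

Lemma sintD f g : adm f -> adm g -> sint (fun x => f x + g x) = sint f + sint g.
Proof.
move=> af ag; apply: RintegralD; [exact: measurable_unit_sphere|exact: adm_integrable|exact: adm_integrable].
Qed.

Lemma sintZ c f : adm f -> sint (fun x => c * f x) = c * sint f.
Proof. by move=> af; apply: RintegralZl; [exact: measurable_unit_sphere|exact: adm_integrable]. Qed.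

Lemma sintB f g : adm f -> adm g -> sint (fun x => f x - g x) = sint f - sint g.
Proof.
move=> af ag; apply: RintegralB; [exact: measurable_unit_sphere|exact: adm_integrable|exact: adm_integrable].
Qed.

Lemma sint_sum (I : Type) (r : seq I) (P : pred I) (F : I -> 'cV[R]_n -> R) :
  (forall i, P i -> adm (F i)) ->
  sint (fun x => \sum_(i <- r | P i) F i x) = \sum_(i <- r | P i) sint (F i).
Proof.
move=> aF; elim: r => [|i r IH].
  rewrite big_nil (@eq_sint _ (fun=> 0)); last by move=> x _; rewrite big_nil.
  by rewrite /sint Rintegral_cst ?mul0r//; exact: measurable_unit_sphere.
rewrite big_cons (@eq_sint _ (fun x => if P i then F i x + \sum_(j <- r | P j) F j x else \sum_(j <- r | P j) F j x)); last first.
  by move=> x _; rewrite big_cons.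
case: (boolP (P i)) => [Pi|_]; last exact: IH.
rewrite sintD ?IH//; [exact: aF|exact: adm_sum].
Qed.

Lemma sint_le f g : adm f -> adm g -> (forall x, S x -> f x <= g x) -> sint f <= sint g.
Proof.
move=> af ag; apply: le_Rintegral; [exact: measurable_unit_sphere|exact: adm_integrable|exact: adm_integrable].
Qed.

Lemma sint_ge0 f : (forall x, S x -> 0 <= f x) -> 0 <= sint f.
Proof. exact: Rintegral_ge0. Qed.

Lemma sint_cst c : sint (fun=> c) = c * sphere_area R n.
Proof. by rewrite /sint Rintegral_cst//; exact: measurable_unit_sphere. Qed.

Lemma sint_orthogonal (Q : 'M[R]_n) f : orthogonal_mx Q -> adm f ->
  sint (fun x => f (Q *m x)) = sint f.
Proof.
move=> oQ af; have [mQ sQ] := surface_orthogonal oQ.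
have SQ : mulmx Q @^-1` S = S.
  by apply/seteqP; split=> x; rewrite /unit_sphere/= enorm_orthogonal.
rewrite /sint /Rintegral; congr fine.
have -> : (\int[sigma]_(x in S) (f x)%:E = \int[pushforward sigma (mulmx Q)]_(x in S) (f x)%:E)%E.
  apply: eq_measure_integral => A mA _.
  by have := sQ A mA; rewrite mul1e => h; exact: (esym h).
rewrite integral_pushforward//.
- by rewrite SQ.
- by apply/measurable_EFinP; case: af.
- rewrite SQ; apply: (adm_integrable (f := fun x => f (Q *m x))).
  case: af => mf [M hM]; split; first exact: measurableT_comp.
  by exists M => x Sx; apply: hM; rewrite /unit_sphere/= enorm_orthogonal.
- exact: measurable_unit_sphere.
Qed.

(** Pairs of poles with equal Gram matrices are matched by an orthogonal map, which changes no
    integral. *)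
Lemma sint_gram (F : R -> R -> R) x1 x2 y1 y2 :
  adm (fun x => F (dotv y1 x) (dotv y2 x)) ->
  dotv x1 x1 = dotv y1 y1 -> dotv x2 x2 = dotv y2 y2 -> dotv x1 x2 = dotv y1 y2 ->
  sint (fun x => F (dotv x1 x) (dotv x2 x)) = sint (fun x => F (dotv y1 x) (dotv y2 x)).
Proof.
move=> aF h1 h2 h12; have [Q oQ [Q1 Q2]] := orthogonal_2transitive h1 h2 h12.
rewrite -(sint_orthogonal oQ aF); apply: eq_sint => x _.
by rewrite -Q1 -Q2 !dotv_orthogonal.
Qed.

Definition basis_vec (i : 'I_n) : 'cV[R]_n := delta_mx i 0.

Lemma dotv_basis i x : dotv (basis_vec i) x = x i 0.
Proof.
rewrite dotvE (bigD1 i)//= big1 ?addr0; first by rewrite mxE !eqxx mul1r.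
by move=> j ji; rewrite mxE (negbTE ji) mul0r.
Qed.

Lemma dotv_basis2 i j : dotv (basis_vec i) (basis_vec j) = (i == j)%:R.
Proof. by rewrite dotv_basis mxE eqxx andbT. Qed.

Lemma sphere_basis i : S (basis_vec i).
Proof. by apply/sphere_dotv; rewrite dotv_basis2 eqxx. Qed.

Definition i0 : 'I_n := Ordinal n0.
Definition i1 : 'I_n := Ordinal hn.
Notation e0 := (basis_vec i0).
Notation e1 := (basis_vec i1).

Lemma e00 : dotv e0 e0 = 1. Proof. by rewrite dotv_basis2. Qed.
Lemma e11 : dotv e1 e1 = 1. Proof. by rewrite dotv_basis2. Qed.
Lemma e01 : dotv e0 e1 = 0. Proof. by rewrite dotv_basis2. Qed.

Lemma adm_dotvX x k : adm (fun y => dotv x y ^+ k).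
Proof. by apply: admX; exact: adm_dotv. Qed.

Definition moment k := sint (fun x => dotv e0 x ^+ k).

Lemma sint_dotvX x k : S x -> sint (fun y => dotv x y ^+ k) = moment k.
Proof.
move=> /sphere_dotv xx; apply: (sint_gram (F := fun a _ => a ^+ k) (x2 := x) (y2 := e0));
  rewrite ?e00//; exact: adm_dotvX.
Qed.

Lemma moment_odd k : odd k -> moment k = 0.
Proof.
move=> ok; have : moment k = - moment k.
  rewrite -[in LHS](@sint_dotvX (- e0)); last first.
    by apply/sphere_dotv; rewrite !dotv_lin opprK e00.
  rewrite -mulN1r -sintZ; last exact: adm_dotvX.
  by apply: eq_sint => x _; rewrite dotvNl exprNn -signr_odd ok expr1.
by move=> h; lra.
Qed.

Lemma coef_binomial_X2 m : ((1 + 'X^2) ^+ m : {poly R})`_2 = m%:R.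
Proof.
elim: m => [|m IH]; first by rewrite expr0 coef1.
have c0 : ((1 + 'X^2) ^+ m : {poly R})`_0 = 1.
  by rewrite -horner_coef0 !hornerE/= expr0n/= addr0 expr1n.
rewrite exprS mulrDl mul1r coefD IH coefXnM/= subnn c0 -[in RHS]addn1 natrD.
by [].
Qed.

(** Compare the coefficients of [t ^+ 2] in the integral of [dotv (e0 + t *: e1) x ^+ M], M = 2m +
    2. The binomial formula makes it a polynomial in [t]; homogeneity and rotation invariance give
    [(1 + t ^+ 2) ^+ m.+1 * moment M]. *)
Lemma moment_mixed m : (m.*2.+1)%:R * sint (fun x => dotv e0 x ^+ m.*2 * dotv e1 x ^+ 2) =
  moment m.*2.+2.
Proof.
pose M := m.*2.+2.
pose a (i : nat) := sint (fun x => dotv e0 x ^+ (M - i) * dotv e1 x ^+ i).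
have aa i : adm (fun x => dotv e0 x ^+ (M - i) * dotv e1 x ^+ i).
  by apply: admM; exact: adm_dotvX.
pose L : {poly R} := \poly_(i < M.+1) ('C(M, i)%:R * a i).
pose P : {poly R} := moment M *: (1 + 'X^2) ^+ m.+1.
suff LP : L = P.
  have : L`_2 = P`_2 by rewrite LP.
  rewrite coef_poly /= coefZ coef_binomial_X2.
  have -> : a 2%N = sint (fun x => dotv e0 x ^+ m.*2 * dotv e1 x ^+ 2).
    by rewrite /a /M subn2.
  have -> : 'C(M, 2)%:R = m.+1%:R * m.*2.+1%:R :> R.
    rewrite -natrM bin2 (_ : (M * M.-1)%N = (m.+1 * m.*2.+1).*2) ?doubleK//.
    by rewrite doubleMl.
  rewrite -mulrA [RHS]mulrC; apply: mulfI.
  by rewrite pnatr_eq0.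
apply: poly_eq_itv => t _.
have tp : 0 < 1 + t ^+ 2 by have := sqr_ge0 t; lra.
have sp : 0 < Num.sqrt (1 + t ^+ 2) by rewrite sqrtr_gt0.
have nv : dotv (e0 + t *: e1) (e0 + t *: e1) = 1 + t ^+ 2.
  by rewrite !dotv_lin e00 e11 (dotvC e1) e01; ring.
transitivity (sint (fun x => dotv (e0 + t *: e1) x ^+ M)).
  rewrite /L horner_poly.
  under eq_sint => x _ do rewrite dotvDl dotvZl exprDn.
  rewrite sint_sum; last first.
    move=> i _; rewrite (_ : (fun x => _) = fun x => ('C(M, i)%:R * t ^+ i) * (dotv e0 x ^+ (M - i) * dotv e1 x ^+ i)).
      exact: admZ.
    by apply/funext => x; rewrite exprMn -mulr_natl; ring.
  apply: eq_bigr => i _; rewrite mulrAC -sintZ//.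
  by apply: eq_sint => x _; rewrite exprMn -mulr_natl; ring.
have Su : S ((Num.sqrt (1 + t ^+ 2))^-1 *: (e0 + t *: e1)).
  by apply/sphere_dotv; rewrite dotvZl dotvZr nv mulrA -invfM -expr2 sqr_sqrtr ?(ltW tp)// mulVf// gt_eqF.
rewrite /P !hornerE /= -(sint_dotvX M Su) mulrC -sintZ; last exact: adm_dotvX.
apply: eq_sint => x _; rewrite dotvZl exprMn.
have -> : (1 + t ^+ 2) ^+ m.+1 = Num.sqrt (1 + t ^+ 2) ^+ M.
  by rewrite /M -doubleS -mul2n exprM sqr_sqrtr// ltW.
by rewrite mulrA -exprMn divff ?expr1n ?mul1r// gt_eqF.
Qed.

(** Insert the sum of the squared coordinates, which is 1, into [moment k]: the first coordinate
    yields [moment k.+2], and the n - 1 others yield equal mixed moments. *)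
Lemma moment_step k : (k.+1%:R) * moment k = (k + n)%:R * moment k.+2.
Proof.
have [ok|ek] := boolP (odd k); first by rewrite !moment_odd ?mulr0//= negbK.
have [m km] : exists m, k = m.*2 by exists k./2; rewrite even_halfK.
rewrite {k ek}km.
have -> : moment m.*2 = moment m.*2.+2 + (n.-1)%:R * sint (fun x => dotv e0 x ^+ m.*2 * dotv e1 x ^+ 2).
  rewrite /moment.
  transitivity (sint (fun x => \sum_(i < n) dotv e0 x ^+ m.*2 * dotv (basis_vec i) x ^+ 2)).
    apply: eq_sint => x /sphere_dotv; rewrite dotvE => h.
    rewrite -mulr_sumr (_ : \sum_(i < n) _ = 1) ?mulr1// -h.
    by apply: eq_bigr => i _; rewrite dotv_basis expr2.
  rewrite sint_sum; last by move=> i _; apply: admM; exact: adm_dotvX.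
  rewrite (bigD1 i0)//=; congr (_ + _).
    by apply: eq_sint => x _; rewrite -exprD addn2.
  rewrite (eq_bigr (fun=> sint (fun x => dotv e0 x ^+ m.*2 * dotv e1 x ^+ 2))); last first.
    move=> i ii0; apply: (sint_gram (F := fun a b => a ^+ m.*2 * b ^+ 2)).
    - by apply: admM; exact: adm_dotvX.
    - by [].
    - by rewrite !dotv_basis2 !eqxx.
    - by rewrite !dotv_basis2 eq_sym (negbTE ii0).
  rewrite sumr_const mulr_natl; congr (_ *+ _).
  by rewrite (cardC1 i0) card_ord.
rewrite mulrDr mulrCA moment_mixed -mulrDl -natrD; congr (_%:R * _).
by rewrite addSn -addnS prednK.
Qed.

(** Both sides obey the same two-step recursion, so only k = 0 and k = 1 need checking. This
    replaces slicing the sphere by latitude. *)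
Lemma sint_zonalX k x : S x ->
  sint (fun y => dotv x y ^+ k) = sphere_area R n.-1 * wint n (fun s => s ^+ k).
Proof.
move=> Sx; rewrite sint_dotvX//.
have c0 : forall j, (j < 2)%N -> moment j = sphere_area R n.-1 * wint n (fun s => s ^+ j).
  case=> [_|[_|//]].
    rewrite /moment; have -> : sint (fun x => dotv e0 x ^+ 0) = n%:R * vol R n.
      by rewrite sint_cst mul1r sphere_areaE.
    have [_ [_]] := volP R n.-1; rewrite prednK// => ->.
    rewrite mulrCA wint_halfcircle// sphere_areaE; last by rewrite -subn1 subn_gt0.
    by rewrite mulrA [vol R _ * _]mulrC; congr (_ * _); apply: eq_wint.
  by rewrite moment_odd// (_ : wint n _ = 0) ?mulr0//; exact: wint_moment1.
have [m] := ubnP k; elim: m k => // m IH [|[|k]] km; [exact: c0|exact: c0|].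
have kn : (k + n)%:R != 0 :> R by rewrite pnatr_eq0 addn_eq0 negb_and -!lt0n n0 orbT.
apply: (mulfI kn); rewrite -moment_step IH; last by rewrite ltnS in km; exact: ltnW.
by rewrite mulrCA wint_moment_step// mulrCA.
Qed.

Lemma sint_zonal (p : {poly R}) x : S x ->
  sint (fun y => p.[dotv x y]) = sphere_area R n.-1 * wint n (fun s => p.[s]).
Proof.
move=> Sx; under eq_sint => y _ do rewrite horner_coef.
rewrite sint_sum; last by move=> i _; apply: admZ; exact: adm_dotvX.
rewrite (_ : wint n _ = \sum_(i < size p) p`_i * wint n (fun s => s ^+ i)).
  rewrite mulr_sumr; apply: eq_bigr => i _.
  rewrite sintZ; last exact: adm_dotvX.
  by rewrite (sint_zonalX _ Sx) mulrCA.
rewrite (@eq_wint _ _ _ (fun s => \sum_(i < size p) p`_i * s ^+ i)); last first.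
  by move=> s _; rewrite horner_coef.
have cX j : {within `[-1, 1], continuous (fun s : R => s ^+ j)}.
  by apply: continuous_cI => s; exact: exprn_continuous.
elim: (index_enum _) => [|i r IH].
  rewrite big_nil (@eq_wint _ _ _ (fun s => 0 * 1)); last by move=> s _; rewrite big_nil mul0r.
  by rewrite wintZ ?mul0r//; apply: continuous_cI => s; exact: cvg_cst.
rewrite big_cons -IH -wintZ// -wintD//.
- by apply: eq_wint => s _; rewrite big_cons.
- by apply: continuous_cI => s; apply: cvgM; [exact: cvg_cst|exact: exprn_continuous].
- apply: continuous_cI; rewrite (_ : (fun s => _) = horner (\sum_(j <- r) p`_j *: 'X^j)).
    exact: continuous_horner.
  apply: funext => s; rewrite horner_sum; apply: eq_bigr => j _.
  by rewrite hornerZ hornerXn.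
Qed.

End sphere_integral.

(** * Zonal convolution and Gegenbauer polynomials *)

Section funk_hecke.
Context (R : realType) (n : nat).
Hypothesis hn : (2 <= n)%N.
Notation S := (unit_sphere R n).
Notation sint := (@sint R n).
Notation e0 := (basis_vec R (i0 hn)).
Notation e1 := (basis_vec R (i1 hn)).
Notation wintp p := (wint n (fun s => (p : {poly R}).[s])).
Notation c0 := (sphere_area R n.-1).
Implicit Types (x y z : 'cV[R]_n) (p q r : {poly R}).

Lemma c0_gt0 : 0 < c0.
Proof. by apply: sphere_area_gt0; rewrite -subn1 subn_gt0. Qed.

Lemma cI_horner p : {within `[-1, 1], continuous (fun s => p.[s])}.
Proof. by apply: continuous_cI; exact: continuous_horner. Qed.

Lemma wintpD p q : wintp (p + q) = wintp p + wintp q.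
Proof. by rewrite -wintD//; [apply: eq_wint => s _; rewrite hornerD|exact: cI_horner|exact: cI_horner]. Qed.

Lemma wintpZ a p : wintp (a *: p) = a * wintp p.
Proof. by rewrite -wintZ//; [apply: eq_wint => s _; rewrite hornerZ|exact: cI_horner]. Qed.

Lemma wintp0 : wintp 0 = 0.
Proof. by rewrite -(scale0r 0) wintpZ mul0r. Qed.

Lemma wintpB p q : wintp (p - q) = wintp p - wintp q.
Proof. by rewrite wintpD -scaleN1r wintpZ mulN1r. Qed.

Lemma wintp_sum (I : Type) (s : seq I) (P : pred I) (F : I -> {poly R}) :
  wintp (\sum_(i <- s | P i) F i) = \sum_(i <- s | P i) wintp (F i).
Proof.
elim/big_rec2: _ => [|i _ p _ <-]; first exact: wintp0.
exact: wintpD.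
Qed.

Lemma wintp_sqr_ge0 p : 0 <= wintp (p * p).
Proof.
by apply: Rintegral_ge0 => s _; rewrite mulr_ge0 ?weight_ge0// hornerM -expr2 sqr_ge0.
Qed.

Lemma wintp_sqr_eq0 p : wintp (p * p) = 0 -> p = 0.
Proof.
move=> h; apply: poly_eq_itv => s sI; rewrite horner0.
apply: (@wint_sqr_eq0 _ _ hn (fun s => p.[s]) (@cI_horner p) _ s sI).
by rewrite -h; apply: eq_wint => t _; rewrite hornerM expr2.
Qed.

Lemma wintp_sqr_gt0 p : p != 0 -> 0 < wintp (p * p).
Proof.
move=> p0; rewrite lt_def wintp_sqr_ge0 andbT.
by apply: contra p0 => /eqP/wintp_sqr_eq0/eqP.
Qed.

(* Every pair of unit vectors has the Gram matrix of [e0, t e0 + u e1]. *)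
Definition planar (t : R) : 'cV[R]_n := t *: e0 + halfcircle t *: e1.

Lemma dotv_planarl t : dotv e0 (planar t) = t.
Proof. by rewrite /planar !dotv_lin e00 e01; ring. Qed.

Lemma sphere_planar t : t \in `[-1, 1] -> S (planar t).
Proof.
move=> tI; apply/sphere_dotv; rewrite /planar !dotv_lin e00 e11 e01 (dotvC e1) e01.
by have := sqr_halfcircle tI; nra.
Qed.

Definition conv p q x y := sint (fun z => p.[dotv x z] * q.[dotv y z]).

Lemma adm_conv p q x y : adm (fun z : 'cV[R]_n => p.[dotv x z] * q.[dotv y z]).
Proof. by apply: admM; apply: adm_horner; exact: adm_dotv. Qed.

Lemma conv_gram p q x1 x2 y1 y2 : S x1 -> S x2 -> S y1 -> S y2 ->
  dotv x1 x2 = dotv y1 y2 -> conv p q x1 x2 = conv p q y1 y2.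
Proof.
move=> /sphere_dotv h1 /sphere_dotv h2 /sphere_dotv k1 /sphere_dotv k2 h.
apply: (sint_gram hn (F := fun a b => p.[a] * q.[b])).
- exact: adm_conv.
- by rewrite h1 k1.
- by rewrite h2 k2.
- by [].
Qed.

Lemma conv_sym p q x y : S x -> S y -> conv p q x y = conv q p x y.
Proof.
move=> Sx Sy; rewrite (@conv_gram q p x y y x)// 1?dotvC//.
by apply: eq_sint => z _; rewrite mulrC.
Qed.

Let mixed p i := sint (fun z => p.[dotv e0 z] * dotv e1 z ^+ i).

Let adm_mixed p i : adm (fun z : 'cV[R]_n => p.[dotv e0 z] * dotv e1 z ^+ i).
Proof. by apply: admM; [apply: adm_horner|apply: admX]; exact: adm_dotv. Qed.

Let mixed_odd p i : odd i -> mixed p i = 0.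
Proof.
move=> oi; suff : mixed p i = - mixed p i by move=> h; lra.
rewrite /mixed -mulN1r -sintZ//.
rewrite (@sint_gram _ _ hn (fun a b => p.[a] * b ^+ i) e0 e1 e0 (- e1)).
- by apply: eq_sint => z _; rewrite dotvNl exprNn -signr_odd oi expr1; ring.
- by apply: admM; [apply: adm_horner|apply: admX]; exact: adm_dotv.
- by [].
- by rewrite !dotv_lin opprK.
- by rewrite !dotv_lin e01 oppr0.
Qed.

(** The poles may be taken as [e0] and [planar hn t], with [t] their inner product. Expanding
    binomially in [t] and [halfcircle t], the odd powers of [halfcircle t] drop out by the
    reflection of [e1]; hence a polynomial in [t], and the rounding in [i./2] is harmless. *)
Definition conv_polyX p k : {poly R} :=
  \sum_(i < k.+1) ('C(k, i)%:R * mixed (p * 'X^(k - i)) i) *: ('X^(k - i) * (1 - 'X^2) ^+ i./2).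

Definition conv_poly p q : {poly R} := \sum_(k < size q) q`_k *: conv_polyX p k.

Lemma size_conv_polyX p k : (size (conv_polyX p k) <= k.+1)%N.
Proof.
apply: (leq_trans (size_sum _ _ _)); apply/bigmax_leqP => i _.
apply: (leq_trans (size_scale_leq _ _)).
apply: (leq_trans (size_polyMleq _ _)).
rewrite size_polyXn addSn /=.
have s2 : (size (1 - 'X^2 : {poly R})%R <= 3)%N.
  by rewrite (leq_trans (size_polyD _ _))// size_polyN size_polyXn size_poly1.
pose u : {poly R} := (1 - 'X^2) ^+ i./2.
have su : (size u <= (i./2).*2.+1)%N.
  apply: (leq_trans (size_poly_exp_leq _ _)); rewrite ltnS -mul2n leq_mul2r.
  by apply/orP; right; case: (size _) s2 => [|[|[|[|]]]].
have i2 : ((i./2).*2 <= i)%N by rewrite -[leqRHS]odd_double_half leq_addl.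
have := ltn_ord i; rewrite ltnS -/u; move: (size u) (i./2).*2 su i2 => a b; lia.
Qed.

Lemma size_conv_poly p q : (size (conv_poly p q) <= size q)%N.
Proof.
apply: (leq_trans (size_sum _ _ _)); apply/bigmax_leqP => i _.
apply: (leq_trans (size_scale_leq _ _)); apply: (leq_trans (size_conv_polyX _ _)).
exact: ltn_ord.
Qed.

Lemma conv_polyXE p k x y : S x -> S y ->
  sint (fun z => p.[dotv x z] * dotv y z ^+ k) = (conv_polyX p k).[dotv x y].
Proof.
move=> Sx Sy; set t := dotv x y.
have tI : t \in `[-1, 1] by exact: sphere_dotv_itv.
move: (Sx) (Sy) => /sphere_dotv xx /sphere_dotv yy.
have /sphere_dotv pp := sphere_planar tI.
rewrite (@sint_gram _ _ hn (fun a b => p.[a] * b ^+ k) x y e0 (planar t)); first last.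
- by rewrite dotv_planarl.
- by rewrite yy pp.
- by rewrite xx e00.
- by apply: admM; [apply: adm_horner|apply: admX]; exact: adm_dotv.
transitivity (sint (fun z => \sum_(i < k.+1)
    ('C(k, i)%:R * (t ^+ (k - i) * halfcircle t ^+ i)) * ((p * 'X^(k - i)).[dotv e0 z] * dotv e1 z ^+ i))).
  apply: eq_sint => z _; rewrite /planar dotvDl !dotvZl exprDn mulr_sumr.
  by apply: eq_bigr => i _; rewrite -mulr_natl !exprMn hornerM hornerXn; ring.
rewrite sint_sum//; last by move=> i _; exact: admZ.
rewrite /conv_polyX horner_sum; apply: eq_bigr => i _.
rewrite sintZ// -/(mixed (p * 'X^(k - i)) i) hornerZ hornerM hornerXn.
have [oi|ei] := boolP (odd i); first by rewrite mixed_odd//; ring.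
have -> : halfcircle t ^+ i = (1 - t ^+ 2) ^+ i./2.
  by rewrite -sqr_halfcircle// -exprM mul2n even_halfK.
by rewrite horner_exp !hornerE/=; ring.
Qed.

Lemma conv_polyE p q x y : S x -> S y -> conv p q x y = (conv_poly p q).[dotv x y].
Proof.
move=> Sx Sy; rewrite /conv.
transitivity (sint (fun z => \sum_(k < size q) q`_k * (p.[dotv x z] * dotv y z ^+ k))).
  by apply: eq_sint => z _; rewrite [q.[_]]horner_coef mulr_sumr; apply: eq_bigr => i _; ring.
have a k : adm (fun z : 'cV[R]_n => p.[dotv x z] * dotv y z ^+ k).
  by apply: admM; [apply: adm_horner|apply: admX]; exact: adm_dotv.
rewrite sint_sum//; last by move=> i _; exact: admZ.
rewrite /conv_poly horner_sum; apply: eq_bigr => i _.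
by rewrite sintZ// conv_polyXE// hornerZ.
Qed.

(** With [size_conv_poly] this bounds the degree by that of either factor. *)
Lemma conv_poly_sym p q : conv_poly p q = conv_poly q p.
Proof.
apply: poly_eq_itv => t tI; have Sp := sphere_planar tI.
have Se0 : S e0 by exact: sphere_basis.
by rewrite -[t]dotv_planarl -(conv_polyE p q Se0 Sp) -(conv_polyE q p Se0 Sp) conv_sym.
Qed.

(** Indexed by words of length [k] instead of exponents, so that powers of [dotv] expand with all
    coefficients equal to 1. *)
Definition monom (k : nat) (w : {ffun 'I_k -> 'I_n}) x : R := \prod_(i < k) x (w i) 0.

Lemma adm_monom k (w : {ffun 'I_k -> 'I_n}) : adm (monom w).
Proof. by apply: adm_prod => i _; exact: adm_coord. Qed.

Lemma dotv_exp k x y : dotv x y ^+ k = \sum_(w : {ffun 'I_k -> 'I_n}) monom w x * monom w y.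
Proof.
rewrite -[in LHS](card_ord k) -prodr_const dotvE.
under eq_bigr do rewrite /=.
rewrite bigA_distr_bigA /=; apply: eq_bigr => w _.
by rewrite /monom -big_split.
Qed.

(* Fubini for polynomial kernels: [dotv z y ^+ k] is a finite sum of products. *)
Lemma wint_conv p q r :
  c0 * wintp (conv_poly p q * r) = \sum_(k < size q) q`_k *
    \sum_(w : {ffun 'I_k -> 'I_n})
      sint (fun z => p.[dotv e0 z] * monom w z) * sint (fun y => r.[dotv e0 y] * monom w y).
Proof.
have Se0 : S e0 by exact: sphere_basis.
have a p' k (w : {ffun 'I_k -> 'I_n}) : adm (fun z => p'.[dotv e0 z] * monom w z).
  by apply: admM; [apply: adm_horner; exact: adm_dotv|exact: adm_monom].
rewrite -(sint_zonal hn _ Se0).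
transitivity (sint (fun y => \sum_(k < size q) q`_k * \sum_(w : {ffun 'I_k -> 'I_n})
   sint (fun z => p.[dotv e0 z] * monom w z) * (r.[dotv e0 y] * monom w y))).
  apply: eq_sint => y Sy; rewrite hornerM /conv_poly horner_sum mulr_suml.
  apply: eq_bigr => k _; rewrite hornerZ -mulrA; congr (_ * _).
  rewrite -conv_polyXE//.
  transitivity (sint (fun z => \sum_(w : {ffun 'I_k -> 'I_n}) monom w y * (p.[dotv e0 z] * monom w z)) * r.[dotv e0 y]).
    congr (_ * _); apply: eq_sint => z _; rewrite dotv_exp mulr_sumr.
    by apply: eq_bigr => w _; ring.
  rewrite sint_sum//; last by move=> w _; exact: admZ.
  rewrite mulr_suml; apply: eq_bigr => w _; rewrite sintZ//; ring.
have a2 k (w : {ffun 'I_k -> 'I_n}) : adm (fun y => sint (fun z => p.[dotv e0 z] * monom w z) * (r.[dotv e0 y] * monom w y)).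
  exact: admZ.
rewrite sint_sum//; last by move=> k _; apply: admZ; apply: adm_sum.
apply: eq_bigr => k _; rewrite sintZ//; last by apply: adm_sum.
congr (_ * _); rewrite sint_sum//; apply: eq_bigr => w _.
by rewrite sintZ.
Qed.

(** The outer polynomials [p] and [r] enter the expansion in [wint_conv] symmetrically. *)
Lemma wint_conv_sym p q r : wintp (conv_poly p q * r) = wintp (conv_poly r q * p).
Proof.
apply: (mulfI (lt0r_neq0 c0_gt0)); rewrite !wint_conv.
by apply: eq_bigr => k _; congr (_ * _); apply: eq_bigr => w _; rewrite mulrC.
Qed.

Lemma conv_poly1 p q : (conv_poly p q).[1] = c0 * wintp (p * q).
Proof.
have Se0 : S e0 by exact: sphere_basis.
rewrite -(e00 R hn) -conv_polyE// -(sint_zonal hn _ Se0).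
by apply: eq_sint => z _; rewrite hornerM.
Qed.

Definition orth l p := size p = l.+1 /\ forall r, (size r <= l)%N -> wintp (p * r) = 0.

Lemma orth_neq0 l p : orth l p -> p != 0.
Proof. by move=> [sp _]; rewrite -size_poly_gt0 sp. Qed.

(** Subtracting the multiple of [p] with the same coefficient in degree [l] leaves a polynomial of
    lower degree that is orthogonal to itself. *)
Lemma orth_uniq l p q : orth l p -> (size q <= l.+1)%N ->
  (forall r, (size r <= l)%N -> wintp (q * r) = 0) -> exists c, q = c *: p.
Proof.
move=> [sp op] sq oq; pose c := q`_l / lead_coef p; exists c.
apply/eqP; rewrite -subr_eq0; apply/eqP/wintp_sqr_eq0.
have sz : (size (q - c *: p)%R <= l)%N.
  apply/leq_sizeP => j lj; rewrite coefB coefZ.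
  have [jl|jl] := eqVneq j l.
    rewrite jl /c /lead_coef sp /= divfK ?subrr//.
    by rewrite -[l]/(l.+1.-1) -sp -/(lead_coef p) lead_coef_eq0 -size_poly_gt0 sp.
  have {}lj : (l < j)%N by rewrite ltn_neqAle eq_sym jl lj.
  by rewrite !nth_default ?mulr0 ?subr0// ?sp// (leq_trans sq).
by rewrite mulrBl -scalerAl wintpB wintpZ op// oq// mulr0 subr0.
Qed.

(* Convolution with [q] is self-adjoint and does not raise degrees, so it maps
   each orthogonal polynomial to a multiple of itself. *)
Theorem funk_hecke l p q : orth l p -> exists c, conv_poly p q = c *: p.
Proof.
move=> op; apply: (orth_uniq op).
  by rewrite conv_poly_sym (leq_trans (size_conv_poly _ _))//; case: op => ->.
move=> r sr; rewrite wint_conv_sym mulrC; apply: op.2.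
by rewrite conv_poly_sym (leq_trans (size_conv_poly _ _)).
Qed.

(** Convolving [p] with itself gives a multiple of [p] whose value at 1 is [c0] times the squared
    norm of [p], a positive number. This is what makes normalization at 1 possible. *)
Lemma orth_at1_neq0 l p : orth l p -> p.[1] != 0.
Proof.
move=> op; have [c cp] := funk_hecke p op.
have : (conv_poly p p).[1] != 0.
  by rewrite conv_poly1 gt_eqF// mulr_gt0 ?c0_gt0// wintp_sqr_gt0// (orth_neq0 op).
by rewrite cp hornerZ; apply: contra => /eqP ->; rewrite mulr0.
Qed.

Lemma poly_span (P : nat -> {poly R}) l : (forall j, (j < l)%N -> size (P j) = j.+1) ->
  forall r, (size r <= l)%N -> exists a : nat -> R, r = \sum_(j < l) a j *: P j.
Proof.
elim: l => [|l IH] hP r.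
  by rewrite leqn0 size_poly_eq0 => /eqP ->; exists (fun=> 0); rewrite big_ord0.
move=> sr; pose c := r`_l / lead_coef (P l).
have [||a ra] := IH _ (r - c *: P l).
- by move=> j jl; apply: hP; exact: ltnW.
- have sP := hP l (ltnSn l).
  apply/leq_sizeP => j lj; rewrite coefB coefZ.
  have [jl|jl] := eqVneq j l.
    have lc : lead_coef (P l) != 0 by rewrite lead_coef_eq0 -size_poly_gt0 sP.
    by rewrite jl (_ : (P l)`_l = lead_coef (P l)) ?divfK ?subrr// /lead_coef sP.
  have {}lj : (l < j)%N by rewrite ltn_neqAle eq_sym jl lj.
  by rewrite !nth_default ?mulr0 ?subr0// ?sP// (leq_trans sr).
exists (fun j => if j == l then c else a j); rewrite big_ord_recr /= eqxx.
rewrite -[LHS](subrK (c *: P l)) ra; congr (_ + _); apply: eq_bigr => j _.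
by rewrite (ltn_eqF (ltn_ord j)).
Qed.

(** Gram-Schmidt on the monomials. As [orth] mentions no other member of the family, families for
    different [l] need not agree, and one polynomial per degree can be chosen afterwards. *)
Lemma orth_exists_upto l : exists P : nat -> {poly R}, forall j, (j < l)%N -> orth j (P j).
Proof.
elim: l => [|l [P hP]]; first by exists (fun=> 0).
pose p := 'X^l - \sum_(j < l) (wintp ('X^l * P j) / wintp (P j * P j)) *: P j.
exists (fun j => if j == l then p else P j) => j; rewrite ltnS leq_eqVlt.
case/orP => [/eqP ->|jl]; last by rewrite (ltn_eqF jl); exact: hP.
rewrite eqxx; split.
  rewrite /p size_polyDl ?size_polyXn// size_polyN ltnS.
  apply: (leq_trans (size_sum _ _ _)); apply/bigmax_leqP => i _.
  by apply: (leq_trans (size_scale_leq _ _)); rewrite (hP _ (ltn_ord i)).1.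
move=> r sr; have [a ->] := poly_span (fun j jl => (hP j jl).1) sr.
rewrite mulr_sumr wintp_sum big1// => i _; rewrite -scalerAr wintpZ.
rewrite /p mulrBl wintpB mulr_suml wintp_sum (bigD1 i)//= -scalerAl wintpZ.
have Pi0 : wintp (P i * P i) != 0 by rewrite gt_eqF// wintp_sqr_gt0// (orth_neq0 (hP _ (ltn_ord i))).
rewrite divfK// big1 ?addr0 ?subrr ?mulr0// => k ki.
rewrite -scalerAl wintpZ (_ : wintp (P k * P i) = 0) ?mulr0//.
have : (nat_of_ord k != i) by [].
rewrite neq_ltn => /orP[h|h].
  by rewrite mulrC (hP _ (ltn_ord i)).2// (hP _ (ltn_ord k)).1.
by rewrite (hP _ (ltn_ord k)).2// (hP _ (ltn_ord i)).1.
Qed.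

Notation G := (gegenbauer (geg_index R n)).

Lemma gegenbauerP : is_gegenbauer (geg_index R n) G.
Proof.
apply: (@xgetPex _ (fun=> 0) [set C | is_gegenbauer (geg_index R n) C]).
have ex l : exists p, orth l p by have [P] := orth_exists_upto l.+1; exists (P l); auto.
have [P hP] := choice ex.
exists (fun l => (P l).[1]^-1 *: P l); split=> /=.
- by move=> l; rewrite size_scale ?invr_eq0 ?(orth_at1_neq0 (hP l))// (hP l).1.
- move=> l m lm; transitivity (wintp (((P l).[1]^-1 *: P l) * ((P m).[1]^-1 *: P m))).
    by apply: eq_Rintegral => s _; rewrite hornerM mulrA.
  rewrite -scalerAl -scalerAr !wintpZ (_ : wintp (P l * P m) = 0) ?mulr0//.
  move: lm; rewrite neq_ltn => /orP[h|h].
    by rewrite mulrC (hP m).2// (hP l).1.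
  by rewrite (hP l).2// (hP m).1.
- by move=> l; rewrite hornerZ mulVf// (orth_at1_neq0 (hP l)).
Qed.

Lemma size_gegenbauer l : size (G l) = l.+1.
Proof. by case: gegenbauerP. Qed.

Lemma gegenbauer1 l : (G l).[1] = 1.
Proof. by case: gegenbauerP. Qed.

Lemma gegenbauer_orthogonal l m : l != m -> wintp (G l * G m) = 0.
Proof.
case: gegenbauerP => _ h _ lm; rewrite -[RHS](h l m lm).
by apply: eq_Rintegral => s _; rewrite hornerM mulrA.
Qed.

Lemma gegenbauer_orth l : orth l (G l).
Proof.
split; first exact: size_gegenbauer.
move=> r sr; have [a ->] := poly_span (fun j _ => size_gegenbauer j) sr.
rewrite mulr_sumr wintp_sum big1// => i _; rewrite -scalerAr wintpZ.
by rewrite gegenbauer_orthogonal ?mulr0// neq_ltn ltn_ord orbT.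
Qed.

Definition gnorm l := wintp (G l * G l).

Lemma gegenbauer_sqnormE l : gegenbauer_sqnorm (geg_index R n) l = gnorm l.
Proof. by apply: eq_Rintegral => s _; rewrite hornerM expr2. Qed.

Lemma gnorm_gt0 l : 0 < gnorm l.
Proof. by rewrite wintp_sqr_gt0// (orth_neq0 (gegenbauer_orth l)). Qed.

(** The eigenvalue is read off at 1, where [G l] takes the value 1. *)
Lemma conv_gegenbauer l q : conv_poly (G l) q = (c0 * wintp (q * G l)) *: G l.
Proof.
have [c h] := funk_hecke q (gegenbauer_orth l); rewrite h; congr (_ *: _).
have := conv_poly1 (G l) q; rewrite h hornerZ gegenbauer1 mulr1 => ->.
by rewrite [G l * q]mulrC.
Qed.

Lemma sint_gegenbauer l q x y : S x -> S y ->
  sint (fun z => (G l).[dotv x z] * q.[dotv y z]) = c0 * wintp (q * G l) * (G l).[dotv x y].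
Proof. by move=> Sx Sy; rewrite [LHS](conv_polyE _ _ Sx Sy) conv_gegenbauer hornerZ. Qed.

(** Zonal functions at two poles with inner product [t] have the same square integral [k], and their
    product integrates to [k * (G l).[t]]. The squares of their sum and difference have nonnegative
    integrals. *)
Lemma gegenbauer_le1 l t : t \in `[-1, 1] -> `|(G l).[t]| <= 1.
Proof.
move=> tI; pose k := c0 * gnorm l.
have k0 : 0 < k by rewrite mulr_gt0 ?c0_gt0 ?gnorm_gt0.
have Se0 : S e0 by exact: sphere_basis.
have Sp := sphere_planar tI.
pose u z := (G l).[dotv e0 z]; pose v z := (G l).[dotv (planar t) z].
have au : adm u by apply: adm_horner; exact: adm_dotv.
have av : adm v by apply: adm_horner; exact: adm_dotv.
have uu : sint (fun z => u z * u z) = k.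
  by rewrite sint_gegenbauer// e00 gegenbauer1 mulr1.
have vv : sint (fun z => v z * v z) = k.
  by rewrite sint_gegenbauer//; move/sphere_dotv : Sp => ->; rewrite gegenbauer1 mulr1.
have uv : sint (fun z => u z * v z) = k * (G l).[t] by rewrite sint_gegenbauer// dotv_planarl.
have key e : e ^+ 2 = 1 -> 0 <= 2 * (k * (1 + e * (G l).[t])).
  move=> e2; have : 0 <= sint (fun z => (u z + e * v z) ^+ 2) by apply: sint_ge0 => z _; exact: sqr_ge0.
  rewrite (@eq_sint _ _ _ (fun z => (u z * u z + v z * v z) + (2 * e) * (u z * v z))); last first.
    by move=> z _; rewrite sqrrD exprMn e2; ring.
  rewrite sintD ?sintD ?sintZ ?uu ?vv ?uv//; try by [exact: admM|apply: admZ; exact: admM|apply: admD; exact: admM].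
  by move=> h; apply: le_trans h _; rewrite le_eqVlt; apply/orP; left; apply/eqP; ring.
have h1 := key 1 (expr1n _ _).
have h2 : 0 <= 2 * (k * (1 + -1 * (G l).[t])) by apply: key; rewrite sqrrN expr1n.
rewrite ler_norml; apply/andP; split.
  by move: h1; rewrite pmulr_rge0// pmulr_rge0//; lra.
by move: h2; rewrite pmulr_rge0// pmulr_rge0//; lra.
Qed.

End funk_hecke.

(** * Positive definiteness tested on measures *)

Section discretization.
Context (R : realType) (n : nat).
Hypothesis hn : (2 <= n)%N.
Notation S := (unit_sphere R n).
Notation sint := (@sint R n).
Notation A := (sphere_area R n).

Let A0 : 0 < A. Proof. by apply: sphere_area_gt0; exact: leq_trans hn. Qed.

Lemma sint_exists_le (g : 'cV[R]_n -> R) (eta : R) : adm g -> sint g < eta * A ->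
  exists2 x, S x & g x <= eta.
Proof.
move=> ag gA; apply: contrapT => h; suff : eta * A <= sint g by rewrite leNgt gA.
rewrite -sint_cst//; apply: sint_le => //; first exact: adm_cst.
move=> x Sx; rewrite leNgt; apply/negP => gx; apply: h; exists x => //; exact: ltW.
Qed.

(* Maurey's argument: pick the points greedily, so that the squared distance
   between the sum of the samples and its mean grows at most linearly. *)
Lemma discretize (T : finType) (Phi : T -> 'cV[R]_n -> R) (delta : R) : 0 < delta ->
  (forall t, adm (Phi t)) ->
  exists2 xs : seq 'cV[R]_n, xs != [::] /\ (forall x, x \in xs -> S x) &
    forall t, `|A / (size xs)%:R * (\sum_(x <- xs) Phi t x) - sint (Phi t)| <= delta.
Proof.
move=> d0 aPhi; pose phi t x := Phi t x - sint (Phi t) / A.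
have aphi t : adm (phi t) by apply: admB => //; exact: adm_cst.
have phi0 t : sint (phi t) = 0.
  by rewrite sintB ?sint_cst ?divfK ?subrr ?gt_eqF//; exact: adm_cst.
have aV : adm (fun x => \sum_t phi t x ^+ 2) by apply: adm_sum => t _; exact: admX.
have [_ [C hC]] := aV.
(* The summand 1 pays for the slack in choosing the next point, whose cross term is only made at
   most 1. *)
pose C' := `|C| + 1; have C'0 : 0 < C' by rewrite /C' ltr_wpDl.
have step m : exists2 xs : seq 'cV[R]_n, size xs = m /\ (forall x, x \in xs -> S x) &
    \sum_t (\sum_(x <- xs) phi t x) ^+ 2 <= m%:R * C'.
  elim: m => [|m [xs [sxs Sxs] hxs]].
    exists [::] => //; rewrite mul0r big1// => t _; by rewrite big_nil expr0n.
  pose D t := \sum_(x <- xs) phi t x.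
  pose g x := \sum_t (2 * D t) * phi t x.
  have ag : adm g by apply: adm_sum => t _; exact: admZ.
  have g0 : sint g = 0.
    by rewrite sint_sum ?big1// => t _; [rewrite sintZ// phi0 mulr0|exact: admZ].
  have [x Sx gx] : exists2 x, S x & g x <= 1.
    by apply: sint_exists_le => //; rewrite g0 mul1r.
  exists (x :: xs).
    split; first by rewrite /= sxs.
    by move=> y; rewrite inE => /orP[/eqP ->|/Sxs].
  have -> : \sum_t (\sum_(y <- x :: xs) phi t y) ^+ 2 =
      \sum_t D t ^+ 2 + g x + \sum_t phi t x ^+ 2.
    rewrite /g -!big_split /=; apply: eq_bigr => t _.
    by rewrite big_cons -/(D t); ring.
  have := hC x Sx; have := ler_norm (\sum_t phi t x ^+ 2); have := ler_norm C.
  rewrite -natr1 mulrDl mul1r; move: hxs; rewrite -/(D _) /C' => h1 h2 h3 h4.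
  by move: h1 h2 h3 h4 gx; rewrite /D; lra.
(* Enough samples to bring the squared error bound [C' * A ^+ 2 / m] below [delta ^+ 2]. *)
pose m := (Num.truncn (C' * A ^+ 2 / delta ^+ 2)).+1.
have [xs [sxs Sxs] hxs] := step m.
have m0 : 0 < m%:R :> R by rewrite ltr0n.
exists xs; first by split=> //; rewrite -size_eq0 sxs.
move=> t; rewrite sxs.
have -> : A / m%:R * \sum_(x <- xs) Phi t x - sint (Phi t) = A / m%:R * \sum_(x <- xs) phi t x.
  rewrite /phi sumrB mulrBr; congr (_ - _).
  rewrite big_const_seq count_predT sxs iter_addr_0 -[X in _ = _ * X]mulr_natl.
  by field; rewrite !gt_eqF.
have ht : (\sum_(x <- xs) phi t x) ^+ 2 <= m%:R * C'.
  apply: le_trans hxs; rewrite (bigD1 t)//= lerDl.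
  by apply: sumr_ge0 => i _; exact: sqr_ge0.
rewrite -(@ler_pXn2r _ 2)// ?nnegrE ?(ltW d0)// real_normK ?num_real// exprMn expr_div_n.
apply: (@le_trans _ _ (A ^+ 2 / m%:R ^+ 2 * (m%:R * C'))).
  by rewrite ler_wpM2l// divr_ge0// sqr_ge0.
have -> : A ^+ 2 / m%:R ^+ 2 * (m%:R * C') = C' * A ^+ 2 / m%:R by field; rewrite gt_eqF.
rewrite ler_pdivrMr// [leRHS]mulrC -ler_pdivrMr ?exprn_gt0//.
by apply: ltW; exact: truncnS_gt.
Qed.

End discretization.

Section kernel_energy.
Context (R : realType).

Lemma kernel_fin (T : Type) (E : set T) (K : T -> T -> R) (I : finType) (x : I -> T) (a : I -> R) :
  is_kernel E K -> (forall i, E (x i)) -> 0 <= \sum_i \sum_j a i * a j * K (x i) (x j).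
Proof.
move=> [_ hK] Ex.
have := hK #|I| (fun k => x (enum_val k)) (fun k => a (enum_val k)) (fun k => Ex _).
rewrite (big_enum_val (A := I) (fun i => \sum_j a i * a j * K (x i) (x j))) /=.
congr (0 <= _); apply: eq_bigr => k _.
by rewrite (big_enum_val (A := I) (fun j => a (enum_val k) * a j * K (x (enum_val k)) (x j))).
Qed.

Lemma sum_option (T : finType) (F : option T -> R) :
  \sum_o F o = F None + \sum_t F (Some t).
Proof.
rewrite (bigD1 None)//=; congr (_ + _); rewrite (reindex_omap Some id) => [|[]//] /=.
by apply: eq_bigl => t; rewrite eqxx.
Qed.

Lemma cvg_bigsum (I : Type) (r : seq I) (F : I -> R^nat) (l : I -> R) :
  (forall i, F i k @[k --> \oo] --> l i) ->
  (\sum_(i <- r) F i k) @[k --> \oo] --> \sum_(i <- r) l i.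
Proof.
move=> h; elim: r => [|i r IH].
  rewrite big_nil (_ : (fun k => _) = fun=> 0); first exact: cvg_cst.
  by apply: funext => k; rewrite big_nil.
rewrite big_cons (_ : (fun k => _) = fun k => F i k + \sum_(j <- r) F j k).
  by apply: cvgD => //; exact: h.
by apply: funext => k; rewrite big_cons.
Qed.

End kernel_energy.

(** * Energy of a Dirac mass plus a zonal density *)

Section energy.
Context (R : realType) (n : nat).
Hypothesis hn : (2 <= n)%N.
Notation S := (unit_sphere R n).
Notation sint := (@sint R n).
Notation A := (sphere_area R n).
Notation e0 := (basis_vec R (i0 hn)).
Notation c0 := (sphere_area R n.-1).
Notation wintp p := (wint n (fun s => (p : {poly R}).[s])).
Variables (K : 'cV[R]_n -> 'cV[R]_n -> R) (M : nat) (rad : 'I_M -> R).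
Hypothesis hK : is_kernel (unit_ball R n) K.
Hypothesis hrad : forall i, unit_interval R (rad i).
Variables (q : 'I_M -> 'I_M -> {poly R}) (eps : R).
Hypothesis eps0 : 0 <= eps.
Hypothesis hq : forall i j x y, S x -> S y ->
  `|K (rad i *: x) (rad j *: y) - (q i j).[dotv x y]| <= eps.
Variables (b : 'I_M -> R) (h : 'I_M -> {poly R}).

(* [mass] bounds the total variation of the signed measures
   [b i delta_e0 + h i (dotv e0 _) d sigma] and of their discretizations. *)
Variable mass : R.
Hypothesis hmass : forall xs : seq 'cV[R]_n, xs != [::] -> (forall x, x \in xs -> S x) ->
  \sum_i (`|b i| + A / (size xs)%:R * \sum_(x <- xs) `|(h i).[dotv e0 x]|) <= mass.

(** The moments of the test measures against monomials. The energy of a polynomial kernel is a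
    finite sum in these, so convergence of the moments under sampling is enough. *)
Let nu i (k : nat) (w : {ffun 'I_k -> 'I_n}) : R :=
  b i * monom w e0 + sint (fun z => (h i).[dotv e0 z] * monom w z).

Let energy (v : 'I_M -> forall k, {ffun 'I_k -> 'I_n} -> R) : R :=
  \sum_i \sum_j \sum_(k < size (q i j)) (q i j)`_k * \sum_w v i k w * v j k w.

Let dnu (xs : seq 'cV[R]_n) i (k : nat) (w : {ffun 'I_k -> 'I_n}) : R :=
  b i * monom w e0 + A / (size xs)%:R * \sum_(x <- xs) (h i).[dotv e0 x] * monom w x.

(** [K] is positive on the atoms of the sample; replacing it by the polynomials [q] costs at most
    [eps] times the squared total variation. *)
Let dnu_energy xs : xs != [::] -> (forall x, x \in xs -> S x) ->
  - (eps * mass ^+ 2) <= energy (dnu xs).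
Proof.
move=> xs0 Sxs; pose m := size xs.
(* An atom is a radius index with [None] for the pole or [Some p] for the sample number [p]. *)
pose I : finType := ('I_M * option 'I_m)%type.
pose pt (o : option 'I_m) : 'cV[R]_n := if o is Some p then nth 0 xs p else e0.
pose wt (u : I) : R := if u.2 is Some p then A / m%:R * (h u.1).[dotv e0 (nth 0 xs p)] else b u.1.
have Spt o : S (pt o).
  by case: o => [p|] /=; [apply: Sxs; exact: mem_nth|exact: sphere_basis].
have dnuE i k w : dnu xs i w = \sum_o wt (i, o) * @monom R n k w (pt o).
  rewrite sum_option /= /dnu; congr (_ + _).
  rewrite (big_nth 0) big_mkord mulr_sumr; apply: eq_bigr => p _.
  by rewrite /wt /= mulrA.
have EE : energy (dnu xs) = \sum_u \sum_v wt u * wt v * (q u.1 v.1).[dotv (pt u.2) (pt v.2)].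
  rewrite /energy -(pair_bigA _ (fun i o => \sum_v wt (i, o) * wt v * (q i v.1).[dotv (pt o) (pt v.2)])) /=.
  apply: eq_bigr => i _.
  under [RHS]eq_bigr => o _.
    rewrite -(pair_bigA _ (fun j o' => wt (i, o) * wt (j, o') * (q i j).[dotv (pt o) (pt o')])) /=.
    over.
  rewrite exchange_big /=; apply: eq_bigr => j _.
  transitivity (\sum_o \sum_o' \sum_(k < size (q i j)) (q i j)`_k * \sum_w (wt (i, o) * @monom R n k w (pt o)) * (wt (j, o') * monom w (pt o'))); last first.
    apply: eq_bigr => o _; apply: eq_bigr => o' _.
    rewrite horner_coef mulr_sumr; apply: eq_bigr => k _.
    rewrite dotv_exp mulrCA; congr (_ * _); rewrite mulr_sumr.
    by apply: eq_bigr => w _; ring.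
  under [RHS]eq_bigr => o _ do rewrite exchange_big /=.
  rewrite exchange_big /=; apply: eq_bigr => k _.
  under [RHS]eq_bigr => o _ do rewrite -mulr_sumr.
  rewrite -mulr_sumr; congr (_ * _).
  under [RHS]eq_bigr => o _ do rewrite exchange_big /=.
  rewrite exchange_big /=; apply: eq_bigr => w _.
  rewrite !dnuE mulr_suml; apply: eq_bigr => o _.
  by rewrite mulr_sumr.
have psd := @kernel_fin R _ _ K I (fun u => rad u.1 *: pt u.2) wt hK (fun u => polar_ball (hrad _) (Spt _)).
have mass_le : \sum_u `|wt u| <= mass.
  apply: le_trans (hmass xs0 Sxs); rewrite le_eqVlt; apply/orP; left; apply/eqP.
  rewrite -(pair_bigA _ (fun i o => `|wt (i, o)|)) /=; apply: eq_bigr => i _.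
  rewrite sum_option /=; congr (_ + _).
  rewrite (big_nth 0) big_mkord mulr_sumr; apply: eq_bigr => p _.
  by rewrite normrM ger0_norm// divr_ge0 ?ler0n// fine_ge0.
have mass0 : 0 <= mass by apply: le_trans mass_le; apply: sumr_ge0.
rewrite EE -subr_ge0 opprK; apply: le_trans psd _.
have -> : eps * mass ^+ 2 = eps * mass * mass by rewrite expr2 mulrA.
apply: (@le_trans _ _ (\sum_u \sum_v (wt u * wt v * (q u.1 v.1).[dotv (pt u.2) (pt v.2)] + `|wt u| * `|wt v| * eps))).
  apply: ler_sum => u _; apply: ler_sum => v _.
  rewrite -lerBlDl -mulrBr; apply: le_trans (ler_norm _) _.
  by rewrite normrM normrM ler_wpM2l ?mulr_ge0// hq.
under eq_bigr => u _ do rewrite big_split /=.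
rewrite big_split /= lerD2l.
have -> : \sum_(i : I) \sum_(i2 : I) `|wt i| * `|wt i2| * eps = eps * (\sum_u `|wt u|) * \sum_u `|wt u|.
  rewrite -mulrA mulr_suml mulr_sumr; apply: eq_bigr => u _.
  by rewrite mulr_sumr mulr_sumr; apply: eq_bigr => v _; ring.
by rewrite -!mulrA ler_wpM2l// ler_pM// sumr_ge0.
Qed.

Let adm_hm i k (w : {ffun 'I_k -> 'I_n}) :
  adm (fun z : 'cV[R]_n => (h i).[dotv e0 z] * monom w z).
Proof. by apply: admM; [apply: adm_horner; exact: adm_dotv|exact: adm_monom]. Qed.

Let nu_energy : - (eps * mass ^+ 2) <= energy nu.
Proof.
(* Bounding the sizes of all [q i j] leaves finitely many monomials, so one sample approximates all
   their moments at once. *)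
pose Kmax := \max_(ij : 'I_M * 'I_M) size (q ij.1 ij.2).
pose T : finType := ('I_M * {k : 'I_Kmax & {ffun 'I_k -> 'I_n}})%type.
pose Phi (t : T) z := (h t.1).[dotv e0 z] * monom (tagged t.2) z.
have ex (N : nat) : exists xs : seq 'cV[R]_n, [/\ xs != [::], (forall x, x \in xs -> S x) &
    forall t, `|A / (size xs)%:R * (\sum_(x <- xs) Phi t x) - sint (Phi t)| <= N.+1%:R^-1].
  have N0 : 0 < N.+1%:R^-1 :> R by rewrite invr_gt0.
  have [xs [xs0 Sxs] hxs] := discretize hn N0 (fun t : T => adm_hm t.1 (tagged t.2)).
  by exists xs.
have [xs hxs] := choice ex.
have cv i k (w : {ffun 'I_k -> 'I_n}) : (k < Kmax)%N -> dnu (xs N) i w @[N --> \oo] --> nu i w.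
  move=> kK; apply: cvgD; first exact: cvg_cst.
  apply/cvgrPdist_le => e e0'; near=> N.
  have [_ _ hN] := hxs N.
  have := hN (i, Tagged (fun k : 'I_Kmax => {ffun 'I_k -> 'I_n}) (i := Ordinal kK) w).
  rewrite distrC /Phi /=; move=> /le_trans; apply.
  apply: ltW; near: N; exact: (near_infty_natSinv_lt (PosNum e0')).
have cE : energy (dnu (xs N)) @[N --> \oo] --> energy nu.
  apply: cvg_bigsum => i; apply: cvg_bigsum => j; apply: cvg_bigsum => k.
  apply: cvgM; first exact: cvg_cst.
  have kK : (k < Kmax)%N.
    exact: leq_trans (ltn_ord k) (leq_bigmax (F := fun ij : 'I_M * 'I_M => size (q ij.1 ij.2)) (i, j)).
  by apply: cvg_bigsum => w; apply: cvgM; exact: cv.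
apply: (cvgr_to_ge cE).
by apply: nearW => N; have [xs0 Sxs _] := hxs N; exact: dnu_energy.
Unshelve. all: by end_near. Qed.

Lemma energy_ge0 : - (eps * mass ^+ 2) <= \sum_i \sum_j
  (b i * b j * (q i j).[1] + b i * (c0 * wintp (h j * q i j)) + b j * (c0 * wintp (h i * q i j))
   + c0 * wintp (conv_poly hn (h i) (q i j) * h j)).
Proof.
apply: le_trans nu_energy _; rewrite le_eqVlt; apply/orP; left; apply/eqP.
have zonal (p r : {poly R}) : \sum_(k < size r) r`_k * \sum_(w : {ffun 'I_k -> 'I_n})
    monom w e0 * sint (fun z => p.[dotv e0 z] * monom w z) = c0 * wintp (p * r).
  have a k (w : {ffun 'I_k -> 'I_n}) : adm (fun z : 'cV[R]_n => p.[dotv e0 z] * monom w z).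
    by apply: admM; [apply: adm_horner; exact: adm_dotv|exact: adm_monom].
  rewrite -(sint_zonal hn _ (sphere_basis R (i0 hn))).
  transitivity (sint (fun z => \sum_(k < size r) r`_k * \sum_(w : {ffun 'I_k -> 'I_n})
     monom w e0 * (p.[dotv e0 z] * monom w z))).
    rewrite sint_sum//; last by move=> k _; apply: admZ => //; apply: adm_sum => // w _; exact: admZ.
    apply: eq_bigr => k _; rewrite sintZ//; last by apply: adm_sum => // w _; exact: admZ.
    congr (_ * _); rewrite sint_sum//; last by move=> w _; exact: admZ.
    by apply: eq_bigr => w _; rewrite sintZ.
  apply: eq_sint => z _; rewrite hornerM [r.[_]]horner_coef mulr_sumr; apply: eq_bigr => k _.
  rewrite dotv_exp mulrCA; congr (_ * _); rewrite mulr_sumr.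
  by apply: eq_bigr => w _; ring.
apply: eq_bigr => i _; apply: eq_bigr => j _.
rewrite wint_conv -!zonal [(q i j).[1]]horner_coef !mulr_sumr -!big_split /=.
apply: eq_bigr => k _.
rewrite -[1](e00 R hn) dotv_exp !mulr_sumr -!big_split /=.
by apply: eq_bigr => w _; rewrite /nu; ring.
Qed.

End energy.

(** * Radial coefficients of an invariant kernel *)

Section weierstrass.
Context (R : realType).
Implicit Types (g : R -> R) (F : nat -> R) (u : R).

(* [bernstein N F] is the Bernstein polynomial \sum_k F k 'C(N, k) X^k (1 - X)^(N - k). *)
Fixpoint bernstein (N : nat) (F : nat -> R) : {poly R} :=
  if N is N'.+1 then 'X * bernstein N' (fun k => F k.+1) + (1 - 'X) * bernstein N' F
  else (F 0%N)%:P.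

Lemma bernsteinS N F u : (bernstein N.+1 F).[u] =
  u * (bernstein N (fun k => F k.+1)).[u] + (1 - u) * (bernstein N F).[u].
Proof. by rewrite /= !hornerE. Qed.

Lemma bernstein_le N F G u : 0 <= u -> u <= 1 -> (forall k, (k <= N)%N -> F k <= G k) ->
  (bernstein N F).[u] <= (bernstein N G).[u].
Proof.
move=> u0 u1; elim: N F G => [|N IH] F G FG; first by rewrite /= !hornerC FG.
rewrite !bernsteinS lerD// ler_wpM2l ?subr_ge0// IH// => k kN; apply: FG => //.
exact: leqW.
Qed.

(** Mean and variance of the binomial distribution with parameters N and u, in the form of the
    second moment about [a]. *)
Lemma bernstein_quadratic N (al be a u : R) :
  (bernstein N (fun k => al + be * (k%:R - a) ^+ 2)).[u] =
  al + be * (N%:R * u * (1 - u) + (N%:R * u - a) ^+ 2).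
Proof.
elim: N a => [|N IH] a; first by rewrite /= hornerC; ring.
rewrite bernsteinS IH.
rewrite (_ : (fun k : nat => _) = fun k => al + be * (k%:R - (a - 1)) ^+ 2); last first.
  by apply: funext => k; rewrite -natr1; congr (_ + _ * _ ^+ 2); ring.
by rewrite IH -natr1; ring.
Qed.

Lemma segment_unif_continuous g (e : R) : {within `[-1, 1], continuous g} -> 0 < e ->
  exists2 d, 0 < d & forall s t, s \in `[-1, 1] -> t \in `[-1, 1] ->
    `|s - t| < d -> `|g s - g t| <= e.
Proof.
move=> cg e0.
have := @segment_compact R (-1) 1; rewrite compact_near_coveringP -near_covering_withinP.
move=> /(_ nat \oo (fun N s => forall t, t \in `[-1, 1] -> `|s - t| < N.+1%:R^-1 -> `|g s - g t| <= e)) h.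
have : \forall N \near \oo, `[-1, 1] `<=` (fun s => forall t, t \in `[-1, 1] -> `|s - t| < N.+1%:R^-1 -> `|g s - g t| <= e).
  apply: h => s0 s0I.
  have e2 : 0 < e / 2 by rewrite divr_gt0.
  have /subspace_continuousP/(_ _ s0I)/cvgrPdist_lt/(_ _ e2) := cg.
  rewrite near_withinE => /nbhs_normP[d /= d0 hd].
  have d2 : 0 < d / 2 by rewrite divr_gt0.
  near=> s N => sI t tI st.
  have ss0 : `|s0 - s| < d / 2.
    by near: s; apply/nbhs_normP; exists (d / 2).
  have Nd : N.+1%:R^-1 < d / 2 by near: N; exact: (near_infty_natSinv_lt (PosNum d2)).
  have h1 : `|g s0 - g s| < e / 2 by apply: hd => //=; lra.
  have h3 : `|s0 - t| < d.
    apply: le_lt_trans (ler_distD s s0 t) _; rewrite [d]splitr ltrD//.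
    exact: lt_trans st Nd.
  have h2 : `|g s0 - g t| < e / 2 by exact: hd.
  rewrite /= (le_trans (ler_distD (g s0) (g s) (g t)))// [e]splitr lerD// ltW//.
  by rewrite distrC.
case=> N _ /(_ N (leqnn N)) hN; exists N.+1%:R^-1; first by rewrite invr_gt0.
by move=> s t sI tI st; exact: hN.
Unshelve. all: by end_near. Qed.

(** A modulus that [bernstein_quadratic] evaluates exactly. Beyond distance [d] the quadratic term
    with constant [2 * M / d ^+ 2] already exceeds the oscillation of [g]. *)
Lemma segment_quadratic_modulus g (e : R) : {within `[-1, 1], continuous g} -> 0 < e ->
  exists2 c, 0 <= c & forall s t, s \in `[-1, 1] -> t \in `[-1, 1] ->
    `|g s - g t| <= e + c * (s - t) ^+ 2.
Proof.
move=> cg e0; have [d d0 hd] := segment_unif_continuous cg e0.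
have [M M0 hM] := cI_bounded cg.
exists (2 * M / d ^+ 2); first by rewrite divr_ge0 ?sqr_ge0// mulr_ge0.
move=> s t sI tI; have [st|st] := ltP `|s - t| d.
  by apply: le_trans (hd _ _ sI tI st) _; rewrite lerDl mulr_ge0 ?sqr_ge0// divr_ge0 ?sqr_ge0// mulr_ge0.
apply: (@le_trans _ _ (2 * M)).
  by apply: le_trans (ler_normB _ _) _; rewrite mulr_natl mulr2n lerD ?hM.
have h : 2 * M <= 2 * M / d ^+ 2 * (s - t) ^+ 2.
  rewrite mulrAC ler_pdivlMr ?exprn_gt0// ler_wpM2l ?mulr_ge0//.
  by rewrite -[leRHS]real_normK ?num_real//; apply: lerXn2r; rewrite // nnegrE ltW.
by rewrite (le_trans h)// lerDr ltW.
Qed.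

Theorem weierstrass g (e : R) : {within `[-1, 1], continuous g} -> 0 < e ->
  exists p : {poly R}, forall s, s \in `[-1, 1] -> `|g s - p.[s]| <= e.
Proof.
move=> cg e0; have e2 : 0 < e / 2 by rewrite divr_gt0.
have [c c0 hc] := segment_quadratic_modulus cg e2.
(* The variance contributes [4 * (u * (1 - u)) * (c / N%:R)], whose first factor is at most 1; so
   [c / N%:R <= e / 2] is what is required. *)
have [N N0 Nc] : exists2 N : nat, 0 < N%:R :> R & 2 * c <= e * N%:R.
  exists (Num.truncn (2 * c / e)).+1; first by rewrite ltr0n.
  by rewrite [leRHS]mulrC -ler_pdivrMr//; apply: ltW; exact: truncnS_gt.
pose node (k : nat) : R := 2 * (k%:R / N%:R) - 1.
pose B := bernstein N (g \o node).
exists (B \Po (2^-1 *: ('X + 1))) => s sI.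
rewrite horner_comp !hornerE /=; set u := 2^-1 * (s + 1).
have su : s = 2 * u - 1 by rewrite /u; field.
have [u0 u1] : 0 <= u /\ u <= 1.
  by move: sI; rewrite in_itv/= /u => /andP[? ?]; split; lra.
have nodeI k : (k <= N)%N -> node k \in `[-1, 1].
  move=> kN; rewrite in_itv/= /node.
  have h0 : 0 <= k%:R / N%:R :> R by rewrite divr_ge0.
  have h1 : k%:R / N%:R <= 1 :> R by rewrite ler_pdivrMr// mul1r ler_nat.
  by move: (_ / _) h0 h1 => v *; lra.
pose q : R := 4 * c / N%:R ^+ 2.
have q0 : 0 <= q by rewrite divr_ge0 ?sqr_ge0// mulr_ge0.
have bd k : (k <= N)%N -> `|g s - g (node k)| <= e / 2 + q * (k%:R - N%:R * u) ^+ 2.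
  move=> kN; apply: le_trans (hc _ _ sI (nodeI k kN)) _.
  rewrite lerD2l le_eqVlt; apply/orP; left; apply/eqP.
  by rewrite su /node /q; field; rewrite gt_eqF.
have var : q * (N%:R * u * (1 - u) + (N%:R * u - N%:R * u) ^+ 2) <= e / 2.
  have -> : q * (N%:R * u * (1 - u) + (N%:R * u - N%:R * u) ^+ 2) = 4 * (u * (1 - u)) * (c / N%:R).
    by rewrite /q; field; rewrite gt_eqF.
  have h1 : c / N%:R <= e / 2 by rewrite ler_pdivrMr//; lra.
  have h2 : 0 <= c / N%:R by rewrite divr_ge0.
  have h3 : 4 * (u * (1 - u)) <= 1 by have := sqr_ge0 (2 * u - 1); nra.
  by apply: le_trans h1; rewrite ler_piMl.
rewrite distrC ler_norml; apply/andP; split.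
  rewrite lerBrDl; apply: (@le_trans _ _ (bernstein N (fun k => (g s - e / 2) + (- q) * (k%:R - N%:R * u) ^+ 2)).[u]).
    by rewrite bernstein_quadratic mulNr; lra.
  apply: bernstein_le => // k /bd; rewrite ler_norml => /andP[_ h] /=; lra.
rewrite lerBlDl; apply: (@le_trans _ _ (bernstein N (fun k => (g s + e / 2) + q * (k%:R - N%:R * u) ^+ 2)).[u]).
  apply: bernstein_le => // k /bd; rewrite ler_norml => /andP[h _] /=; lra.
by rewrite bernstein_quadratic; lra.
Qed.

End weierstrass.

Section within_composition.

Lemma within_continuous_into (T U V : topologicalType) (D : set T) (E : set U)
    (f : T -> U) (g : U -> V) : continuous f -> (forall x, D x -> E (f x)) ->
  {within E, continuous g} -> {within D, continuous (g \o f)}.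
Proof.
move=> cf DE /subspace_continuousP cg; apply/subspace_continuousP => x Dx.
have cfx : f y @[y --> within D (nbhs x)] --> within E (nbhs (f x)).
  move=> P h; have {}h : nbhs x [set y | E (f y) -> P (f y)] := cf x _ h.
  change (nbhs x [set y | D y -> P (f y)]).
  by apply: filterS h => y hy Dy; exact: hy (DE _ Dy).
exact: cvg_comp cfx (cg _ (DE _ Dx)).
Qed.

End within_composition.

(** * The zonal profile of an invariant kernel and its coefficients *)

Section radial_coefficients.
Context (R : realType) (n : nat).
Hypothesis hn : (2 <= n)%N.
Notation S := (unit_sphere R n).
Notation A := (sphere_area R n).
Notation e0 := (basis_vec R (i0 hn)).
Notation e1 := (basis_vec R (i1 hn)).
Notation c0 := (sphere_area R n.-1).
Notation wintp p := (wint n (fun s => (p : {poly R}).[s])).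
Notation G := (gegenbauer (geg_index R n)).
Notation gnorm := (gnorm R n).
Variable K : 'cV[R]_n -> 'cV[R]_n -> R.
Hypothesis hK : is_kernel (unit_ball R n) K.
Hypothesis cK : kernel_continuous (unit_ball R n) K.
Hypothesis oK : O_invariant K.

Definition kappa (r1 r2 s : R) : R := K (r1 *: e0) (r2 *: planar hn s).

Lemma kappaE r1 r2 x y : unit_interval R r1 -> unit_interval R r2 -> S x -> S y ->
  K (r1 *: x) (r2 *: y) = kappa r1 r2 (dotv x y).
Proof.
move=> hr1 hr2 Sx Sy; have Sp := sphere_planar hn (sphere_dotv_itv Sx Sy).
move: (Sx) (Sy) (Sp) => /sphere_dotv xx /sphere_dotv yy /sphere_dotv pp.
have [|||Q oQ [Qx Qy]] := @orthogonal_2transitive R n x y e0 (planar hn (dotv x y)).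
- by rewrite xx e00.
- by rewrite yy pp.
- by rewrite dotv_planarl.
rewrite (oK (orthogonal_tr oQ)); [|exact: polar_ball|exact: polar_ball].
by rewrite trmxK -!scalemxAr Qx Qy.
Qed.

Lemma kappa_sym r1 r2 s : unit_interval R r1 -> unit_interval R r2 -> s \in `[-1, 1] ->
  kappa r1 r2 s = kappa r2 r1 s.
Proof.
move=> hr1 hr2 sI; have Sp := sphere_planar hn sI; have S0 := sphere_basis R (i0 hn).
rewrite {1}/kappa hK.1; [|exact: polar_ball|exact: polar_ball].
by rewrite kappaE// dotvC dotv_planarl.
Qed.

Lemma continuous_planar : continuous (@planar R n hn).
Proof.
move=> s; apply: cvgD; apply: cvgZr_tmp; [exact: cvg_id|exact: continuous_halfcircle].
Qed.

Lemma continuous_kappa :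
  {within (unit_interval R `*` unit_interval R) `*` `[-1, 1], continuous
    (fun u : (R * R) * R => kappa u.1.1 u.1.2 u.2)}.
Proof.
pose psi (u : (R * R) * R) := (u.1.1 *: e0, u.1.2 *: planar hn u.2).
apply: (@within_continuous_into _ _ _ _ _ psi (fun z => K z.1 z.2) _ _ cK).
  move=> u.
  have h1 : (x.1.1 *: e0) @[x --> u] --> u.1.1 *: e0.
    by apply: cvgZr_tmp; apply: (@continuous_comp _ _ _ fst fst); exact: cvg_fst.
  have h2 : (x.1.2 *: planar hn x.2) @[x --> u] --> u.1.2 *: planar hn u.2.
    apply: cvgZ.
      by apply: (@continuous_comp _ _ _ fst snd); [exact: cvg_fst|exact: cvg_snd].
    apply: (@continuous_comp _ _ _ snd (@planar R n hn)); [exact: cvg_snd|exact: continuous_planar].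
  exact: (cvg_pair h1 h2).
move=> [[r1 r2] s] [[/= h1 h2] h3]; split=> /=; apply: polar_ball => //.
  exact: sphere_basis.
exact: sphere_planar.
Qed.

Lemma continuous_kappa_slice r1 r2 : unit_interval R r1 -> unit_interval R r2 ->
  {within `[-1, 1], continuous (kappa r1 r2)}.
Proof.
move=> h1 h2.
apply: (@within_continuous_into _ _ _ _ _ (fun s : R => ((r1, r2), s)) _ _ _ continuous_kappa) => //.
move=> s; have p1 : ((fun=> (r1, r2)) : R -> R * R) x @[x --> s] --> (r1, r2) by exact: cvg_cst.
have p2 : x @[x --> s] --> s by exact: cvg_id.
exact: (cvg_pair p1 p2).
Qed.

Definition coef (l : nat) (r1 r2 : R) : R :=
  wint n (fun s => kappa r1 r2 s * (G l).[s]) / gnorm l.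

Lemma coef_sym l r1 r2 : unit_interval R r1 -> unit_interval R r2 ->
  coef l r1 r2 = coef l r2 r1.
Proof.
move=> h1 h2; rewrite /coef; congr (_ / _); apply: eq_wint => s sI.
by rewrite kappa_sym.
Qed.

Lemma wint_approx (f g : R -> R) l (e : R) :
  {within `[-1, 1], continuous f} -> {within `[-1, 1], continuous g} ->
  (forall s, s \in `[-1, 1] -> `|f s - g s| <= e) ->
  `|wint n (fun s => f s * (G l).[s]) - wint n (fun s => g s * (G l).[s])| <= e * wint n (fun=> 1).
Proof.
move=> cf cg fg.
have c1 (h : R -> R) : {within `[-1, 1], continuous h} -> {within `[-1, 1], continuous (fun s => h s * (G l).[s])}.
  by move=> ch x; apply: cvgM; [exact: ch|exact: cI_horner].
have cc (c : R) : {within `[-1, 1], continuous ((fun=> c) : R -> R)}.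
  by apply: continuous_cI => x; exact: cvg_cst.
have one : (1 : R) \in `[-1, 1] by rewrite in_itv/= lexx andbT; lra.
have epos : 0 <= e := le_trans (normr_ge0 _) (fg 1 one).
have bd (f' g' : R -> R) : {within `[-1, 1], continuous f'} -> {within `[-1, 1], continuous g'} ->
    (forall s, s \in `[-1, 1] -> `|f' s - g' s| <= e) ->
    wint n (fun s => f' s * (G l).[s]) <= e * wint n (fun=> 1) + wint n (fun s => g' s * (G l).[s]).
  move=> cf' cg' fg'; rewrite -wintZ// -wintD//; last exact: c1.
  apply: wint_le => //; first exact: c1.
    by move=> x; apply: cvgD; [exact: cc|exact: c1].
  move=> s sI; rewrite mulr1 -lerBlDr -mulrBl; apply: le_trans (ler_norm _) _.
  rewrite normrM; apply: le_trans (ler_piMr _ _) (fg' s sI) => //.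
  exact: gegenbauer_le1.
rewrite ler_norml; apply/andP; split.
  have h := bd g f cg cf (fun s sI => eq_ind_r (fun a => a <= e) (fg s sI) (distrC _ _)).
  by move: h; set a := wint n _; set b := wint n _; set c := wint n _; lra.
by rewrite lerBlDr; exact: bd.
Qed.

Lemma conv_poly_gegenbauer_sum L (al : nat -> R) (q : {poly R}) :
  conv_poly hn (\sum_(l < L) al l *: G l) q =
  \sum_(l < L) (al l * (c0 * wintp (q * G l))) *: G l.
Proof.
have S0 := sphere_basis R (i0 hn).
apply: poly_eq_itv => t tI; have Sp := sphere_planar hn tI.
rewrite -[in LHS](dotv_planarl hn t) -(conv_polyE _ _ _ S0 Sp) horner_sum.
have a l : adm (fun z : 'cV[R]_n => (G l).[dotv e0 z] * q.[dotv (planar hn t) z]) by exact: adm_conv.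
transitivity (sint (fun z : 'cV[R]_n => \sum_(l < L) al l * ((G l).[dotv e0 z] * q.[dotv (planar hn t) z]))).
  apply: eq_sint => z _; rewrite horner_sum mulr_suml; apply: eq_bigr => l _.
  by rewrite hornerZ mulrA.
rewrite sint_sum//; last by move=> l _; exact: admZ.
apply: eq_bigr => l _; rewrite sintZ// sint_gegenbauer// dotv_planarl hornerZ; ring.
Qed.

Lemma wintp_mul_gegenbauer_sum L (al be : nat -> R) :
  wintp ((\sum_(l < L) al l *: G l) * (\sum_(l < L) be l *: G l)) =
  \sum_(l < L) al l * be l * gnorm l.
Proof.
rewrite mulr_suml wintp_sum//; apply: eq_bigr => l _.
rewrite -scalerAl wintpZ// mulr_sumr wintp_sum// (bigD1 l)//= big1 ?addr0.
  by rewrite -scalerAr wintpZ// mulrA.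
by move=> k kl; rewrite -scalerAr wintpZ// gegenbauer_orthogonal ?mulr0// eq_sym.
Qed.

Section quadratic_form.
Variables (M : nat) (rad : 'I_M -> R) (b : 'I_M -> R) (L : nat) (be : 'I_M -> nat -> R).
Hypothesis hrad : forall i, unit_interval R (rad i).

Let form (k : 'I_M -> 'I_M -> R) (c : nat -> 'I_M -> 'I_M -> R) : R :=
  \sum_i \sum_j (b i * b j * k i j
    + b i * (\sum_(l < L) be j l * c l i j) + b j * (\sum_(l < L) be i l * c l i j)
    + \sum_(l < L) be i l * be j l * c l i j).

(** Dividing by [c0 * gnorm l] cancels the Funk-Hecke constants, so the energy becomes exactly a
    form in the coefficients with weights [be]. *)
Let alpha i l := be i l / (c0 * gnorm l).
Let h i : {poly R} := \sum_(l < L) alpha i l *: G l.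
Let mass := \sum_i (`|b i| + A * \sum_(l < L) `|alpha i l|).

Let hmass (xs : seq 'cV[R]_n) : xs != [::] -> (forall x, x \in xs -> S x) ->
  \sum_i (`|b i| + A / (size xs)%:R * \sum_(x <- xs) `|(h i).[dotv e0 x]|) <= mass.
Proof.
move=> xs0 Sxs; apply: ler_sum => i _; rewrite lerD2l.
have A0 : 0 < A by apply: sphere_area_gt0; exact: leq_trans hn.
have sz : 0 < (size xs)%:R :> R by rewrite ltr0n lt0n size_eq0.
rewrite -mulrA ler_pM2l// mulrC ler_pdivrMr//.
have -> : (\sum_(l < L) `|alpha i l|) * (size xs)%:R = \sum_(x <- xs) \sum_(l < L) `|alpha i l|.
  by rewrite big_const_seq count_predT iter_addr_0 mulr_natr.
rewrite big_seq [leRHS]big_seq; apply: ler_sum => x /Sxs Sx.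
rewrite /h horner_sum; apply: le_trans (ler_norm_sum _ _ _) _.
apply: ler_sum => l _; rewrite hornerZ normrM ler_piMr// gegenbauer_le1//.
by apply: sphere_dotv_itv => //; exact: sphere_basis.
Qed.

Let form_approx (q : 'I_M -> 'I_M -> {poly R}) (e : R) : 0 <= e ->
  (forall i j s, s \in `[-1, 1] -> `|kappa (rad i) (rad j) s - (q i j).[s]| <= e) ->
  - (e * mass ^+ 2) <= form (fun i j => (q i j).[1]) (fun l i j => wintp (q i j * G l) / gnorm l).
Proof.
move=> e0' hq.
have hq' i j x y : S x -> S y -> `|K (rad i *: x) (rad j *: y) - (q i j).[dotv x y]| <= e.
  by move=> Sx Sy; rewrite kappaE// hq// sphere_dotv_itv.
apply: le_trans (energy_ge0 (hn := hn) hK hrad e0' hq' hmass) _.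
rewrite le_eqVlt; apply/orP; left; apply/eqP.
apply: eq_bigr => i _; apply: eq_bigr => j _.
have lin k : c0 * wintp (h k * q i j) = \sum_(l < L) be k l * (wintp (q i j * G l) / gnorm l).
  rewrite /h mulr_suml wintp_sum// mulr_sumr; apply: eq_bigr => l _.
  rewrite -scalerAl wintpZ// [G l * _]mulrC /alpha; field.
  by rewrite !gt_eqF ?c0_gt0 ?gnorm_gt0.
rewrite !lin /h conv_poly_gegenbauer_sum (wintp_mul_gegenbauer_sum _
  (fun l => alpha i l * (c0 * wintp (q i j * G l))) (alpha j)).
congr (_ + _); rewrite mulr_sumr; apply: eq_bigr => l _; rewrite /alpha; field.
by rewrite !gt_eqF ?c0_gt0 ?gnorm_gt0.
Qed.

(* The value of [K] on the signed measures [b i delta_e0 + h i sigma] placed at the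
   radii [rad i]; [b = 0] will give positivity of the coefficients and [b = 1], with
   [be = -1], Bessel's inequality. *)
Lemma coef_form_ge0 : 0 <= form (fun i j => kappa (rad i) (rad j) 1) (fun l i j => coef l (rad i) (rad j)).
Proof.
(* Only the approximating polynomials depend on [N]; [mass] does not, so the error term vanishes in
   the limit. *)
have ex N : exists q : 'I_M -> 'I_M -> {poly R}, forall i j s, s \in `[-1, 1] ->
    `|kappa (rad i) (rad j) s - (q i j).[s]| <= N.+1%:R^-1.
  have N0 : 0 < N.+1%:R^-1 :> R by rewrite invr_gt0.
  have ex2 (ij : 'I_M * 'I_M) : exists p : {poly R}, forall s, s \in `[-1, 1] ->
      `|kappa (rad ij.1) (rad ij.2) s - p.[s]| <= N.+1%:R^-1.
    by apply: weierstrass => //; exact: continuous_kappa_slice.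
  have [q hq] := choice ex2; exists (fun i j => q (i, j)) => i j s sI.
  exact: (hq (i, j)).
have [q hq] := choice ex.
have one : (1 : R) \in `[-1, 1] by rewrite in_itv/= lexx andbT; lra.
have invN0 : (N.+1%:R^-1 : R) @[N --> \oo] --> 0.
  apply/cvgrPdist_le => e e0'; near=> N; rewrite sub0r normrN ger0_norm ?invr_ge0//.
  by apply: ltW; near: N; exact: (near_infty_natSinv_lt (PosNum e0')).
have cv1 i j : (q N i j).[1] @[N --> \oo] --> kappa (rad i) (rad j) 1.
  apply/cvgrPdist_le => e e0'; near=> N; apply: le_trans (hq N i j 1 one) _.
  by apply: ltW; near: N; exact: (near_infty_natSinv_lt (PosNum e0')).
have cv2 l i j : wintp (q N i j * G l) / gnorm l @[N --> \oo] --> coef l (rad i) (rad j).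
  apply: cvgM; last exact: cvg_cst.
  apply/cvgrPdist_le => e e0'.
  have W0 := wint1_gt0 R hn.
  have eW : 0 < e / wint n (fun=> 1 : R) by rewrite divr_gt0.
  near=> N; have -> : wintp (q N i j * G l) = wint n (fun s => (q N i j).[s] * (G l).[s]).
    by apply: eq_wint => s _; rewrite hornerM.
  apply: le_trans (wint_approx l _ _ (hq N i j)) _.
  - exact: continuous_kappa_slice.
  - exact: cI_horner.
  rewrite -ler_pdivlMr//.
  by apply: ltW; near: N; exact: (near_infty_natSinv_lt (PosNum eW)).
have cvF : form (fun i j => (q N i j).[1]) (fun l i j => wintp (q N i j * G l) / gnorm l)
    + N.+1%:R^-1 * mass ^+ 2 @[N --> \oo] -->
    form (fun i j => kappa (rad i) (rad j) 1) (fun l i j => coef l (rad i) (rad j)) + 0 * mass ^+ 2.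
  apply: cvgD; last by apply: cvgM => //; exact: cvg_cst.
  apply: cvg_bigsum => i; apply: cvg_bigsum => j.
  apply: cvgD; [apply: cvgD; [apply: cvgD|]|].
  - by apply: cvgM; [exact: cvg_cst|exact: cv1].
  - by apply: cvgM; [exact: cvg_cst|apply: cvg_bigsum => l; apply: cvgM; [exact: cvg_cst|exact: cv2]].
  - by apply: cvgM; [exact: cvg_cst|apply: cvg_bigsum => l; apply: cvgM; [exact: cvg_cst|exact: cv2]].
  - by apply: cvg_bigsum => l; apply: cvgM; [exact: cvg_cst|exact: cv2].
rewrite mul0r addr0 in cvF; apply: (cvgr_to_ge cvF).
apply: nearW => N; have N0 : 0 <= N.+1%:R^-1 :> R by rewrite invr_ge0.
by have := form_approx N0 (hq N); rewrite -subr_ge0 opprK.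
Unshelve. all: by end_near. Qed.

End quadratic_form.
End radial_coefficients.

(** * The Gegenbauer series of the profile *)

Section expansion.
Context (R : realType) (n : nat).
Hypothesis hn : (2 <= n)%N.
Notation S := (unit_sphere R n).
Notation I := (unit_interval R).
Notation G := (gegenbauer (geg_index R n)).
Notation gnorm := (gnorm R n).
Notation wintp p := (wint n (fun s => (p : {poly R}).[s])).

Lemma wint_gegenbauer_sum (a : nat -> R) N l : (l < N)%N ->
  wintp ((\sum_(k < N) a k *: G k) * G l) = a l * gnorm l.
Proof.
move=> lN; rewrite mulr_suml wintp_sum// (bigD1 (Ordinal lN))//= big1 ?addr0.
  by rewrite -scalerAl wintpZ.
by move=> k kl; rewrite -scalerAl wintpZ// gegenbauer_orthogonal ?mulr0.
Qed.

Variable K : 'cV[R]_n -> 'cV[R]_n -> R.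
Hypothesis hK : is_kernel (unit_ball R n) K.
Hypothesis cK : kernel_continuous (unit_ball R n) K.
Hypothesis oK : O_invariant K.
Notation kappa := (kappa hn K).
Notation coef := (coef hn K).

Lemma coef_kernel l : is_kernel I (coef l).
Proof.
split=> [r1 r2 h1 h2|m x a hx]; first exact: coef_sym.
have := coef_form_ge0 hn hK cK oK (fun=> 0) l.+1 (fun i k => if k == l then a i else 0) hx.
rewrite /=; congr (0 <= _); apply: eq_bigr => i _; apply: eq_bigr => j _.
rewrite !mul0r !add0r big_ord_recr /= eqxx big1 ?add0r// => k _.
by rewrite (ltn_eqF (ltn_ord k)) !mul0r.
Qed.

Lemma coef_bessel L r : I r -> \sum_(l < L) coef l r r <= kappa r r 1.
Proof.
move=> hr.
have := coef_form_ge0 hn hK cK oK (M := 1) (rad := fun=> r) (fun=> 1) L (fun _ _ => -1) (fun=> hr).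
rewrite /= !big_ord1 !mul1r.
have -> : \sum_(l < L) -1 * coef l r r = - \sum_(l < L) coef l r r.
  by rewrite -mulr_sumr mulN1r.
have -> : \sum_(l < L) -1 * -1 * coef l r r = \sum_(l < L) coef l r r.
  by apply: eq_bigr => l _; rewrite mulrNN !mul1r.
by set s := \sum_(l < L) _; lra.
Qed.

Lemma kernel2 (c : R -> R -> R) r1 r2 e : is_kernel I c -> I r1 -> I r2 -> e ^+ 2 = 1 ->
  0 <= c r1 r1 + c r2 r2 + 2 * e * c r1 r2.
Proof.
move=> [sc pc] h1 h2 e2.
have /= := pc 2%N (fun i => if val i == 0%N then r1 else r2) (fun i => if val i == 0%N then 1 else e).
rewrite !big_ord_recr !big_ord0 /= !add0r (sc r2 r1)// => h.
have {h} := h (fun i => ltac:(by case: ifP)).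
by rewrite !mul1r !mulr1 -expr2 e2 mul1r; lra.
Qed.

Lemma kernel_diag_ge0 (c : R -> R -> R) r : is_kernel I c -> I r -> 0 <= c r r.
Proof.
move=> [_ pc] hr; have := pc 1%N (fun=> r) (fun=> 1) (fun=> hr).
by rewrite !big_ord1 !mul1r.
Qed.

(** The arithmetic mean bound is linear in the diagonal values, so majorants and their remainders
    split into two diagonal series. *)
Lemma kernel_le (c : R -> R -> R) r1 r2 : is_kernel I c -> I r1 -> I r2 ->
  `|c r1 r2| <= 2^-1 * (c r1 r1 + c r2 r2).
Proof.
move=> hc h1 h2; have := kernel2 hc h1 h2 (expr1n _ 2).
have := @kernel2 c r1 r2 (-1) hc h1 h2 _; rewrite sqrrN expr1n => /(_ erefl) ha hb.
by rewrite ler_norml; apply/andP; split; lra.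
Qed.

(** Tube argument: joint continuity at each angle and compactness of [-1, 1] give one neighbourhood
    of the radii that works for all angles. *)
Lemma unif_kappa_near p0 e : (I `*` I) p0 -> 0 < e ->
  \forall p \near within (I `*` I) (nbhs p0),
    forall s, s \in `[-1, 1] -> `|kappa p0.1 p0.2 s - kappa p.1 p.2 s| <= e.
Proof.
move=> hp0 epos; have := @segment_compact R (-1) 1.
rewrite compact_near_coveringP -near_covering_withinP => h.
apply: (h _ (within (I `*` I) (nbhs p0)) (fun p s => `|kappa p0.1 p0.2 s - kappa p.1 p.2 s| <= e)) => s0 s0I.
have e2 : 0 < e / 2 by rewrite divr_gt0.
have /subspace_continuousP/(_ (p0, s0))/= := @continuous_kappa R n hn K cK.
move=> /(_ (conj hp0 s0I))/cvgrPdist_lt/(_ _ e2).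
rewrite near_withinE => -[[P Q] /= [hP hQ] PQ].
exists (Q, P `&` (I `*` I)) => /=.
  by split=> //; rewrite /within/=; apply: filterS hP => p Pp Ip; split.
move=> [s p] /= [Qs [Pp Ip]] sI.
have h1 : `|kappa p0.1 p0.2 s0 - kappa p.1 p.2 s| < e / 2 by apply: (PQ (p, s)).
have h2 : `|kappa p0.1 p0.2 s0 - kappa p0.1 p0.2 s| < e / 2.
  by apply: (PQ (p0, s)) => //; split=> //=; exact: nbhs_singleton.
rewrite (le_trans (ler_distD (kappa p0.1 p0.2 s0) _ _))// [e]splitr lerD// ltW//.
by rewrite distrC.
Qed.

Lemma coef_continuous l : kernel_continuous I (coef l).
Proof.
apply/subspace_continuousP => p0 hp0; apply/cvgrPdist_le => e epos.
have W0 := wint1_gt0 R hn; have g0 := gnorm_gt0 R hn l.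
have dpos : 0 < e * gnorm l / wint n (fun=> 1 : R) by rewrite divr_gt0 ?mulr_gt0.
have := unif_kappa_near hp0 dpos; rewrite !near_withinE; apply: filterS => p hp Ip.
rewrite /= /coef -mulrBl normrM [`|(gnorm l)^-1|]ger0_norm ?invr_ge0 ?(ltW g0)// ler_pdivrMr//.
have c1 := @continuous_kappa_slice R n hn K cK _ _ hp0.1 hp0.2.
have c2 := @continuous_kappa_slice R n hn K cK _ _ Ip.1 Ip.2.
apply: le_trans (wint_approx hn l c1 c2 (hp Ip)) _.
by rewrite divfK// gt_eqF.
Qed.

Lemma gegenbauer0 : G 0 = 1.
Proof.
have := size_gegenbauer R hn 0 => /eqP/size_poly1P[c c0 h].
by have := gegenbauer1 R hn 0; rewrite h hornerC => ->.
Qed.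

(** At radius 0 the profile is constant, and constants are orthogonal to [G l] when [l] is
    positive. *)
Lemma coef00 l : (0 < l)%N -> coef l 0 0 = 0.
Proof.
move=> l0; rewrite /coef (_ : wint n _ = 0) ?mul0r//.
rewrite (@eq_wint _ _ _ (fun s => K 0 0 * (G l * 1).[s])); last first.
  by move=> s _; rewrite /kappa !scale0r mulr1.
rewrite wintZ//; last exact: cI_horner.
have [_ ->] := gegenbauer_orth R hn l; rewrite ?mulr0//.
by rewrite size_poly1.
Qed.

Lemma coef_term_le l r1 r2 s : I r1 -> I r2 -> s \in `[-1, 1] ->
  `|coef l r1 r2 * (G l).[s]| <= 2^-1 * (coef l r1 r1 + coef l r2 r2).
Proof.
move=> h1 h2 sI; rewrite normrM; apply: le_trans (kernel_le (coef_kernel l) h1 h2).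
by rewrite ler_piMr// gegenbauer_le1.
Qed.

Lemma series_coef_cvg r : I r -> cvgn (series (fun l => coef l r r)).
Proof.
move=> hr; apply: nondecreasing_is_cvgn.
  by apply: nondecreasing_series => k _ _; exact: kernel_diag_ge0 (coef_kernel k) hr.
exists (kappa r r 1) => _ [L _ <-]; rewrite /series/= big_mkord; exact: coef_bessel.
Qed.

Definition maj r1 r2 l : R := 2^-1 * (coef l r1 r1 + coef l r2 r2).

Lemma maj_ge0 r1 r2 l : I r1 -> I r2 -> 0 <= maj r1 r2 l.
Proof. by move=> h1 h2; apply: le_trans (kernel_le (coef_kernel l) h1 h2). Qed.

Lemma series_majE r1 r2 : series (maj r1 r2) =
  fun L => 2^-1 * (series (fun l => coef l r1 r1) L + series (fun l => coef l r2 r2) L).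
Proof. by apply: funext => L; rewrite /series/= -big_split/= mulr_sumr. Qed.

Lemma series_maj_cvg r1 r2 : I r1 -> I r2 -> cvgn (series (maj r1 r2)).
Proof.
move=> h1 h2; rewrite series_majE; apply: is_cvgM; first exact: is_cvg_cst.
by apply: is_cvgD; exact: series_coef_cvg.
Qed.

Lemma normed_term_cvg r1 r2 s : I r1 -> I r2 -> s \in `[-1, 1] ->
  cvgn [normed series (fun l => coef l r1 r2 * (G l).[s])].
Proof.
move=> h1 h2 sI; apply: (series_le_cvg _ _ _ (series_maj_cvg h1 h2)) => l /=.
- by [].
- exact: maj_ge0.
- exact: coef_term_le.
Qed.

Definition partial r1 r2 L s := \sum_(l < L) coef l r1 r2 * (G l).[s].
Definition gsum r1 r2 s := limn (series (fun l => coef l r1 r2 * (G l).[s])).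
(** The remainder of the majorant. It does not involve the angle, so it controls the series
    uniformly in [s]. *)
Definition tail r1 r2 L := limn (series (maj r1 r2)) - series (maj r1 r2) L.

Lemma tail_cvg r1 r2 : I r1 -> I r2 -> tail r1 r2 L @[L --> \oo] --> 0.
Proof.
move=> h1 h2; rewrite -(subrr (limn (series (maj r1 r2)))).
by apply: cvgB; [exact: cvg_cst|exact: series_maj_cvg].
Qed.

Lemma gsum_tail r1 r2 L s : I r1 -> I r2 -> s \in `[-1, 1] ->
  `|gsum r1 r2 s - partial r1 r2 L s| <= tail r1 r2 L.
Proof.
move=> h1 h2 sI; set u := fun l => coef l r1 r2 * (G l).[s].
have cu : cvgn (series u) by apply: normed_cvg; exact: normed_term_cvg.
have pE N : partial r1 r2 N s = series u N by rewrite /partial /series/= big_mkord.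
rewrite pE.
have cd : `|series u N - series u L| @[N --> \oo] --> `|gsum r1 r2 s - series u L|.
  by apply: cvg_norm; apply: cvgB; [exact: cu|exact: cvg_cst].
apply: (cvgr_to_le cd); exists L => // N /= LN.
rewrite sub_series_geq// (le_trans (ler_norm_sum _ _ _))//.
apply: (@le_trans _ _ (\sum_(L <= k < N) maj r1 r2 k)).
  by apply: ler_sum => k _; exact: coef_term_le.
rewrite -sub_series_geq// /tail lerD2r; apply: nondecreasing_cvgn_le.
  by apply: nondecreasing_series => k _ _; exact: maj_ge0.
exact: series_maj_cvg.
Qed.

Lemma continuous_partial r1 r2 L : {within `[-1, 1], continuous (partial r1 r2 L)}.
Proof.
have -> : partial r1 r2 L = horner (\sum_(l < L) coef l r1 r2 *: G l).
  by apply: funext => s; rewrite horner_sum; apply: eq_bigr => l _; rewrite hornerZ.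
exact: cI_horner.
Qed.

Lemma continuous_gsum r1 r2 : I r1 -> I r2 -> {within `[-1, 1], continuous (gsum r1 r2)}.
Proof.
move=> h1 h2; apply/subspace_continuousP => s0 s0I; apply/cvgrPdist_le => e epos.
have e3 : 0 < e / 3 by rewrite divr_gt0.
have /cvgrPdist_le/(_ _ e3)[L _ /(_ L (leqnn L)) hL] := tail_cvg h1 h2.
have {}hL : tail r1 r2 L <= e / 3 by move: hL; rewrite sub0r normrN; apply: le_trans; exact: ler_norm.
have /subspace_continuousP/(_ s0 s0I)/cvgrPdist_le/(_ _ e3) := @continuous_partial r1 r2 L.
rewrite !near_withinE; apply: filterS => s hs sI; have {}hs := hs sI.
have k1 := le_trans (gsum_tail L h1 h2 s0I) hL.
have k2 := le_trans (gsum_tail L h1 h2 sI) hL.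
rewrite (le_trans (ler_distD (partial r1 r2 L s0) _ _))//.
have := ler_distD (partial r1 r2 L s) (partial r1 r2 L s0) (gsum r1 r2 s).
rewrite (distrC (partial r1 r2 L s) (gsum _ _ _)) => k3.
move: k1 k2 k3 hs; lra.
Qed.

Lemma wint_partial r1 r2 L m : (m < L)%N ->
  wint n (fun s => partial r1 r2 L s * (G m).[s]) = coef m r1 r2 * gnorm m.
Proof.
move=> mL; rewrite -(@wint_gegenbauer_sum (fun l => coef l r1 r2) L)//.
apply: eq_wint => s _; rewrite hornerM horner_sum; congr (_ * _).
by apply: eq_bigr => l _; rewrite hornerZ.
Qed.

Lemma gsum_kappa r1 r2 s : I r1 -> I r2 -> s \in `[-1, 1] -> gsum r1 r2 s = kappa r1 r2 s.
Proof.
move=> h1 h2 sI; apply/eqP; rewrite -subr_eq0; apply/eqP.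
pose D s := gsum r1 r2 s - kappa r1 r2 s.
have ck := @continuous_kappa_slice R n hn K cK _ _ h1 h2.
have cD : {within `[-1, 1], continuous D}.
  by move=> x; apply: cvgB; [exact: continuous_gsum|exact: ck].
have cG (f : R -> R) l : {within `[-1, 1], continuous f} -> {within `[-1, 1], continuous (fun s => f s * (G l).[s])}.
  by move=> cf x; apply: cvgM; [exact: cf|exact: cI_horner].
have DG m : wint n (fun s => D s * (G m).[s]) = 0.
  have -> : wint n (fun s => D s * (G m).[s]) = wint n (fun s => gsum r1 r2 s * (G m).[s]) - coef m r1 r2 * gnorm m.
    rewrite /coef divfK ?gt_eqF ?gnorm_gt0// -[X in _ - X]mul1r -mulNr -wintZ//; last exact: cG.
    rewrite -wintD//.
    - by apply: eq_wint => t _; rewrite /D; ring.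
    - by apply: cG; exact: continuous_gsum.
    - by move=> x; apply: cvgM; [exact: cvg_cst|exact: cG].
  apply/eqP; rewrite -normr_le0; apply/ler_addgt0Pr => e epos; rewrite add0r.
  have W0 := wint1_gt0 R hn.
  have eW : 0 < e / wint n (fun=> 1 : R) by rewrite divr_gt0.
  have /cvgrPdist_le/(_ _ eW)[L _ hL] := tail_cvg h1 h2.
  (* The truncation must also exceed [m] for the partial sum to carry the coefficient of degree
     [m]. *)
  have {}hL := hL (maxn L m.+1) (leq_maxl _ _).
  rewrite -(@wint_partial r1 r2 (maxn L m.+1)); last by rewrite leq_max ltnSn orbT.
  rewrite -[leRHS](divfK (lt0r_neq0 W0)); apply: (wint_approx hn).
  - exact: continuous_gsum.
  - exact: continuous_partial.
  - move=> t tI; apply: le_trans (gsum_tail _ h1 h2 tI) _.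
    by move: hL; rewrite sub0r normrN; apply: le_trans; exact: ler_norm.
have Dp (p : {poly R}) : wint n (fun s => D s * p.[s]) = 0.
  have [a ->] := poly_span (fun j _ => size_gegenbauer R hn j) (leqnn (size p)).
  elim: (size p) => [|k IH].
    rewrite big_ord0 (@eq_wint _ _ _ (fun s => 0 * D s)); last by move=> t _; rewrite horner0 mulr0 mul0r.
    by rewrite wintZ// mul0r.
  rewrite big_ord_recr /= (@eq_wint _ _ _ (fun s => D s * (\sum_(j < k) a j *: G j).[s] + a k * (D s * (G k).[s]))); last first.
    by move=> t _; rewrite hornerD hornerZ; ring.
  have c1 : {within `[-1, 1], continuous (fun s => D s * (\sum_(j < k) a j *: G j).[s])}.
    by move=> x; apply: cvgM; [exact: cD|exact: cI_horner].
  have c2 : {within `[-1, 1], continuous (fun s => a k * (D s * (G k).[s]))}.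
    by move=> x; apply: cvgM; [exact: cvg_cst|exact: cG].
  by rewrite wintD// IH add0r wintZ ?DG ?mulr0//; exact: cG.
have cD2 : {within `[-1, 1], continuous (fun s => D s ^+ 2)}.
  by apply: (@within_continuous_comp _ _ _ _ D (fun x : R => x ^+ 2)) => // x _; exact: exprn_continuous.
apply: (@wint_sqr_eq0 R n hn D cD _ s sI).
have [M M0 hM] := cI_bounded cD.
apply/eqP; rewrite eq_le; apply/andP; split; last first.
  by apply: Rintegral_ge0 => t _; rewrite mulr_ge0 ?weight_ge0 ?sqr_ge0.
apply/ler_addgt0Pr => e epos; rewrite add0r.
have W0 := wint1_gt0 R hn; have M1 : 0 < M + 1 by rewrite ltr_wpDl.
(* As [D] is orthogonal to [p], its square integrates like [(D - p) * D], at most this constant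
   times [M + 1] times the total weight; [M + 1] avoids a zero denominator. *)
have dpos : 0 < e / ((M + 1) * wint n (fun=> 1 : R)) by rewrite divr_gt0// mulr_gt0.
have [p hp] := weierstrass cD dpos.
have cp : {within `[-1, 1], continuous (fun s => D s * p.[s])}.
  by move=> x; apply: cvgM; [exact: cD|exact: cI_horner].
have c1 : {within `[-1, 1], continuous (fun s => D s ^+ 2 + -1 * (D s * p.[s]))}.
  by move=> x; apply: cvgD; [exact: cD2|apply: cvgM; [exact: cvg_cst|exact: cp]].
have -> : wint n (fun s => D s ^+ 2) = wint n (fun s => D s ^+ 2 + -1 * (D s * p.[s])).
  rewrite wintD// ?wintZ// ?Dp ?mulr0 ?addr0//.
  by move=> x; apply: cvgM; [exact: cvg_cst|exact: cp].
apply: (@le_trans _ _ (wint n (fun=> e / ((M + 1) * wint n (fun=> 1 : R)) * (M + 1) * 1))).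
  apply: wint_le => //.
    by apply: continuous_cI => x; exact: cvg_cst.
  move=> t tI; have -> : D t ^+ 2 + -1 * (D t * p.[t]) = (D t - p.[t]) * D t by ring.
  rewrite mulr1; apply: le_trans (ler_norm _) _; rewrite normrM; apply: ler_pM => //.
    exact: hp.
  by apply: le_trans (hM t tI) _; rewrite lerDl.
rewrite wintZ//; last by apply: continuous_cI => x; exact: cvg_cst.
by rewrite le_eqVlt; apply/orP; left; apply/eqP; field; rewrite !gt_eqF.
Qed.

End expansion.

Section uniform_convergence.
Context (R : realType) (T : choiceType).
Implicit Types (D : set T) (F : nat -> T -> R) (f : T -> R).

Lemma uniform_cvgP D F f : {uniform D, F @ \oo --> f} <->
  forall e, 0 < e -> \forall N \near \oo, forall x, D x -> `|f x - F N x| <= e.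
Proof.
split=> [h e e0|h].
  have : nbhs (f : {uniform` D -> R}) [set g | forall x, D x -> `|f x - g x| <= e].
    apply/uniform_nbhs; exists [set xy | ball xy.1 e xy.2].
    split; first exact: (entourage_ball _ (PosNum e0)).
    by move=> g hg x Dx; apply: ltW; exact: (hg x Dx).
  by move=> /h.
move=> P /uniform_nbhs[E [entE EP]].
move: entE; rewrite -entourage_from_ballE => -[e /= e0 eE].
have e2 : 0 < e / 2 by rewrite divr_gt0.
have := h _ e2; apply: filterS => N hN; apply: EP => x Dx; apply: eE => /=.
rewrite /ball/= (le_lt_trans (hN x Dx))//; lra.
Qed.

End uniform_convergence.

(** * Uniform convergence of the expansion *)

Section expansion_converges.
Context (R : realType) (n : nat).
Hypothesis hn : (2 <= n)%N.
Notation I := (unit_interval R).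
Notation G := (gegenbauer (geg_index R n)).
Variable K : 'cV[R]_n -> 'cV[R]_n -> R.
Hypothesis hK : is_kernel (unit_ball R n) K.
Hypothesis cK : kernel_continuous (unit_ball R n) K.
Hypothesis oK : O_invariant K.
Notation kappa := (kappa hn K).
Notation coef := (coef hn K).

Let one_in : (1 : R) \in `[-1, 1].
Proof. by rewrite in_itv/= lexx andbT; lra. Qed.

Lemma series_coef_diag r : I r -> series (fun l => coef l r r) @ \oo --> kappa r r 1.
Proof.
move=> hr; rewrite -(@gsum_kappa R n hn K hK cK oK r r 1 hr hr one_in) /gsum.
rewrite (_ : (fun l => coef l r r * (G l).[1]) = (fun l => coef l r r)).
  exact: (@series_coef_cvg R n hn K hK cK oK r hr).
by apply: funext => l; rewrite (gegenbauer1 R hn) mulr1.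
Qed.

Definition diag_rem r L := kappa r r 1 - series (fun l => coef l r r) L.

Lemma continuous_diag (f : R -> R -> R) :
  kernel_continuous I f -> {within I, continuous (fun r => f r r)}.
Proof.
move=> cf; apply: (@within_continuous_into _ _ _ I (I `*` I) (fun r : R => (r, r)) (fun p => f p.1 p.2)) => //.
move=> r; have h : x @[x --> r] --> r by exact: cvg_id.
exact: (cvg_pair h h).
Qed.

Lemma continuous_kappa1 : {within I, continuous (fun r => kappa r r 1)}.
Proof.
apply: (@within_continuous_into _ _ _ _ _ (fun r : R => ((r, r), (1 : R))) _ _ _
  (@continuous_kappa R n hn K cK)) => //.
move=> r; have h : x @[x --> r] --> r by exact: cvg_id.
have h1 : ((fun=> 1) : R -> R) x @[x --> r] --> (1 : R) by exact: cvg_cst.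
exact: (cvg_pair (cvg_pair h h) h1).
Qed.

Lemma continuous_rem L : {within I, continuous (fun r => diag_rem r L)}.
Proof.
have cs : {within I, continuous (fun r => \sum_(l < L) coef l r r)}.
  elim: L => [|L IH].
    have -> : (fun r => \sum_(l < 0) coef l r r) = cst 0.
      by apply: funext => x; rewrite big_ord0.
    by move=> r; exact: cvg_cst.
  have -> : (fun r => \sum_(l < L.+1) coef l r r) =
      (fun r => \sum_(l < L) coef l r r + coef L r r).
    by apply: funext => x; rewrite big_ord_recr.
  by move=> r; apply: cvgD; [exact: IH|exact: (continuous_diag (@coef_continuous R n hn K cK L))].
have -> : (fun r => diag_rem r L) = (fun r => kappa r r 1 - \sum_(l < L) coef l r r).
  by apply: funext => r; rewrite /diag_rem /series/= big_mkord.
by move=> r; apply: cvgB; [exact: continuous_kappa1|exact: cs].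
Qed.

Lemma rem_cvg r : I r -> diag_rem r L @[L --> \oo] --> 0.
Proof.
move=> hr; rewrite -(subrr (kappa r r 1)).
by apply: cvgB; [exact: cvg_cst|exact: series_coef_diag].
Qed.

Lemma rem_decr r L M : I r -> (L <= M)%N -> diag_rem r M <= diag_rem r L.
Proof.
move=> hr LM; rewrite /diag_rem lerB//.
move: L M LM; apply: nondecreasing_series => k _ _.
exact: kernel_diag_ge0 (@coef_kernel R n hn K hK cK oK k) hr.
Qed.

(* Dini: the remainders are continuous, decrease with [L] and tend to 0 pointwise. *)
Lemma rem_uniform e : 0 < e -> \forall L \near \oo, forall r, I r -> diag_rem r L <= e.
Proof.
move=> e0; have := @segment_compact R 0 1.
rewrite compact_near_coveringP -near_covering_withinP => h.
apply: (h _ \oo (fun L r => diag_rem r L <= e)) => r0 hr0.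
have e2 : 0 < e / 2 by rewrite divr_gt0.
have /cvgrPdist_le/(_ _ e2)[L _ /(_ L (leqnn L)) hL] := rem_cvg hr0.
have /subspace_continuousP/(_ r0 hr0)/cvgrPdist_le/(_ _ e2) := continuous_rem (L := L).
rewrite near_withinE => hP.
exists ([set r | I r -> `|diag_rem r0 L - diag_rem r L| <= e / 2], [set M | (L <= M)%N]) => /=.
  by split=> //; exists L.
move=> [r M] /= [hr LM] Ir; have {}hr := hr Ir.
apply: le_trans (rem_decr Ir LM) _.
move: hL hr; rewrite sub0r normrN !ler_norml => /andP[_ h1] /andP[h2 _].
lra.
Qed.

(** The majorant is a mean of two diagonal series, so uniformity in one radius from [rem_uniform]
    becomes uniformity in all pairs. *)
Lemma tailE r1 r2 L : I r1 -> I r2 ->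
  tail hn K r1 r2 L = 2^-1 * (diag_rem r1 L + diag_rem r2 L).
Proof.
move=> h1 h2; rewrite /tail series_majE.
rewrite (_ : limn _ = 2^-1 * (kappa r1 r1 1 + kappa r2 r2 1)); first by rewrite /diag_rem; ring.
apply: cvg_lim => //; apply: cvgM; first exact: cvg_cst.
by apply: cvgD; exact: series_coef_diag.
Qed.

Lemma eseries_coef r : I r -> (\sum_(0 <= l <oo) (coef l r r)%:E)%E = (kappa r r 1)%:E.
Proof.
move=> hr; apply: cvg_lim => //.
rewrite (_ : (fun N => _) = EFin \o series (fun l => coef l r r)); last first.
  by apply: funext => N; rewrite /series/= sumEFin.
by apply: (cvg_comp _ _ (series_coef_diag hr)).
Qed.

Lemma coef_expansion : radial_expansion K coef.
Proof.
have pol x : (polar R n `*` polar R n) x -> [/\ I x.1.1, I x.2.1 & dotv x.1.2 x.2.2 \in `[-1, 1]].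
  move=> [[h1 s1] [h2 s2]]; split=> //; exact: sphere_dotv_itv.
split.
- by move=> l; split; [exact: coef_kernel|exact: coef_continuous].
- by move=> l l0; exact: coef00.
(* The diagonal sum is the continuous function [kappa r r 1], so its maximum is attained. *)
- have [r hr hmax] := EVT_max ler01 continuous_kappa1.
  exists r => //; rewrite eseries_coef//; split; first exact: ltry.
  by move=> t ht; rewrite eseries_coef// lee_fin hmax.
- by move=> x /pol[h1 h2 h3]; exact: (@normed_term_cvg R n hn K hK cK oK).
- apply/uniform_cvgP => e e0; have := rem_uniform e0; apply: filterS => L hL x px.
  have [h1 h2 h3] := pol x px; move: px => [[_ s1] [_ s2]].
  rewrite (@kappaE R n hn K oK)// -(@gsum_kappa R n hn K hK cK oK)//.
  have -> : series (expansion_term coef x) L = partial hn K x.1.1 x.2.1 L (dotv x.1.2 x.2.2).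
    by rewrite /partial /series/= big_mkord.
  apply: le_trans (@gsum_tail R n hn K hK cK oK _ _ L _ h1 h2 h3) _; rewrite tailE//.
  by have := hL _ h1; have := hL _ h2; lra.
Qed.

End expansion_converges.

(** * Kernels given by a radial expansion *)

Section converse.
Context (R : realType) (n : nat).
Hypothesis hn : (2 <= n)%N.
Notation S := (unit_sphere R n).
Notation B := (unit_ball R n).
Notation I := (unit_interval R).
Notation G := (gegenbauer (geg_index R n)).

Lemma kernel_row0 (c : R -> R -> R) r : is_kernel I c -> I r -> c 0 0 = 0 -> c 0 r = 0.
Proof.
move=> [sc pc] hr c00.
have I0 : I 0 by rewrite /unit_interval /= in_itv/= lexx ler01.
have hI (i : 'I_2) : I (if val i == 0%N then 0 else r) by case: ifP.
apply/eqP; apply: contraT => cr.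
(* Because [c 0 0 = 0], the form is affine in the weight at 0; this weight gives it the value -1. *)
have /= := pc 2%N _ (fun i => if val i == 0%N then - (c r r + 1) / (2 * c 0 r) else 1) hI.
rewrite !big_ord_recr !big_ord0 /= !add0r (sc r 0)// c00 mulr0 add0r !mulr1 !mul1r.
have -> : - (c r r + 1) / (2 * c 0 r) * c 0 r = - (c r r + 1) / 2 by field.
by move=> h; exfalso; lra.
Qed.

Lemma continuous_dotv : continuous (fun z : 'cV[R]_n * 'cV[R]_n => dotv z.1 z.2).
Proof.
move=> z; have -> : (fun z : 'cV[R]_n * 'cV[R]_n => dotv z.1 z.2) =
    (fun z => \sum_(i < n) z.1 i 0 * z.2 i 0) by apply: funext => y; rewrite dotvE.
apply: cvg_big => [|i _]; first exact: add_continuous.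
apply: cvgM.
  by apply: (@continuous_comp _ _ _ fst (fun x : 'cV[R]_n => x i 0)); [exact: cvg_fst|exact: coord_continuous].
by apply: (@continuous_comp _ _ _ snd (fun x : 'cV[R]_n => x i 0)); [exact: cvg_snd|exact: coord_continuous].
Qed.

Lemma continuous_enorm : continuous (@enorm R n).
Proof.
move=> x; apply: (@continuous_comp _ _ _ (fun x : 'cV[R]_n => dotv x x) Num.sqrt).
  apply: (@continuous_comp _ _ _ (fun x : 'cV[R]_n => (x, x)) (fun z => dotv z.1 z.2)).
    by have h : y @[y --> x] --> x; [exact: cvg_id|exact: (cvg_pair h h)].
  exact: continuous_dotv.
exact: sqrt_continuous.
Qed.

Lemma continuous_enorm2 : continuous (fun z : 'cV[R]_n * 'cV[R]_n => (enorm z.1, enorm z.2)).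
Proof.
move=> z.
have h1 : enorm x.1 @[x --> z] --> enorm z.1.
  by apply: (@continuous_comp _ _ _ fst (@enorm R n)); [exact: cvg_fst|exact: continuous_enorm].
have h2 : enorm x.2 @[x --> z] --> enorm z.2.
  by apply: (@continuous_comp _ _ _ snd (@enorm R n)); [exact: cvg_snd|exact: continuous_enorm].
exact: (cvg_pair h1 h2).
Qed.

Lemma ball_enorm z : B z -> I (enorm z).
Proof. by rewrite /unit_interval /= in_itv/= enorm_ge0 => ->. Qed.

(** The origin has no direction of its own and receives a basis vector, which is why the link to
    [normalize] is conditional. *)
Lemma polar_exists z : B z -> exists theta, [/\ S theta, z = enorm z *: theta & z != 0 -> theta = normalize z].
Proof.
move=> Bz; have [->|z0] := eqVneq z 0.
  by exists (basis_vec R (i0 hn)); rewrite enorm0 scale0r; split=> //; exact: sphere_basis.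
by exists (normalize z); split=> //; [exact: sphere_normalize|rewrite polar_decomposition].
Qed.

Lemma normalize0 : normalize (0 : 'cV[R]_n) = 0.
Proof. by rewrite /normalize scaler0. Qed.

Lemma dotv_normalize_itv (z1 z2 : 'cV[R]_n) : dotv (normalize z1) (normalize z2) \in `[-1, 1].
Proof.
have zero : (0 : R) \in `[-1, 1] by rewrite in_itv/=; apply/andP; split; lra.
have [->|h1] := eqVneq z1 0; first by rewrite normalize0 dot0v.
have [->|h2] := eqVneq z2 0; first by rewrite normalize0 dotv0.
by apply: sphere_dotv_itv; exact: sphere_normalize.
Qed.

Variables (K : 'cV[R]_n -> 'cV[R]_n -> R) (c : nat -> R -> R -> R).
Hypothesis hKc : radial_expansion K c.

Lemma expansion_uniform e : 0 < e -> \forall N \near \oo, forall r1 r2 t1 t2,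
  I r1 -> I r2 -> S t1 -> S t2 ->
  `|K (r1 *: t1) (r2 *: t2) - \sum_(l < N) c l r1 r2 * (G l).[dotv t1 t2]| <= e.
Proof.
move: hKc => [_ _ _ _ /uniform_cvgP h] e0; have := h e e0; apply: filterS => N hN r1 r2 t1 t2 h1 h2 s1 s2.
by have := hN ((r1, t1), (r2, t2)) (conj (conj h1 s1) (conj h2 s2)); rewrite /series/= big_mkord.
Qed.

(** A partial sum depends only on the radii and the inner product of the directions, so both values
    of [K] lie within [e / 2] of the same number. *)
Lemma expansion_O_invariant : O_invariant K.
Proof.
move=> Q z1 z2 oQ B1 B2.
have [t1 [s1 E1 _]] := polar_exists B1; have [t2 [s2 E2 _]] := polar_exists B2.
have I1 := ball_enorm B1; have I2 := ball_enorm B2.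
have oQt := orthogonal_tr oQ.
have sQ t : S t -> S (Q^T *m t) by rewrite /unit_sphere /= enorm_orthogonal.
rewrite E1 E2; move: (enorm z1) (enorm z2) I1 I2 => r1 r2 I1 I2.
rewrite -!scalemxAr; apply/eqP; rewrite -subr_eq0 -normr_le0; apply/ler_addgt0Pr => e e0.
have e2 : 0 < e / 2 by rewrite divr_gt0.
have [N _ /(_ N (leqnn N)) hN] := expansion_uniform e2.
have h1 := hN _ _ _ _ I1 I2 s1 s2.
have := hN _ _ _ _ I1 I2 (sQ _ s1) (sQ _ s2).
rewrite dotv_orthogonal// distrC => h2; rewrite add0r.
by rewrite [e]splitr; exact: le_trans (ler_distD _ _ _) (lerD h1 h2).
Qed.

(* [normalize 0 = 0] is harmless here: for [l = 0] the polynomial is constant, and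
   for [l > 0] the coefficient vanishes when one radius is 0. *)
Definition cart_term l (z : 'cV[R]_n * 'cV[R]_n) : R :=
  c l (enorm z.1) (enorm z.2) * (G l).[dotv (normalize z.1) (normalize z.2)].

Lemma radial_vanish l r : (0 < l)%N -> I r -> c l 0 r = 0 /\ c l r 0 = 0.
Proof.
move: hKc => [hc hc0 _ _ _] l0 hr; have [kc _] := hc l.
have I0 : I 0 by rewrite /unit_interval /= in_itv/= lexx ler01.
have h := kernel_row0 kc hr (hc0 l l0).
by split=> //; rewrite kc.1.
Qed.

Lemma cart_termE l z t1 t2 : B z.1 -> B z.2 ->
  (z.1 != 0 -> t1 = normalize z.1) -> (z.2 != 0 -> t2 = normalize z.2) ->
  cart_term l z = c l (enorm z.1) (enorm z.2) * (G l).[dotv t1 t2].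
Proof.
move=> B1 B2 h1 h2; rewrite /cart_term.
have I1 := ball_enorm B1; have I2 := ball_enorm B2.
case: l => [|l]; first by rewrite (gegenbauer0 R hn) !hornerC.
have [z1|/h1 ->] := eqVneq z.1 0.
  by rewrite z1 enorm0 (radial_vanish _ I2).1// !mul0r.
have [z2|/h2 -> //] := eqVneq z.2 0.
by rewrite z2 enorm0 (radial_vanish _ I1).2// !mul0r.
Qed.

Lemma continuous_cart_term l : {within B `*` B, continuous (cart_term l)}.
Proof.
have cc : {within B `*` B, continuous (fun z : 'cV[R]_n * 'cV[R]_n => c l (enorm z.1) (enorm z.2))}.
  move: hKc => [/(_ l)[_ kc] _ _ _ _].
  apply: (@within_continuous_into _ _ _ _ _ (fun z : 'cV[R]_n * 'cV[R]_n => (enorm z.1, enorm z.2)) _ _ _ kc).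
    exact: continuous_enorm2.
  by move=> z [B1 B2]; split; exact: ball_enorm.
case: l cc => [|l] cc.
  rewrite (_ : cart_term 0 = fun z => c 0 (enorm z.1) (enorm z.2))//.
  by apply: funext => z; rewrite /cart_term (gegenbauer0 R hn) hornerC mulr1.
move: cc => /subspace_continuousP cc; apply/subspace_continuousP => z0 Bz0.
have {}cc := cc _ Bz0; rewrite /from_subspace.
(* Where a radius vanishes, the coefficient tends to 0 while the Gegenbauer factor stays bounded by
   1, however the directions behave; elsewhere [normalize] is continuous. *)
have [z00|] := boolP ((z0.1 == 0) || (z0.2 == 0)).
  have c0 : c l.+1 (enorm z0.1) (enorm z0.2) = 0.
    case/orP: z00 => /eqP ->; rewrite enorm0.
      by rewrite (radial_vanish _ (ball_enorm Bz0.2)).1.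
    by rewrite (radial_vanish _ (ball_enorm Bz0.1)).2.
  have -> : cart_term l.+1 z0 = 0 by rewrite /cart_term c0 mul0r.
  apply/cvgrPdist_le => e e0.
  move: cc => /cvgrPdist_le/(_ e e0); apply: filterS => z /=.
  rewrite /from_subspace c0 !sub0r !normrN; apply: le_trans.
  by rewrite /cart_term normrM ler_piMr// (gegenbauer_le1 hn)// dotv_normalize_itv.
rewrite negb_or => /andP[z1 z2]; apply: cvgM; first exact: cc.
apply: (cvg_within_filter (F := nbhs z0)).
pose f (z : 'cV[R]_n * 'cV[R]_n) : R := (enorm z.1)^-1 * (enorm z.2)^-1 * dotv z.1 z.2.
have fE z : dotv (normalize z.1) (normalize z.2) = f z.
  by rewrite /normalize dotvZl dotvC dotvZl dotvC mulrA.
rewrite (_ : (fun z => _) = (fun z => (G l.+1).[f z])); last by apply: funext => z; rewrite fE.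
rewrite fE; apply: (@continuous_comp _ _ _ f (horner (G l.+1))); last exact: continuous_horner.
apply: cvgM; last exact: continuous_dotv.
apply: cvgM; apply: cvgV; rewrite ?enorm_eq0//.
  by apply: (@continuous_comp _ _ _ fst (@enorm R n)); [exact: cvg_fst|exact: continuous_enorm].
by apply: (@continuous_comp _ _ _ snd (@enorm R n)); [exact: cvg_snd|exact: continuous_enorm].
Qed.

Lemma expansion_continuous : kernel_continuous B K.
Proof.
apply/subspace_continuousP => z0 Bz0; apply/cvgrPdist_le => e e0.
have e3 : 0 < e / 3 by rewrite divr_gt0.
have [N _ /(_ N (leqnn N)) hN] := expansion_uniform e3.
pose P z := \sum_(l < N) cart_term l z.
have KP z : (B `*` B) z -> `|K z.1 z.2 - P z| <= e / 3.
  move=> [B1 B2]; have [t1 [s1 E1 F1]] := polar_exists B1; have [t2 [s2 E2 F2]] := polar_exists B2.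
  have := hN _ _ _ _ (ball_enorm B1) (ball_enorm B2) s1 s2; rewrite -E1 -E2.
  rewrite (_ : P z = \sum_(l < N) c l (enorm z.1) (enorm z.2) * (G l).[dotv t1 t2])//.
  by apply: eq_bigr => l _; exact: cart_termE.
have cP : P z @[z --> within (B `*` B) (nbhs z0)] --> P z0.
  apply: cvg_big => [|l _]; first exact: add_continuous.
  by have /subspace_continuousP/(_ _ Bz0) := continuous_cart_term (l := l).
move: cP => /cvgrPdist_le/(_ _ e3); rewrite !near_withinE; apply: filterS => z hz Bz.
have {}hz := hz Bz; have k1 := KP _ Bz0; have k2 := KP _ Bz.
apply: le_trans (ler_distD (P z0) _ _) _.
have := ler_distD (P z) (P z0) (K z.1 z.2); rewrite (distrC (P z) (K _ _)) => k3.
by move: k1 k2 k3 hz; lra.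
Qed.

End converse.

(** * Recovering the coefficients by integration *)

Section coefficient_formula.
Context (R : realType) (n : nat).
Hypothesis hn : (2 <= n)%N.
Notation S := (unit_sphere R n).
Notation I := (unit_interval R).
Notation G := (gegenbauer (geg_index R n)).
Notation gnorm := (gnorm R n).
Notation wintp p := (wint n (fun s => (p : {poly R}).[s])).

Variables (K : 'cV[R]_n -> 'cV[R]_n -> R) (c : nat -> R -> R -> R).
Hypothesis hKc : radial_expansion K c.
Variables (r1 r2 : R) (theta : 'cV[R]_n).
Hypotheses (h1 : I r1) (h2 : I r2) (Stheta : S theta).
Let f y := K (r1 *: theta) (r2 *: y).
Let p N : {poly R} := \sum_(k < N) c k r1 r2 *: G k.

Let f_approx e : 0 < e -> \forall N \near \oo, forall y, S y ->
  `|f y - (p N).[dotv theta y]| <= e.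
Proof.
move=> e0; have := expansion_uniform hKc e0; apply: filterS => N hN y Sy.
have := hN _ _ _ _ h1 h2 Stheta Sy.
rewrite horner_sum; under eq_bigr do rewrite -hornerZ.
by [].
Qed.

Let p_adm N : adm (fun y => (p N).[dotv theta y]).
Proof. by apply: adm_horner; exact: adm_dotv. Qed.

(** On the sphere [f] is a limit of polynomials, hence measurable and bounded; it is cut to 0
    elsewhere, where the expansion says nothing about [K]. *)
Let f_adm : adm (f \_ S).
Proof.
split.
  apply/(measurable_restrictT _ (@measurable_unit_sphere R n)).
  apply: (measurable_fun_cvg (h := fun N y => (p N).[dotv theta y])).
    by move=> N; apply: measurable_funTS; exact: (p_adm N).1.
  move=> y Sy; apply/cvgrPdist_le => e e0; have := f_approx e0.
  by apply: filterS => N /(_ y Sy).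
have [N _ /(_ N (leqnn N)) hN] := f_approx ltr01.
have [M hM] := (p_adm N).2; exists (1 + M) => y Sy; rewrite patchE mem_set//.
rewrite -[f y](subrK (p N).[dotv theta y]); apply: le_trans (ler_normD _ _) _.
by apply: lerD; [exact: hN|exact: hM].
Qed.

Lemma sint_expansion l :
  sint (fun y => f y * (G l).[dotv theta y]) = c l r1 r2 * gnorm l * sphere_area R n.-1.
Proof.
have aG : adm (fun y => (G l).[dotv theta y]) by apply: adm_horner; exact: adm_dotv.
have aF : adm (fun y => (f \_ S) y * (G l).[dotv theta y]) by exact: admM.
rewrite (@eq_sint _ _ _ (fun y => (f \_ S) y * (G l).[dotv theta y])); last first.
  by move=> y Sy; rewrite patchE mem_set.
apply/eqP; rewrite -subr_eq0 -normr_le0; apply/ler_addgt0Pr => e e0; rewrite add0r.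
have A0 : 0 < sphere_area R n by apply: sphere_area_gt0; exact: ltnW.
have eA : 0 < e / sphere_area R n by rewrite divr_gt0.
(* [N] exceeds [l], so the polynomial [p N] already has the coefficient [c l r1 r2] and its integral
   is exact. *)
have [N0 _ hN0] := f_approx eA; pose N := maxn N0 l.+1.
have {hN0}hN := hN0 N (leq_maxl _ _).
have aP : adm (fun y => (p N).[dotv theta y] * (G l).[dotv theta y]) by exact: admM.
have -> : c l r1 r2 * gnorm l * sphere_area R n.-1 =
    sint (fun y => (p N).[dotv theta y] * (G l).[dotv theta y]).
  rewrite (@eq_sint _ _ _ (fun y => (p N * G l).[dotv theta y])); last first.
    by move=> y _; rewrite hornerM.
  rewrite sint_zonal// (wint_gegenbauer_sum hn (fun k => c k r1 r2)) 1?mulrC//.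
  by rewrite leq_max ltnSn orbT.
have bound y : S y -> `|(f \_ S) y * (G l).[dotv theta y] -
    (p N).[dotv theta y] * (G l).[dotv theta y]| <= e / sphere_area R n.
  move=> Sy; rewrite -mulrBl normrM patchE mem_set//.
  rewrite -[leRHS]mulr1; apply: ler_pM => //; first exact: hN.
  by apply: (gegenbauer_le1 hn); exact: sphere_dotv_itv.
rewrite -sintB// ler_norml -[e](divfK (lt0r_neq0 A0)) -mulNr -!sint_cst.
apply/andP; split; apply: sint_le => //; try exact: adm_cst; try exact: admB.
  by move=> y /bound; rewrite ler_norml => /andP[].
by move=> y /bound; rewrite ler_norml => /andP[].
Qed.

End coefficient_formula.

Theorem theorem4p8 (R : realType) (n : nat) (hn : (2 <= n)%N)
    (K : 'cV[R]_n -> 'cV[R]_n -> R) (hK : is_kernel (unit_ball R n) K) :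
  ((kernel_continuous (unit_ball R n) K /\ O_invariant K) <->
   (exists c : nat -> R -> R -> R, radial_expansion K c)) /\
  (forall c : nat -> R -> R -> R, radial_expansion K c ->
   forall (l : nat) (r1 r2 : R) (theta1 : 'cV[R]_n),
     unit_interval R r1 -> unit_interval R r2 -> unit_sphere R n theta1 ->
     c l r1 r2 =
       (gegenbauer_sqnorm (geg_index R n) l * sphere_area R n.-1)^-1 *
       \int[surface_measure R n]_(theta2 in unit_sphere R n)
         (K (r1 *: theta1) (r2 *: theta2) *
          (gegenbauer (geg_index R n) l).[dotv theta1 theta2])).
Proof.
split; first split.
- by move=> [cK oK]; exists (coef hn K); exact: coef_expansion.
- move=> [c hKc]; split; first exact: (expansion_continuous hn hKc).
  exact: (expansion_O_invariant hn hKc).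
move=> c hKc l r1 r2 theta h1 h2 St.
have := sint_expansion hn hKc h1 h2 St l; rewrite /sint => ->.
have g0 := lt0r_neq0 (gnorm_gt0 R hn l); have a0 := lt0r_neq0 (c0_gt0 R hn).
by rewrite gegenbauer_sqnormE; field; rewrite g0 a0.
Qed.
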